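(* For every choice of positive integers $b,\ell,k,m,r$ with $k\le m$ there exists a positive integer $n_0$ with the following property. For every integer $n\ge n_0$, every finite alphabet $\Lambda$ with $\ell$ elements and every $r$-coloring of $\mathrm{W}_{v,k}(b,n,\Lambda)$ there exists $f$ in $\mathrm{W}_{v,m}(b,n,\Lambda)$ such that the set $\mathrm{W}_{v,k}(f)$ is monochromatic.
   Context: Trees. For positive integers $b,n$, $b^{<n}$ is the set of all finite sequences with entries in $\{0,\dots,b-1\}$ of length less than $n$ (including the empty sequence). $|s|$ is the length of $s$, $s(i)$ its $i$-th entry ($0\le i<|s|$), $s^\frown(i)$ is $s$ extended by the entry $i$, $\sqsubseteq$ is the initial segment ordering (strict version $\sqsubset$). The lexicographical order: $s\le_{\mathrm{lex}}t$ iff either $s\sqsubseteq t$, or $s,t$ are $\sqsubseteq$-incomparable and $s(i)<t(i)$ where $i$ is the length of the longest common initial segment of $s,t$. A subtree of $b^{<n}$ is a subset $S\subseteq b^{<n}$ ordered by $\sqsubseteq$. For $s\in S$: $\mathrm{Pred}_S(s)=\{t\in S: t\sqsubset s\}$; $\mathrm{h}_S(s)=|\mathrm{Pred}_S(s)|$; $\mathrm{ImSucc}_S(s)$ is the set of $t\in S$ with $s\sqsubset t$ such that no $t'\in S$ satisfies $s\sqsubset t'\sqsubset t$. For a positive integer $k$, a $k$-complete skew subtree of $b^{<n}$ is a subtree $S$ such that: (i) $S$ has a $\sqsubseteq$-minimum and every $\sqsubseteq$-maximal chain of $S$ has cardinality $k$; (ii) if $s,s'\in S$, $\mathrm{h}_S(s)=\mathrm{h}_S(s')$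 and $s\le_{\mathrm{lex}}s'$, then $|s|\le|s'|$; (iii) if $s,s'\in S$ and $\mathrm{h}_S(s)<\mathrm{h}_S(s')$, then $|s|<|s'|$; (iv) for every non-$\sqsubseteq$-maximal $s\in S$ and every $i\in\{0,\dots,b-1\}$ there is a unique $t\in\mathrm{ImSucc}_S(s)$ with $s^\frown(i)\sqsubseteq t$. Variable words. Let $\Lambda$ be a finite alphabet and let $(v_t)_{t\in b^{<n}}$ be distinct symbols (variables) not in $\Lambda$. For a $k$-complete skew subtree $T$ of $b^{<n}$, a $T$-variable word is a map $f:b^{<n}\to\Lambda\cup\{v_t:t\in T\}$ such that for every $t\in T$ the set $f^{-1}(v_t)$ is nonempty and has $t$ as its $\sqsubseteq$-minimum; write $\mathrm{ws}(f)=T$ (it is uniquely determined by $f$). $\mathrm{W}_{v,k}(b,n,\Lambda)$ is the set of all $T$-variable words over all $k$-complete skew subtrees $T$ of $b^{<n}$. For a variable word $f$ and $(\alpha_t)_{t\in\mathrm{ws}(f)}\in\Lambda^{\mathrm{ws}(f)}$, let $f((\alpha_t)_{t\in\mathrm{ws}(f)})$ be the map $b^{<n}\to\Lambda$ obtained from $f$ by substituting each occurrence of $v_t$ by $\alpha_t$, for all $t\in\mathrm{ws}(f)$. The span of $f$ is $[f]_\Lambda=\{f((\alpha_t)_{t\in\mathrm{ws}(f)}):(\alpha_t)_{t\in\mathrm{ws}(f)}\in\Lambda^{\mathrm{ws}(f)}\}$. For $f\in\mathrm{W}_{v,m}(b,n,\Lambda)$ and a positive integer $k\le m$, $\mathrm{W}_{v,k}(f)=\{g\in\mathrm{W}_{v,k}(b,n,\Lambda):[g]_\Lambda\subseteq[f]_\Lambda\}$.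 An $r$-coloring of a set is a map from it to a set with $r$ elements; a subset is monochromatic if the coloring is constant on it.
   Formalization: Proved for ℓ ≥ 2 instead of ℓ ≥ 1: for ℓ = 1 all spans coincide, so W_{v,k}(f) is all of W_{v,k}(b,n,Λ), which has at least two elements for large n, and the claim fails for every r ≥ 2. *)

(* Defs.v *)
From mathcomp Require Import all_boot.

Set Implicit Arguments.
Unset Strict Implicit.
Unset Printing Implicit Defensive.

(* b^{<n} for positive n: the sequences of length at most n - 1 *)
Notation node b n := (n.-1.-bseq 'I_b).

(* [prefix s t] is the initial segment ordering; this is its strict version *)
Definition sprefix (T : eqType) (s t : seq T) : bool :=
  prefix s t && (s != t).

(* length of the longest common initial segment *)
Fixpoint lcp (T : eqType) (s t : seq T) : nat :=
  match s, t with
  | x :: s', y :: t' => if x == y then (lcp s' t').+1 else 0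
  | _, _ => 0
  end.

(* For incomparable s and t, [lcp s t] is smaller than both lengths, so the
   default value of [nth] plays no role *)
Definition lex_le (b : nat) (s t : seq 'I_b) : bool :=
  prefix s t ||
  [&& ~~ prefix s t, ~~ prefix t s &
      nth 0 (map val s) (lcp s t) < nth 0 (map val t) (lcp s t)].

Section Trees.

Variables b n : nat.
Implicit Types (S C : {set node b n}) (s t : node b n).

Definition Preds S s : {set node b n} := [set t in S | sprefix t s].

Definition height S s : nat := #|Preds S s|.

Definition ImSucc S s : {set node b n} :=
  [set t in S | sprefix s t
                && ~~ [exists t' in S, sprefix s t' && sprefix t' t]].

Definition chain C : bool :=
  [forall s in C, forall t in C, prefix s t || prefix t s].

Definition max_chain S C : bool :=
  maxset (fun D : {set node b n} => (D \subset S) && chain D) C.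

Definition nonmaximal S s : bool := [exists t in S, sprefix s t].

Definition complete_skew (k : nat) S : bool :=
  [&& [exists s in S, forall t in S, prefix s t],
      [forall C : {set node b n}, max_chain S C ==> (#|C| == k)],
      [forall s in S, forall s' in S,
         (height S s == height S s') ==> lex_le s s' ==> (size s <= size s')],
      [forall s in S, forall s' in S,
         (height S s < height S s') ==> (size s < size s')]
    & [forall s in S, nonmaximal S s ==>
         [forall i : 'I_b,
            #|[set t in ImSucc S s | prefix (rcons s i) t]| == 1]]].

End Trees.

(* [inl a] is the letter a and [inr t] is the variable v_t *)
Notation word b n L := {ffun node b n -> L + node b n}.

Section Words.

Variables (b n : nat) (L : finType).
Implicit Types (T : {set node b n}) (f g : word b n L) (s t x : node b n).

(* The first conjunct says that f takes values in L together with the v_t for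
   t in T, the second that t is the minimum of the (hence nonempty) set
   f^{-1}(v_t) for every t in T *)
Definition varword T f : bool :=
  [forall x, if f x is inr t then t \in T else true] &&
  [forall t in T, (f t == inr t) &&
                  [forall x, (f x == inr t) ==> prefix t x]].

Definition ws f : {set node b n} := [set t | [exists x, f x == inr t]].

Lemma varword_ws T f : varword T f -> ws f = T.
Proof.
case/andP=> /forallP fT /forall_inP Tf; apply/setP=> t; rewrite inE.
apply/existsP/idP => [[x /eqP fx]|tT]; first by have := fT x; rewrite fx.
by exists t; case/andP: (Tf t tT).
Qed.

Definition Wv (k : nat) : {set word b n L} :=
  [set f | [exists T : {set node b n}, complete_skew k T && varword T f]].

(* The values of alpha outside [ws f] are irrelevant, as [ws f] is the set of
   all t such that v_t occurs in f *)
Definition subst f (alpha : {ffun node b n -> L}) : {ffun node b n -> L} :=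
  [ffun x => match f x with inl a => a | inr t => alpha t end].

Definition span f : {set {ffun node b n -> L}} :=
  [set subst f alpha | alpha : {ffun node b n -> L}].

Definition Wv_in (k : nat) f : {set word b n L} :=
  [set g in Wv k | span g \subset span f].

(* Over a one-letter alphabet all spans are equal, so that [Wv_in k f] is the
   whole of [Wv k] *)
Lemma Wv_in_card1 (k : nat) f : #|L| = 1 -> Wv_in k f = Wv k.
Proof.
move=> L1; apply/setP=> g; rewrite inE andb_idr // => _.
have irr (u v : {ffun node b n -> L}) : u = v.
  by apply/ffunP=> x; apply: (fintype_le1P _); rewrite L1.
by apply/subsetP=> u /imsetP[alpha _ ->]; apply/imsetP; exists alpha.
Qed.

Definition monochromatic (k : nat) (C : Type)
    (c : {g : word b n L | g \in Wv k} -> C) (A : {set word b n L}) : Prop :=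
  forall g h : {g : word b n L | g \in Wv k},
    val g \in A -> val h \in A -> c g = c h.

End Words.

(* Main.v *)
Require Import Defs.
From mathcomp Require Import all_boot.
From mathcomp Require Import zify.

Set Implicit Arguments.
Unset Strict Implicit.
Unset Printing Implicit Defensive.

(* A variable word f whose variables form a strong subtree of the infinite tree is a copy of
   the tree inside itself, and such words compose. A word g with [g] included in [f] is a
   substitution instance of f: it is obtained from f by replacing each variable by a letter or
   by a variable of g. Hence g is coded by a map h on the tree, with values the letters and the
   names of the nodes of b^{<k}, and by the branches y through the tree of g. A colouring is
   made constant on all codes in three steps.
   One level: f can be stretched above level p so that the colour does not depend on the
   letters put in the slots of that level. The admissible pairs (letter, direction in which a
   branch crosses the slot) are added one at a time. For a new one, apply the previous case on
   many consecutive levels and use the pigeonhole principle on words which change from the new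
   letter to the default one at a varying level. Treating the variables already introduced as
   additional letters, one gets insensitivity to everything but the next new variable.
   One new variable: iterating over the levels, by the pigeonhole principle and fusion the
   colour depends neither on the level where the next variable of g first occurs nor on the
   contents of the levels in between.
   Induction: the variables of g first occur on distinct levels, in the order of b^{<k} by
   length and then lexicographically, so they can be treated one by one starting from the last.
   Finally b^{<m} is placed in the infinite tree with all its nodes on distinct levels, in the
   same order, which makes the order of the variables of g the same for all g. *)

(** Every bound on levels is fixed before the colouring is given. The reason is that composites are
    built from the outside: in a composite of [g] with an inner word [f], the word [g] is chosen
    first, for the level that [f] is going to reach, and [f] is chosen afterwards for the colouring
    induced by [g]. That colouring may have to answer for contents which are not known yet, so its
    colours are tuples or functions of colours; this is why each statement ranges over all finite
    sets of colours. Directions have to be treated together with letters: two instances with the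
    same variables may differ both in their letters and in the route taken by the tree of first
    occurrences. Two branches part only at the first occurrence of a variable, so at every other
    slot a single direction describes the route. The order of adjunction matters. The word which
    adjoins a crossed pair fills vacant nodes with its letter, so all vacant pairs have to be
    available before. *)

Section Prefixes.
Variable T : eqType.
Implicit Types x y z : seq T.

Lemma prefix_take_eq x y : prefix x y -> take (size x) y = x.
Proof. by rewrite prefixE => /eqP. Qed.

Lemma prefix_rcons_inv x y d : prefix x (rcons y d) -> x = rcons y d \/ prefix x y.
Proof.
move=> /[dup] /size_prefix; rewrite size_rcons leq_eqVlt => /orP[/eqP e|lt] p.
  left; move/prefix_take_eq: p => <-; by rewrite take_oversize // size_rcons e.
right; move/prefix_take_eq: p => <-.
by rewrite -cats1 takel_cat ?prefix_take // -ltnS.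
Qed.

Lemma prefix_anti x y : prefix x y -> prefix y x -> x = y.
Proof.
move=> xy yx; have e : size x = size y.
  by apply/eqP; rewrite eqn_leq !size_prefix.
by rewrite -(prefix_take_eq xy) e take_size.
Qed.

Lemma prefix_take_le x y n : prefix x y -> size x <= n -> prefix x (take n y).
Proof.
move=> xy xn; rewrite -(prefix_take_eq xy).
by rewrite -(take_takel y xn) prefix_take.
Qed.

Lemma prefix_rcons_nth (x0 : T) x y : prefix x y -> size x < size y ->
  prefix (rcons x (nth x0 y (size x))) y.
Proof.
move=> xy lt; rewrite -{1}(prefix_take_eq xy) -take_nth //; exact: prefix_take.
Qed.

Lemma nth_prefix (x0 : T) x y i : prefix x y -> i < size x -> nth x0 y i = nth x0 x i.
Proof. by move=> /prefix_take_eq <- ; rewrite size_take_min => h; rewrite nth_take //; lia. Qed.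

Lemma prefix_total x y z : prefix x z -> prefix y z -> size x <= size y -> prefix x y.
Proof.
move=> xz yz le; rewrite -(prefix_take_eq yz); exact: prefix_take_le.
Qed.

Lemma prefix_eq_size x y z : prefix x z -> prefix y z -> size x = size y -> x = y.
Proof. by move=> /prefix_take_eq xz /prefix_take_eq yz e; rewrite -xz -yz e. Qed.

Lemma take_eq_le m n x y : m <= n -> take n x = take n y -> take m x = take m y.
Proof. by move=> mn e; rewrite -(take_takel x mn) -(take_takel y mn) e. Qed.

Lemma take_rcons_size x c : take (size x) (rcons x c) = x.
Proof. by rewrite -cats1 take_size_cat. Qed.

Lemma nth_rcons_size (x0 : T) x c : nth x0 (rcons x c) (size x) = c.
Proof. by rewrite nth_rcons ltnn eqxx. Qed.

End Prefixes.

(** * Strong words *)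

Section StrongWords.
Variables (D : finType) (d0 : D) (A : Type).
Notation node := (seq D).

(* The variable indexed by x first occurs at [ft f x]; [fe f x] is the slot below it, and the
   slots of level n all lie on level [fl f n]. The word itself is [fv f]. *)
Record strong_word : Type := StrongWord {
  fv : node -> A + node;
  fe : node -> node;
  ft : node -> node;
  fl : nat -> nat;
  fe_size : forall x, size (fe x) = fl (size x);
  fe_ft : forall x, prefix (fe x) (ft x);
  ft_fe : forall x d, prefix (rcons (ft x) d) (fe (rcons x d));
  fv_ft : forall x, fv (ft x) = inr x;
  fv_inr : forall z x, fv z = inr x -> prefix (ft x) z }.

Implicit Types (f g : strong_word) (x y z u : node).

Lemma ft_size_ge f x : fl f (size x) <= size (ft f x).
Proof. by rewrite -fe_size size_prefix // fe_ft. Qed.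

Lemma ft_size_lt f x : size (ft f x) < fl f (size x).+1.
Proof.
have := size_prefix (ft_fe f x d0); by rewrite size_rcons fe_size size_rcons.
Qed.

Lemma flS f n : fl f n < fl f n.+1.
Proof.
have := ft_size_lt f (nseq n d0); have := ft_size_ge f (nseq n d0).
by rewrite size_nseq; lia.
Qed.

Lemma fl_lt f m n : m < n -> fl f m < fl f n.
Proof.
elim: n => // n IH; rewrite ltnS leq_eqVlt => /orP[/eqP->|/IH h]; first exact: flS.
exact: ltn_trans h (flS f n).
Qed.

Lemma fl_le f m n : (fl f m <= fl f n) = (m <= n).
Proof.
case: (leqP m n) => [|/(fl_lt f)]; last by rewrite ltnNge => /negbTE.
by rewrite leq_eqVlt => /orP[/eqP->|/(fl_lt f)/ltnW]; rewrite ?leqnn.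
Qed.

Lemma fl_ltE f m n : (fl f m < fl f n) = (m < n).
Proof. by rewrite !ltnNge fl_le. Qed.

Lemma fl_ge f n : n <= fl f n.
Proof. by elim: n => // n IH; apply: leq_ltn_trans IH (flS f n). Qed.

Lemma fe_mono f x y : prefix x y -> prefix (fe f x) (fe f y).
Proof.
elim/last_ind: y => [|y d IH].
  by rewrite prefixs0 => /eqP->; apply: prefix_refl.
move=> /prefix_rcons_inv[->|/IH h]; first exact: prefix_refl.
apply: prefix_trans h _; apply: prefix_trans (fe_ft _ _) _.
exact: prefix_trans (prefix_rcons _ _) (ft_fe _ _ _).
Qed.

Lemma ft_fe_rcons f x y d : prefix (rcons x d) y -> prefix (rcons (ft f x) d) (fe f y).
Proof. by move=> h; apply: prefix_trans (ft_fe _ _ _) (fe_mono _ h). Qed.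

Lemma ft_fe_lt f x y : prefix x y -> size x < size y ->
  prefix (rcons (ft f x) (nth d0 y (size x))) (fe f y).
Proof. by move=> xy lt; apply: ft_fe_rcons; apply: prefix_rcons_nth. Qed.

Lemma ft_prefix_fe f x y : prefix x y -> size x < size y -> prefix (ft f x) (fe f y).
Proof. by move=> xy lt; apply: prefix_trans (prefix_rcons _ _) (ft_fe_lt f xy lt). Qed.

Lemma ft_mono f x y : prefix x y -> prefix (ft f x) (ft f y).
Proof.
move=> xy; case: (ltnP (size x) (size y)) => h.
  exact: prefix_trans (ft_prefix_fe f xy h) (fe_ft _ _).
have -> : x = y; last exact: prefix_refl.
rewrite -(prefix_take_eq xy) take_oversize //.
Qed.

Lemma take_fe f n x : n <= size x -> take (fl f n) (fe f x) = fe f (take n x).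
Proof.
move=> nx; have h : size (take n x) = n by rewrite size_takel.
by have := prefix_take_eq (fe_mono f (prefix_take x n)); rewrite fe_size h.
Qed.

Lemma take_ft f x y : prefix x y -> size x < size y -> take (size (ft f x)) (fe f y) = ft f x.
Proof. by move=> xy h; rewrite (prefix_take_eq (ft_prefix_fe f xy h)). Qed.

Lemma nth_ft f x y : prefix x y -> size x < size y ->
  nth d0 (fe f y) (size (ft f x)) = nth d0 y (size x).
Proof.
move=> xy lt; rewrite (nth_prefix d0 (ft_fe_lt f xy lt)) ?size_rcons //.
by rewrite nth_rcons ltnn eqxx.
Qed.

(** The entry of [fe f y] at position [size (ft f x)] is the entry of [y] at [size x] for each
    proper initial segment [x] of [y], so [y] can be read off from [fe f y]. *)
Lemma fe_inj f : injective (fe f).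
Proof.
move=> x y e; have s : size x = size y.
  by apply/eqP; rewrite eqn_leq -(fl_le f) -(fl_le f (size y)) -!fe_size e leqnn.
elim/last_ind: x y s e => [|x d IH] y; first by case: y.
elim/last_ind: y => [|y d' _]; rewrite ?size_rcons // => -[s] e.
have exy : x = y.
  apply: IH => //.
  have := @take_fe f (size x) (rcons x d); rewrite size_rcons => /(_ (leqnSn _)).
  rewrite take_rcons_size => <-; rewrite e s.
  by rewrite take_fe ?size_rcons // take_rcons_size.
have := @nth_ft f x (rcons x d) (prefix_rcons _ _); rewrite size_rcons => /(_ (leqnn _)).
rewrite nth_rcons_size e exy => <-.
have := @nth_ft f y (rcons y d') (prefix_rcons _ _); rewrite size_rcons => /(_ (leqnn _)) ->.
by rewrite nth_rcons_size.
Qed.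

(** Since [ft f y] is shorter than [fl f (size y).+1], [x] is no longer than [y]. The slot of that
    length below [ft f y] belongs to an initial segment of [y], and slots determine their
    indices. *)
Lemma fe_ft_reflect f x y : prefix (fe f x) (ft f y) -> prefix x y.
Proof.
move=> h; have le : size x <= size y.
  rewrite -ltnS -(fl_ltE f) -fe_size; apply: leq_ltn_trans (ft_size_lt f y).
  exact: size_prefix.
have e : fe f (take (size x) y) = fe f x.
  apply: prefix_eq_size h _; last by rewrite !fe_size size_takel.
  exact: prefix_trans (fe_mono f (prefix_take _ _)) (fe_ft _ _).
by rewrite -(fe_inj e) prefix_take.
Qed.

Lemma ft_reflect f x y : prefix (ft f x) (ft f y) -> prefix x y.
Proof. by move=> h; apply: fe_ft_reflect; apply: prefix_trans (fe_ft f x) h. Qed.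

Lemma fe_reflect f x y : prefix (fe f x) (fe f y) -> prefix x y.
Proof. by move=> h; apply: fe_ft_reflect; apply: prefix_trans h (fe_ft f y). Qed.

Lemma fv_inr_size f z u n : fv f z = inr u -> size z < fl f n -> size u < n.
Proof.
move=> /fv_inr/size_prefix h1 h2; rewrite -(fl_ltE f).
by apply: leq_ltn_trans (leq_trans (ft_size_ge f u) h1) h2.
Qed.

Definition id_word : strong_word.
Proof.
refine (@StrongWord inr id id id _ _ _ _ _) => //.
- by move=> x; apply: prefix_refl.
- by move=> x d; apply: prefix_refl.
- by move=> z x [->]; apply: prefix_refl.
Defined.

Definition comp_word f g : strong_word.
Proof.
refine (@StrongWord (fun z => match fv f z with inl a => inl a | inr u => fv g u end)
  (fe f \o fe g) (ft f \o ft g) (fl f \o fl g) _ _ _ _ _).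
- by move=> x /=; rewrite !fe_size.
- by move=> x /=; apply: prefix_trans (fe_mono f (fe_ft g x)) (fe_ft f _).
- by move=> x d /=; apply: ft_fe_rcons; apply: ft_fe.
- by move=> x /=; rewrite !fv_ft.
- move=> z x /=; case E: (fv f z) => [//|u] /fv_inr h.
  exact: prefix_trans (ft_mono f h) (fv_inr E).
Defined.

Lemma comp_fl f g n : fl (comp_word f g) n = fl f (fl g n). Proof. by []. Qed.
Lemma comp_fe f g x : fe (comp_word f g) x = fe f (fe g x). Proof. by []. Qed.
Lemma comp_ft f g x : ft (comp_word f g) x = ft f (ft g x). Proof. by []. Qed.

Section Subst.
Variables (W : Type) (iota : A -> W).
Implicit Types h : node -> W.

Definition sub f h z : W := match fv f z with inl a => iota a | inr u => h u end.

Lemma sub_comp f g h z : sub (comp_word f g) h z = sub f (sub g h) z.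
Proof. by rewrite /sub /=; case: (fv f z). Qed.

(** This locality allows a colouring of the levels below [fl f n] to be pulled back along [f] to a
    colouring of the levels below [n]. *)
Lemma sub_lt f n h h' : (forall x, size x < n -> h x = h' x) ->
  forall z, size z < fl f n -> sub f h z = sub f h' z.
Proof.
move=> e z hz; rewrite /sub; case E: (fv f z) => [//|u].
by apply: e; apply: fv_inr_size E hz.
Qed.

Lemma sub_ft f h x : sub f h (ft f x) = h x.
Proof. by rewrite /sub fv_ft. Qed.

End Subst.

(** Three degrees of leaving the levels below [p] alone. Under [fixes] the slots of level [p] may
    still move up, as happens when levels are thinned out. The condition [low] also forbids an early
    variable to recur higher up; it is lost once letters are turned back into earlier variables. *)
Definition fixes p f := forall x, size x < p -> ft f x = x.
Definition strongly_fixes p f := fixes p f /\ forall x, size x <= p -> fe f x = x.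
Definition low p f := forall z u, fv f z = inr u -> size u < p -> z = u.

Lemma fixes_fv p f x : fixes p f -> size x < p -> fv f x = inr x.
Proof. by move=> h xp; rewrite -{1}(h x xp) fv_ft. Qed.

Lemma fixes_fe_prefix p f x : fixes p f -> size x <= p -> prefix x (fe f x).
Proof.
move=> h; elim/last_ind: x => [_|x d _]; first exact: prefix0s.
by rewrite size_rcons => xp; have := ft_fe f x d; rewrite h.
Qed.

Lemma fixes_take p f x n : fixes p f -> n <= p -> n <= size x -> take n (fe f x) = take n x.
Proof.
move=> h np nx; have := prefix_trans (fixes_fe_prefix h (_ : size (take n x) <= p))
  (fe_mono f (prefix_take x n)); rewrite size_takel // => /(_ np) /prefix_take_eq.
by rewrite size_takel.
Qed.

Lemma fixes_le p q f : p <= q -> fixes q f -> fixes p f.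
Proof. by move=> pq h x xp; apply: h; apply: leq_trans xp pq. Qed.

Lemma strongly_fixes_le p q f : p <= q -> strongly_fixes q f -> strongly_fixes p f.
Proof.
move=> pq [h1 h2]; split; first exact: fixes_le pq h1.
by move=> x xp; apply: h2; apply: leq_trans xp pq.
Qed.

Lemma low_le p q f : p <= q -> low q f -> low p f.
Proof. by move=> pq h z u e up; apply: h e _; apply: leq_trans up pq. Qed.

Lemma fixes_comp p f g : fixes p f -> fixes p g -> fixes p (comp_word f g).
Proof. by move=> hf hg x xp /=; rewrite hg ?hf. Qed.

Lemma strongly_fixes_comp p f g : strongly_fixes p f -> strongly_fixes p g ->
  strongly_fixes p (comp_word f g).
Proof.
move=> [hf hf'] [hg hg']; split; first exact: fixes_comp.
by move=> x xp /=; rewrite hg' ?hf'.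
Qed.

Lemma low_comp p f g : low p f -> low p g -> low p (comp_word f g).
Proof.
move=> hf hg z u /=; case E: (fv f z) => [//|w] e up.
by have ew := hg _ _ e up; rewrite ew in E; apply: hf E up.
Qed.

Lemma strongly_fixes_id p : strongly_fixes p id_word. Proof. by split. Qed.
Lemma low_id p : low p id_word. Proof. by move=> z u [->]. Qed.

Lemma sub_idw (W : Type) (iota : A -> W) p f h x : fixes p f -> size x < p ->
  sub iota f h x = h x.
Proof. by move=> hf xp; rewrite /sub (fixes_fv hf). Qed.

Variable a0 : A.

(* Above level q the word f is a plain copy of the tree, padded with the letter a0. *)
Definition triv q f :=
  [/\ forall x, q <= size x -> ft f x = fe f x,
      forall x d, q <= size x -> fe f (rcons x d) = rcons (fe f x) d &
      forall z, fl f q <= size z ->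
        fv f z = inl a0 \/ exists u, [/\ q <= size u, z = fe f u & fv f z = inr u]].

Lemma triv_id q : triv q id_word.
Proof. by split=> // z hz; right; exists z. Qed.

Lemma triv_cat q f x w : triv q f -> q <= size x -> fe f (x ++ w) = fe f x ++ w.
Proof.
move=> [_ h _] qx; elim/last_ind: w => [|w d IH]; first by rewrite !cats0.
by rewrite -!rcons_cat -IH h // size_cat (leq_trans qx) // leq_addr.
Qed.

Lemma triv_le q q' f : q <= q' -> triv q f -> triv q' f.
Proof.
move=> le [h1 h2 h3]; split=> [x hx|x d hx|z hz].
- by apply: h1; apply: leq_trans le hx.
- by apply: h2; apply: leq_trans le hx.
case: (h3 z) => [|->|[u [qu e1 e2]]].
- by apply: leq_trans hz; rewrite fl_le.
- by left.
- by right; exists u; split=> //; rewrite -(fl_le f) -fe_size -e1.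
Qed.

Lemma triv_fl q f n : triv q f -> q <= n -> fl f n = fl f q + (n - q).
Proof.
move=> h qn; have e := triv_cat (nseq (n - q) d0) h (_ : q <= size (nseq q d0)).
have := fe_size f (nseq n d0); rewrite size_nseq => <-.
have -> : nseq n d0 = nseq q d0 ++ nseq (n - q) d0.
  by rewrite -nseqD; congr nseq; lia.
by rewrite e ?size_nseq // size_cat fe_size !size_nseq.
Qed.

Lemma triv_comp q f g r : triv r f -> r <= fl g q -> triv q g -> triv q (comp_word f g).
Proof.
move=> hf rq hg; have [f1 f2 f3] := hf; have [g1 g2 g3] := hg.
split=> [x qx|x d qx|z /= hz].
- rewrite /= (g1 _ qx) f1 // fe_size; apply: leq_trans rq _; by rewrite fl_le.
- rewrite /= (g2 _ _ qx) f2 // fe_size; apply: leq_trans rq _; by rewrite fl_le.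
case: (f3 z) => [|->|[u [ru e1 e2]]].
- by apply: leq_trans hz; rewrite fl_le.
- by left.
rewrite e2; case: (g3 u) => [|->|[v [qv e3 e4]]].
- by rewrite -(fl_le f) -fe_size -e1.
- by left.
- by right; exists v; split; rewrite // e1 e3.
Qed.

End StrongWords.

Arguments id_word {D A}.

(** * Words that spread one level of slots over several levels *)

Section Block.
Variables (D : finType) (d0 : D) (A : Type) (a0 : A).
Notation node := (seq D).
Variables (p H : nat) (tau : node -> node) (eps : node -> D -> node)
  (phi : node -> node -> option A).
Hypothesis eps_size : forall x d, size (eps x d) = H.
Hypothesis tau_eps : forall x d, prefix (rcons (tau x) d) (eps x d).
Hypothesis phi_tau : forall x, phi x (tau x) = None.
Hypothesis phi_None : forall x w, size w < H -> phi x w = None -> prefix (tau x) w.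
Implicit Types (x u z w : node).

Let tau_size x : size (tau x) < H.
Proof. by have := size_prefix (tau_eps x d0); rewrite size_rcons eps_size. Qed.

Let eps_inj x d d' : eps x d = eps x d' -> d = d'.
Proof.
move=> e; have h c : nth d0 (eps x c) (size (tau x)) = c.
  by rewrite (nth_prefix d0 (tau_eps x c)) ?size_rcons // nth_rcons_size.
by rewrite -(h d) e h.
Qed.

(** A slot [x] of level [p] is blown up to [H] levels: the variable of [x] first occurs at
    [x ++ tau x], the slot of [rcons x d] is [x ++ eps x d], and [phi x w] is the content of
    [x ++ w], with [None] for the variable of [x]. Above level [p + H] the tree is copied
    plainly. *)
Definition block_fv z : A + node :=
  if size z < p then inr z
  else let x := take p z in let w := drop p z in
  if size w < H then (if phi x w is Some a then inl a else inr x)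
  else if [pick d | eps x d == take H w] is Some d then inr (rcons x d ++ drop H w)
  else inl a0.

Definition block_fe u : node :=
  if size u <= p then u
  else take p u ++ eps (take p u) (nth d0 u p) ++ drop p.+1 u.

Definition block_ft u : node :=
  if size u < p then u else if size u == p then u ++ tau u else block_fe u.

Definition block_fl n := if n <= p then n else n.-1 + H.

Lemma block_fe_rcons x d u : size x = p -> block_fe (rcons x d ++ u) = x ++ eps x d ++ u.
Proof.
move=> e; rewrite /block_fe size_cat size_rcons addSn -e leqNgt ltnS leq_addr /=.
rewrite -cats1 -catA take_size_cat // nth_cat ltnn subnn /=.
by rewrite drop_cat ltnNge leqnSn /= subSnn /= drop0.
Qed.

Lemma split_node u : p < size u -> u = rcons (take p u) (nth d0 u p) ++ drop p.+1 u.
Proof. by move=> h; rewrite -take_nth // cat_take_drop. Qed.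

Lemma block_fv_ft x : block_fv (block_ft x) = inr x.
Proof.
rewrite /block_ft; case: ifP => xp; first by rewrite /block_fv xp.
case: eqP => e.
  rewrite /block_fv size_cat e ltnNge leq_addr /=.
  by rewrite take_size_cat // drop_size_cat // tau_size phi_tau.
have px : p < size x by lia.
rewrite (split_node px); set y := take p x; set d := nth _ _ _; set u := drop _ _.
have sy : size y = p by rewrite size_takel // ltnW.
rewrite block_fe_rcons // /block_fv size_cat sy ltnNge leq_addr /=.
rewrite take_size_cat // drop_size_cat // size_cat eps_size ltnNge leq_addr /=.
rewrite take_size_cat // drop_size_cat //.
case: pickP => [d' /eqP/eps_inj -> //|/(_ d)]; by rewrite eqxx.
Qed.

Lemma block_fv_inr z x : block_fv z = inr x -> prefix (block_ft x) z.
Proof.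
rewrite /block_fv; case: ifP => [zp [<-]|zp]; first by rewrite /block_ft zp prefix_refl.
have pz : p <= size z by lia.
have st : size (take p z) = p by rewrite size_takel.
case: ifP => sw.
  case E: (phi _ _) => [//|] [<-].
  rewrite /block_ft st ltnn eqxx -[X in prefix _ X](cat_take_drop p z) prefix_catr // eqxx.
  exact: phi_None E.
case: pickP => [d /eqP e|//] [<-].
rewrite /block_ft size_cat size_rcons st ifN ?ifN ?block_fe_rcons //; try lia.
by rewrite e !cat_take_drop prefix_refl.
Qed.

Definition block : strong_word D A.
Proof.
refine (@StrongWord D A block_fv block_fe block_ft block_fl _ _ _ block_fv_ft block_fv_inr).
- move=> x; rewrite /block_fe /block_fl; case: ifP => // h.
  by rewrite !size_cat eps_size size_drop size_takel; lia.
- move=> x; rewrite /block_ft; case: ifP => h; first by rewrite /block_fe (ltnW h) prefix_refl.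
  case: eqP => e; first by rewrite /block_fe e leqnn prefix_prefix.
  exact: prefix_refl.
- move=> x d; rewrite /block_ft; case: ifP => h;
  first by rewrite /block_fe size_rcons h prefix_refl.
  case: eqP => e.
    have := block_fe_rcons d [::] e; rewrite cats0 => ->.
    by rewrite rcons_cat prefix_catr // eqxx cats0 tau_eps.
  have px : p < size x by lia.
  rewrite {2}(split_node px) rcons_cat {1}(split_node px) !block_fe_rcons ?size_takel //; try lia.
  by rewrite -!rcons_cat prefix_refl.
Defined.


Lemma block_ftE x : size x = p -> ft block x = x ++ tau x.
Proof. by move=> e; rewrite /= /block_ft e ltnn eqxx. Qed.

Lemma block_feE x d : size x = p -> fe block (rcons x d) = x ++ eps x d.
Proof. by move=> e; have := block_fe_rcons d [::] e; rewrite !cats0. Qed.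

Lemma block_fvE x w : size x = p -> size w < H ->
  fv block (x ++ w) = if phi x w is Some a then inl a else inr x.
Proof.
move=> e h; rewrite /= /block_fv size_cat e ltnNge leq_addr /=.
by rewrite take_size_cat // drop_size_cat // h.
Qed.

Lemma block_fl_top : fl block p.+1 = p + H.
Proof. by rewrite /= /block_fl ltnn. Qed.

Lemma block_idp : strongly_fixes p block.
Proof.
split=> x h /=; first by rewrite /block_ft h.
by rewrite /block_fe h.
Qed.

Lemma block_low : low p block.
Proof.
move=> z u /=; rewrite /block_fv; case: ifP => [_ [->] //|h].
have st : size (take p z) = p by rewrite size_takel; lia.
case: ifP => hw; first by case: (phi _ _) => [//|] [<-]; rewrite st ltnn.
by case: pickP => [d _ [<-]|//]; rewrite size_cat size_rcons st; lia.
Qed.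

Lemma block_triv : triv a0 p.+1 block.
Proof.
split=> [x h|x d h|z].
- by rewrite /= /block_ft ifN ?ifN //; lia.
- rewrite /= {1}(split_node h) rcons_cat {4}(split_node h).
  by rewrite !block_fe_rcons ?size_takel -?rcons_cat //; lia.
rewrite block_fl_top => hz /=; rewrite /block_fv ifN; last by lia.
rewrite ifN; last by rewrite size_drop; lia.
case: pickP => [d /eqP e|]; [right|by left].
eexists; split; [| |by []]; first by rewrite size_cat size_rcons size_takel; lia.
by rewrite block_fe_rcons ?size_takel ?e ?cat_take_drop //; lia.
Qed.

End Block.

(** * Words that keep only some of the levels *)

Section Selection.
Variables (D : finType) (d0 : D) (A : Type) (a0 : A) (lam : nat -> nat).
Notation node := (seq D).
Hypothesis lamS : forall n, lam n < lam n.+1.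
Implicit Types (x u z : node).

Let lam_lt m n : m < n -> lam m < lam n.
Proof.
elim: n => // n IH; rewrite ltnS leq_eqVlt => /orP[/eqP->|/IH h]; first exact: lamS.
exact: ltn_trans h (lamS n).
Qed.

Let lam_inj : injective lam.
Proof. by move=> m n e; case: (ltngtP m n) => // /lam_lt; rewrite e ltnn. Qed.

Let lam_ge n : n <= lam n.
Proof. by elim: n => // n IH; apply: leq_ltn_trans IH (lamS n). Qed.

Let index_lam n q : q < n -> index (lam q) (map lam (iota 0 n)) = q.
Proof.
move=> h; rewrite index_map //.
have e : nth 0 (iota 0 n) q = q by rewrite nth_iota.
by rewrite -{1}e index_uniq ?iota_uniq ?size_iota.
Qed.

(** At a position which is not of the form [lam q], [index] returns [size u], so that [nth] yields
    the default direction [d0]. *)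
Definition select_fe u : node :=
  mkseq (fun i => nth d0 u (index i (map lam (iota 0 (size u))))) (lam (size u)).

(** The candidate [u] is read at the positions [lam q] and then checked. As [q <= lam q], the values
    [lam 0], ..., [lam (size z)] suffice to look up [size z]. *)
Definition select_fv z : A + node :=
  let u := mkseq (fun q => nth d0 z (lam q))
                 (index (size z) (map lam (iota 0 (size z).+1))) in
  if select_fe u == z then inr u else inl a0.

Lemma select_size u : size (select_fe u) = lam (size u).
Proof. by rewrite size_mkseq. Qed.

Lemma select_nth u q : q < size u -> nth d0 (select_fe u) (lam q) = nth d0 u q.
Proof. by move=> h; rewrite nth_mkseq ?index_lam //; apply: lam_lt. Qed.

Lemma select_rcons x d : prefix (rcons (select_fe x) d) (select_fe (rcons x d)).
Proof.
rewrite prefixE size_rcons select_size; apply/eqP.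
have hs : size (take (lam (size x)).+1 (select_fe (rcons x d))) = (lam (size x)).+1.
  by rewrite size_takel // select_size size_rcons.
apply: (@eq_from_nth _ d0); first by rewrite hs size_rcons select_size.
move=> i; rewrite hs ltnS => hi; rewrite nth_take ?ltnS // nth_rcons select_size.
case: ltngtP hi => // [hi _|-> _]; last first.
  by rewrite select_nth ?size_rcons // nth_rcons_size.
rewrite !nth_mkseq ?size_rcons //; last by apply: ltn_trans hi (lamS _).
rewrite -addn1 iotaD map_cat index_cat size_map size_iota.
case: ifP => hin.
  rewrite nth_rcons ifT //.
  by rewrite -[X in _ < X](size_iota 0) -(size_map lam) index_mem.
rewrite nth_default; last by rewrite size_rcons /= add0n ifN_eqC //; lia.
rewrite nth_default // leqNgt -{2}[size x](size_iota 0) -(size_map lam) index_mem.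
by rewrite hin.
Qed.

Lemma select_fvE u : select_fv (select_fe u) = inr u.
Proof.
rewrite /select_fv select_size index_lam; last by rewrite ltnS.
have -> : mkseq (fun q => nth d0 (select_fe u) (lam q)) (size u) = u.
  apply: (@eq_from_nth _ d0); first by rewrite size_mkseq.
  by move=> i; rewrite size_mkseq => h; rewrite nth_mkseq // select_nth.
by rewrite eqxx.
Qed.

Lemma select_fv_inr z u : select_fv z = inr u -> z = select_fe u.
Proof. by rewrite /select_fv; case: eqP => // e [<-]. Qed.

Definition select : strong_word D A.
Proof.
refine (@StrongWord D A select_fv select_fe select_fe lam select_size _ select_rcons select_fvE _).
- by move=> x; apply: prefix_refl.
- by move=> z x /select_fv_inr ->; apply: prefix_refl.
Defined.


Lemma select_idw p : (forall n, n < p -> lam n = n) -> fixes p select.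
Proof.
move=> h x xp /=; apply: (@eq_from_nth _ d0); first by rewrite select_size h.
rewrite select_size h // => i ix; rewrite -{1}(h i); last exact: ltn_trans ix xp.
exact: select_nth.
Qed.

End Selection.

(** * Colourings of bounded depth as colours *)

Section Encoding.
Variables (D : finType) (d0 : D) (W : finType) (w0 : W) (Y : finType) (C : finType).
Notation node := (seq D).
Implicit Types (h : node -> W) (y : Y -> node).

(** Only [h] is cut at level [n]; the branches are cut before they are passed to [c], so pointwise
    equality is enough for them. *)
Definition resp n (C : Type) (c : (node -> W) -> (Y -> node) -> C) :=
  forall h h' y y', (forall x, size x < n -> h x = h' x) -> y =1 y' -> c h y = c h' y'.

Definition agree p h y h' y' :=
  (forall x, size x < p -> h x = h' x) /\ (forall i, take p (y i) = take p (y' i)).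

(* A colouring that depends on the levels below p only is a function on the finite type
   [ctx p], so that it can itself be used as a colour. *)
Definition ctx p : finType :=
  ({ffun p.-bseq D -> W} * {ffun Y -> p.-tuple D})%type.

Definition dec_h p (k : ctx p) : node -> W :=
  fun x => if insub x is Some z then k.1 z else w0.
Definition dec_y p (k : ctx p) : Y -> node := fun i => k.2 i.

Definition enc p (c : (node -> W) -> (Y -> node) -> C) : {ffun ctx p -> C} :=
  [ffun k => c (dec_h k) (dec_y k)].

Lemma encP p c c' : resp p c -> resp p c' -> enc p c = enc p c' ->
  forall h y, (forall i, size (y i) = p) -> c h y = c' h y.
Proof.
move=> rc rc' e h y sy.
pose k : ctx p := ([ffun z : p.-bseq D => h z], [ffun i => insubd [tuple of nseq p d0] (y i)]).
have e1 : forall x, size x < p -> h x = dec_h k x.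
  move=> x xp; rewrite /dec_h insubT; first exact: ltnW.
  by move=> le; rewrite ffunE.
have e2 : y =1 dec_y k.
  by move=> i; rewrite /dec_y ffunE val_insubd sy eqxx.
rewrite (rc _ _ _ _ e1 e2) (rc' _ _ _ _ e1 e2).
by have := congr1 (fun F : {ffun ctx p -> C} => F k) e; rewrite !ffunE.
Qed.

End Encoding.

(** * Insensitivity to the letters of one level *)

Section Insensitivity.
Variables (D : finType) (d0 : D) (A : finType) (a0 : A) (W : finType)
  (iota : A -> W) (Y : finType).
Notation node := (seq D).
Notation sub := (sub iota).
Implicit Types (h : node -> W) (y : Y -> node) (x u z o : node)
  (Phi : seq (A * option D)) (O : pred node).

(* An object is a map h giving the content of each slot together with a family y of branches.
   In Phi, [(a, Some d)] stands for the letter a in a slot which some branches cross in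
   direction d, and [(a, None)] for the letter a in a slot which no branch crosses. *)
Definition admissible Phi h y x := exists a t, [/\ h x = iota a, (a, t) \in Phi &
  forall i, take (size x) (y i) = x -> t = Some (nth d0 (y i) (size x))].

Definition reference h y x := h x = iota a0 /\
  forall i, take (size x) (y i) = x -> nth d0 (y i) (size x) = d0.

Definition on_level O Phi q h y := forall x, size x = q ->
  if O x then admissible Phi h y x else reference h y x.

Definition on_level_but z O Phi q h y := forall x, size x = q -> x != z ->
  if O x then admissible Phi h y x else reference h y x.

Definition has_default Phi := (a0, None) \in Phi /\ (a0, Some d0) \in Phi.

Lemma reference_admissible Phi h y x : has_default Phi -> reference h y x -> admissible Phi h y x.
Proof.
move=> [b1 b2] [e r].
case: (pickP [pred i | take (size x) (y i) == x]) => [i _|no].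
  by exists a0, (Some d0); split=> // j /r ->.
by exists a0, None; split=> // j /eqP; have := no j => /= ->.
Qed.

Lemma reference_on_level O Phi q h y : has_default Phi -> (forall x, size x = q ->
  reference h y x) ->
  on_level O Phi q h y.
Proof. by move=> b r x /r rx; case: ifP => // _; apply: reference_admissible. Qed.

Definition good p k N (f : strong_word D A) :=
  [/\ strongly_fixes p f, low p f, triv a0 (p + k) f & fl f (p + k) = N].

Section Stack.
Variables (f : strong_word D A) (q N : nat).
Hypotheses (ftriv : triv a0 q f) (flq : fl f q = N).
Variables (h : node -> W) (y : Y -> node).
Hypothesis ysize : forall i, size (y i) = q.+1.

Lemma triv_top u d : size u = q -> fe f (rcons u d) = rcons (fe f u) d.
Proof. by move=> e; case: ftriv => _ -> //; rewrite e. Qed.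

Lemma triv_fv_fe u : q <= size u -> fv f (fe f u) = inr u.
Proof. by move=> e; case: ftriv => h1 _ _; rewrite -h1 // fv_ft. Qed.

Lemma stack_case x : size x = N ->
  (exists u, [/\ size u = q, x = fe f u & fv f x = inr u]) \/
  (fv f x = inl a0 /\ forall u, q <= size u -> x <> fe f u).
Proof.
move=> sx; case: ftriv => h1 h2 h3; case: (h3 x) => [|e|[u [qu e1 e2]]].
- by rewrite flq sx.
- right; split=> // u qu ex; move: e; rewrite ex triv_fv_fe //.
- left; exists u; split=> //; apply/eqP; rewrite eqn_leq qu andbT.
  by rewrite -(fl_le d0 f) -fe_size -e1 sx flq.
Qed.

Lemma stack_take i : take N (fe f (y i)) = fe f (take q (y i)).
Proof. by rewrite -flq take_fe // ysize. Qed.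

Lemma stack_rcons i : y i = rcons (take q (y i)) (nth d0 (y i) q).
Proof. by rewrite -take_nth ?ysize // take_oversize ?ysize. Qed.

Lemma stack_fe i : fe f (y i) = rcons (fe f (take q (y i))) (nth d0 (y i) q).
Proof. by rewrite {1}stack_rcons triv_top // size_takel // ysize. Qed.

Lemma stack_nth i : nth d0 (fe f (y i)) N = nth d0 (y i) q.
Proof.
rewrite stack_fe -flq; have <- : size (fe f (take q (y i))) = fl f q.
  by rewrite fe_size size_takel // ysize.
by rewrite nth_rcons_size.
Qed.

Lemma stack_size i : size (fe f (y i)) = N.+1.
Proof. by rewrite stack_fe size_rcons fe_size size_takel ?ysize // flq. Qed.

Lemma stack_on_level_but O O' Phi z : (forall u, size u = q -> O' (fe f u) = O u) ->
  (a0, None) \in Phi -> on_level_but z O Phi q h y ->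
  on_level_but (fe f z) O' Phi N (sub f h) (fe f \o y).
Proof.
move=> OO' b hl x sx xz; case: (stack_case sx) => [[u [su ex evx]]|[evx no]].
  have uz : u != z by apply: contraNneq xz => <-; rewrite ex.
  have hx : sub f h x = h u by rewrite /sub evx.
  have th i : take (size x) (fe f (y i)) = x -> take (size u) (y i) = u.
    by rewrite sx su stack_take ex => /(@fe_inj D d0).
  have := hl u su uz; rewrite ex OO' // -ex; case: ifP => _.
    move=> [a [t [e1 e2 e3]]]; exists a, t; split=> //; first by rewrite hx.
    by move=> i /th/e3 ->; rewrite /= sx stack_nth su.
  move=> [e r]; split; first by rewrite hx.
  by move=> i /th/r; rewrite /= sx stack_nth su.
have hx : sub f h x = iota a0 by rewrite /sub evx.
have np i : take (size x) (fe f (y i)) <> x.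
  rewrite sx stack_take => e; apply: (no (take q (y i))) => //.
  by rewrite size_takel // ysize.
case: ifP => _; first by exists a0, None; split=> // i /np.
by split=> // i /np.
Qed.

Lemma stack_on_level O O' Phi : (forall u, size u = q -> O' (fe f u) = O u) ->
  (a0, None) \in Phi -> on_level O Phi q h y -> on_level O' Phi N (sub f h) (fe f \o y).
Proof.
move=> OO' b hl x sx; pose z := x ++ [:: d0].
have nz : fe f z != x.
  apply/negP => /eqP e; have := fl_ge d0 f (size z); rewrite -fe_size e.
  by rewrite size_cat addn1 ltnn.
apply: (stack_on_level_but (z := z) OO' b _ sx); last by rewrite eq_sym.
by move=> u su _; apply: hl.
Qed.

End Stack.

Definition ref_h n h x := if size x < n then h x else iota a0.
Definition ref_y y i := rcons (y i) d0.

Lemma reference_ref n h y x : size x = n -> (forall i, size (y i) = n) ->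
  reference (ref_h n h) (ref_y y) x.
Proof.
move=> sx sy; split; first by rewrite /ref_h sx ltnn.
by move=> i _; rewrite sx /ref_y -(sy i) nth_rcons_size.
Qed.

(** What remains of the colour once [g] has made level [n] irrelevant. It depends on the levels
    below [n] only, so the inner word can be chosen for it. *)
Definition reduced C (g : strong_word D A) n (c : (node -> W) -> (Y -> node) -> C) h y :=
  c (sub g (ref_h n h)) (fe g \o ref_y y).

Lemma reduced_resp C g n N (c : (node -> W) -> (Y -> node) -> C) :
  resp N c -> resp n (reduced g n c).
Proof.
move=> rc h h' y y' e1 e2; apply: rc => [x _|i].
  rewrite /sub; case: (fv g x) => // u; rewrite /ref_h.
  by case: ifP => // /e1.
by rewrite /= /ref_y e2.
Qed.

Definition end_stable C O Phi n (g : strong_word D A) (c : (node -> W) -> (Y -> node) -> C) :=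
  forall h y h' y', (forall i, size (y i) = n.+1) -> (forall i, size (y' i) = n.+1) ->
  agree n h y h' y' -> on_level O Phi n h y -> on_level O Phi n h' y' ->
  c (sub g h) (fe g \o y) = c (sub g h') (fe g \o y').

(** Level [q] is copied plainly to level [n], where [g] ignores admissible contents; so it may be
    overwritten by the default. Inductions over slots and levels peel off the top in this way. *)
Lemma stack_reduced C O O' Phi q n N f g (c : (node -> W) -> (Y -> node) -> C) h y :
  has_default Phi -> triv a0 q f -> fl f q = n -> resp N c ->
  end_stable O' Phi n g c -> (forall u, size u = q -> O' (fe f u) = O u) ->
  (forall i, size (y i) = q.+1) -> on_level O Phi q h y ->
  c (sub (comp_word d0 g f) h) (fe (comp_word d0 g f) \o y) =
  reduced g n c (sub f h) (fe f \o (fun i => take q (y i))).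
Proof.
move=> b tf ef rc eg OO' sy hl.
rewrite (rc _ (sub g (sub f h)) _ (fe g \o (fe f \o y))) //; last first.
  by move=> x _; rewrite sub_comp.
have ss i : size (fe f (take q (y i))) = n by rewrite fe_size size_takel ?sy.
apply: eg.
- by move=> i; apply: (stack_size tf ef sy).
- by move=> i; rewrite size_rcons /= ss.
- split=> [x xn|i]; first by rewrite /ref_h xn.
  by rewrite /ref_y /= (stack_take ef sy) -[X in _ = take X _](ss i) take_rcons_size.
- by apply: (stack_on_level tf ef sy OO' _ hl); case: b.
- by apply: reference_on_level => // x sx; apply: reference_ref.
Qed.

(** Slots that are not treated are pushed up along [d0]. Their images are then known in advance,
    before the colouring and hence before [f], so that an outer word can be prepared for them. *)
Definition straight O p k N (f : strong_word D A) := forall x, size x = p -> ~~ O x ->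
  fe f (x ++ nseq k d0) = x ++ nseq (N - p) d0.

Definition one_slot Phi := forall p o (C : finType), size o = p -> exists N, p < N /\
  forall c : (node -> W) -> (Y -> node) -> C, resp N c -> exists f,
  [/\ good p 1 N f, straight (pred1 o) p 1 N f & end_stable (pred1 o) Phi p f c].

(* The contents of the slots of level p other than z vary, and the colour is read on the level
   just above the first occurrence of the variable of slot z. *)
Definition mark_stable C z O Phi p (f : strong_word D A) (c : nat -> (node -> W) -> (Y ->
  node) -> C) :=
  forall h y h' y', (forall i, size (y i) = p.+1) -> (forall i, size (y' i) = p.+1) ->
  agree p h y h' y' -> h z = h' z -> (forall i, take p (y i) = z -> y i = y' i) ->
  on_level_but z O Phi p h y -> on_level_but z O Phi p h' y' ->
  let q := (size (ft f z)).+1 in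
  c q (sub f h) (fun i => take q (fe f (y i))) = c q (sub f h') (fun i => take q (fe f (y' i))).

Definition many_slots Phi := forall p zs (C : finType), uniq zs -> all (fun z => size z == p) zs ->
  exists N, p < N /\
  forall c : nat -> (node -> W) -> (Y -> node) -> C, (forall n, resp n (c n)) -> exists f,
  [/\ good p 1 N f, straight (fun x => x \in zs) p 1 N f, end_stable (fun x =>
    x \in zs) Phi p f (c N) &
      forall z, z \in zs -> mark_stable z (fun x => x \in zs) Phi p f c].

Lemma on_level_nil p h y h' y' : (forall i, size (y i) = p.+1) -> (forall i, size (y' i) = p.+1) ->
  agree p h y h' y' ->
  (forall x, size x = p -> reference h y x) -> (forall x, size x = p -> reference h' y' x) ->
  (forall x, size x < p.+1 -> h x = h' x) /\ y =1 y'.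
Proof.
move=> sy sy' [a1 a2] l l'; split=> [x|i].
  rewrite ltnS leq_eqVlt => /orP[/eqP sx|]; last exact: a1.
  by case: (l x sx) => -> _; case: (l' x sx) => ->.
rewrite (stack_rcons sy i) (stack_rcons sy' i) a2.
have st : size (take p (y i)) = p by rewrite size_takel // sy.
have st' : size (take p (y' i)) = p by rewrite size_takel // sy'.
case: (l _ st) => _ /(_ i); rewrite st => -> //.
by case: (l' _ st') => _ /(_ i); rewrite st' => ->.
Qed.

End Insensitivity.

Section Slots.
Variables (D : finType) (d0 : D) (A : finType) (a0 : A) (W : finType)
  (iota : A -> W) (Y : finType).
Notation node := (seq D).
Notation sub := (sub iota).
Implicit Types (h : node -> W) (y : Y -> node) (x u z o : node)
  (Phi : seq (A * option D)) (O : pred node).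

(* Level p is spread over two levels: the first one serves the slots other than z and the
   second one serves z. *)
Section Chi.
Variables (p : nat) (z : node).

Definition chi_tau x : node := if x == z then [:: d0] else [::].
Definition chi_eps x d : node := if x == z then [:: d0; d] else [:: d; d0].
Definition chi_phi x (w : node) := if w == chi_tau x then None else Some a0.

Definition chi : strong_word D A.
Proof.
refine (@block D d0 A a0 p 2 chi_tau chi_eps chi_phi _ _ _ _).
- by move=> x d; rewrite /chi_eps; case: ifP.
- by move=> x d; rewrite /chi_eps /chi_tau; case: ifP => _; rewrite prefixE /= eqxx.
- by move=> x; rewrite /chi_phi eqxx.
- by move=> x w _; rewrite /chi_phi; case: eqP => // -> _; apply: prefix_refl.
Defined.


Lemma chi_idp : strongly_fixes p chi. Proof. exact: block_idp. Qed.
Lemma chi_low : low p chi. Proof. exact: block_low. Qed.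
Lemma chi_triv : triv a0 p.+1 chi. Proof. exact: block_triv. Qed.
Lemma chi_fl : fl chi p.+1 = p.+2.
Proof. by rewrite block_fl_top addn2. Qed.

Hypothesis sz : size z = p.

Lemma chi_ft_z : ft chi z = rcons z d0.
Proof. by rewrite block_ftE // /chi_tau eqxx cats1. Qed.

Lemma chi_ft x : size x = p -> x != z -> ft chi x = x.
Proof. by move=> sx xz; rewrite block_ftE // /chi_tau (negbTE xz) cats0. Qed.

Lemma chi_fe_z d : fe chi (rcons z d) = rcons (rcons z d0) d.
Proof. by rewrite block_feE // /chi_eps eqxx -!cats1 -catA. Qed.

Lemma chi_fe x d : size x = p -> x != z -> fe chi (rcons x d) = rcons (rcons x d) d0.
Proof. by move=> sx xz; rewrite block_feE // /chi_eps (negbTE xz) -!cats1 -catA. Qed.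

Lemma chi_sub0 h x : size x = p -> sub chi h x = if x == z then iota a0 else h x.
Proof.
move=> sx; rewrite /sub -{1}[x]cats0 block_fvE // /chi_phi /chi_tau.
by case: (x == z).
Qed.

Lemma chi_sub1 h x d : size x = p ->
  sub chi h (rcons x d) = if rcons x d == rcons z d0 then h z else iota a0.
Proof.
move=> sx; rewrite /sub -{1}cats1 block_fvE // /chi_phi /chi_tau eqseq_rcons.
case: (altP (x =P z)) => [->|_] /=; last by [].
by rewrite eqseq_cons andbT; case: (d == d0).
Qed.

Variables (h : node -> W) (y : Y -> node).
Hypothesis sy : forall i, size (y i) = p.+1.
Let hx := sub chi h.
Let y2 i := fe chi (y i).
Let y1 i := take p.+1 (y2 i).

Lemma chi_y2_size i : size (y2 i) = p.+2.
Proof. by rewrite /y2 fe_size sy chi_fl. Qed.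

Lemma chi_y1_size i : size (y1 i) = p.+1.
Proof. by rewrite size_takel // chi_y2_size. Qed.

Lemma chi_y2 i : y2 i = if take p (y i) == z then rcons (rcons z d0) (nth d0 (y i) p)
  else rcons (y i) d0.
Proof.
rewrite /y2 {1}(stack_rcons d0 sy i); have st : size (take p (y i)) = p by rewrite size_takel // sy.
case: eqP => [->|/eqP n]; first by rewrite chi_fe_z.
by rewrite chi_fe // -stack_rcons.
Qed.

Lemma chi_y1 i : y1 i = if take p (y i) == z then rcons z d0 else y i.
Proof.
rewrite /y1 chi_y2; case: ifP => _.
  by rewrite -(_ : size (rcons z d0) = p.+1) ?take_rcons_size // size_rcons sz.
by rewrite -(sy i) take_rcons_size.
Qed.

Lemma chi_take i : take p (y1 i) = take p (y i).
Proof. by rewrite chi_y1; case: eqP => // ->; rewrite -sz take_rcons_size. Qed.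

Lemma chi_nth i : take p (y i) != z -> nth d0 (y1 i) p = nth d0 (y i) p.
Proof. by rewrite chi_y1 => /negbTE ->. Qed.

Lemma chi_low_slots Phi zs u :
  (forall x, size x = p -> x != u -> x != z ->
    if x \in z :: zs then admissible d0 iota Phi h y x else reference d0 a0 iota h y x) ->
  z \notin zs -> on_level_but d0 a0 iota u (fun x => x \in zs) Phi p hx y1.
Proof.
move=> l zzs x sx xu; case: (altP (x =P z)) => [exz|xz].
  rewrite exz (negbTE zzs); split; first by rewrite /hx chi_sub0 // eqxx.
  by move=> i; rewrite sz => e; rewrite chi_y1 -chi_take e eqxx -sz nth_rcons_size.
have := l x sx xu xz; rewrite inE (negbTE xz) /=.
have ehx : hx x = h x by rewrite /hx chi_sub0 // (negbTE xz).
have th i : take (size x) (y1 i) = x ->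
    take (size x) (y i) = x /\ nth d0 (y1 i) (size x) = nth d0 (y i) (size x).
  by rewrite sx chi_take => e; split=> //; rewrite chi_nth // e.
case: ifP => _.
  move=> [a [t [e1 e2 e3]]]; exists a, t; split=> //; first by rewrite ehx.
  by move=> i /th[/e3 -> ->].
by move=> [e r]; split; [rewrite ehx|move=> i /th[/r e' ->]].
Qed.

(** A branch avoiding [z] has already turned on the lower of the two levels and continues along
    [d0]; hence on the upper level only [rcons z d0] can differ from the default. *)
Lemma chi_high x : size x = p.+1 -> x != rcons z d0 -> reference d0 a0 iota hx y2 x.
Proof.
move=> sx; have : size x > 0 by rewrite sx.
case/lastP: x sx => // x d; rewrite size_rcons => -[sx] _ n.
split; first by rewrite /hx chi_sub1 // (negbTE n).
move=> i; rewrite size_rcons sx -/(y1 i) chi_y1 chi_y2; case: ifP => _ e.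
  by rewrite e eqxx in n.
by rewrite -(sy i) nth_rcons_size.
Qed.

Lemma chi_high_z Phi : admissible d0 iota Phi h y z -> admissible d0 iota Phi hx y2 (rcons z d0).
Proof.
move=> [a [t [e1 e2 e3]]]; exists a, t; split=> //.
  by rewrite /hx chi_sub1 // eqxx.
move=> i; rewrite size_rcons sz -/(y1 i) => e.
have ez : take p (y i) = z by rewrite -chi_take e -sz take_rcons_size.
rewrite (e3 i) sz // chi_y2 ez eqxx.
by rewrite -(_ : size (rcons z d0) = p.+1) ?nth_rcons_size // size_rcons sz.
Qed.

End Chi.

Lemma on_level_but_on_level O Phi q h y :
  on_level_but d0 a0 iota (nseq q.+1 d0) O Phi q h y -> on_level d0 a0 iota O Phi q h y.
Proof.
move=> l x sx; apply: l => //; apply/negP => /eqP e.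
by move: sx; rewrite e size_nseq; lia.
Qed.

Definition mark_h n z w h x := if size x < n then h x else if x == z then w else iota a0.
Definition mark_y z (th : {ffun Y -> D}) y i := rcons (y i) (if y i == z then th i else d0).

(** Induction on the list of slots: [chi] delays the slot [z] by one level, the word [f0] treats the
    slots of [zs] while [z] passes straight through it, and [g] treats the image of [z] on level
    [N0]. *)
Lemma many_slots_of_one Phi : has_default d0 a0 Phi -> one_slot d0 a0 iota Y Phi ->
  many_slots d0 a0 iota Y Phi.
Proof.
move=> bP S p zs; elim: zs => [|z zs IH] C.
  move=> _ _; exists p.+1; split=> // c rc; exists id_word; split.
  - split; [exact: strongly_fixes_id|exact: low_id|exact: triv_id|by rewrite addn1].
  - by move=> x _ _; rewrite subSnn.
  - move=> h y h' y' sy sy' ag l l'; apply: (rc p.+1); last first.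
      by case: (on_level_nil sy sy' ag l l').
    by move=> x xp; rewrite /sub /=; apply: (on_level_nil sy sy' ag l l').1.
  - by [].
move=> /= /andP[zzs uzs] /andP[/eqP sz szs].
pose C' : finType := (C * option (C * {ffun (W * {ffun Y -> D}) -> C}))%type.
have [N0 [pN0 V0]] := IH C' uzs szs.
(* Every [f0] that is straight off [zs] sends [rcons z d0] to this node, so [g] can be chosen before
   [f0]. *)
have sz' : size (z ++ nseq (N0 - p) d0) = N0 by rewrite size_cat size_nseq sz; lia.
set z' := z ++ _ in sz'.
have [N1 [N01 V1]] := S N0 z' C sz'.
exists N1; split; first exact: ltn_trans pN0 N01.
move=> c rc; have [g [[g1 g2 g3 g4] gst ge]] := V1 (c N1) (rc N1).
pose q1 := (size (ft g z')).+1.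
have q1N : q1 <= N1 by have := ft_size_lt d0 g z'; rewrite sz' -(addn1 N0) g4.
(* The colour just above the first occurrence of the variable of [z], as a function of the value at
   [z] and of the directions taken there, which are not known when [f0] is chosen. *)
pose mk h y := [ffun k : W * {ffun Y -> D} =>
  c q1 (sub g (mark_h N0 z' k.1 h)) (fun i => take q1 (fe g (mark_y z' k.2 y i)))].
pose c' n h y : C' := (c n h y,
  if n == N0 then Some (reduced d0 a0 iota g n (c N1) h y, mk h y) else None).
have rc' n : resp n (c' n).
  move=> h h' y y' e1 e2; rewrite /c'; congr pair; first exact: rc.
  case: eqP => // en; congr (Some (_, _)); first exact: reduced_resp (rc N1) _ _ _ _ e1 e2.
  apply/ffunP => k; rewrite !ffunE; apply: rc => [x _|i].
    rewrite /sub; case: (fv g x) => // u; rewrite /mark_h.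
    by case: ifP => //; rewrite -en => /e1.
  by rewrite /mark_y e2.
have [f0 [[f1 f2 f3 f4] fst fe0 fmk]] := V0 c' rc'.
rewrite addn1 in f3 f4.
have f3' : triv a0 p.+2 f0 by apply: triv_le f3.
have f4' : fl f0 p.+2 = N0.+1 by rewrite (triv_fl d0 f3) // f4; lia.
have ez' : fe f0 (rcons z d0) = z' by rewrite -cats1 -[[:: d0]]/(nseq 1 d0) fst.
pose f := comp_word d0 g (comp_word d0 f0 (chi p z)).
have chT := @chi_triv p z.
have chF := @chi_fl p z.
exists f; split.
- split.
  + by apply: strongly_fixes_comp; [apply: strongly_fixes_le g1;
    lia|apply: strongly_fixes_comp => //; apply: chi_idp].
  + by apply: low_comp; [apply: low_le g2; lia|apply: low_comp => //; apply: chi_low].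
  + rewrite addn1; apply: (@triv_comp D d0 A a0 p.+1 g _ N0.+1); first by rewrite addn1 in g3.
      by rewrite !comp_fl chF f4'.
    by apply: (@triv_comp D d0 A a0 p.+1 f0 (chi p z) p.+2) => //; rewrite chF.
  + by rewrite addn1 !comp_fl chF f4' -(addn1 N0) g4.
- move=> x sx; rewrite inE negb_or => /andP[xz xzs].
  rewrite [_ ++ nseq 1 _]cats1 !comp_fe chi_fe // (triv_top f3) ?size_rcons ?sx //.
  have e0 : fe f0 (rcons x d0) = x ++ nseq (N0 - p) d0.
    by rewrite -cats1 -[[:: d0]]/(nseq 1 d0) fst.
  rewrite e0 -cats1 -[[:: d0]]/(nseq 1 d0) gst.
  + by rewrite -catA -nseqD; congr (_ ++ nseq _ _); lia.
  + by rewrite size_cat size_nseq sx; lia.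
  + by rewrite /= /z' eqseq_cat ?sx ?sz // negb_and xz.
- move=> h y h' y' sy sy' ag l l'.
  pose y1 (y : Y -> node) i := take p.+1 (fe (chi p z) (y i)).
  have red h1 y0 : (forall i, size (y0 i) = p.+1) -> on_level d0 a0 iota (fun x =>
    x \in z :: zs) Phi p h1 y0 ->
      c N1 (sub f h1) (fe f \o y0) =
      reduced d0 a0 iota g N0 (c N1) (sub f0 (sub (chi p z) h1)) (fe f0 \o y1 y0).
    move=> s0 l0;
      rewrite -(@stack_reduced D d0 A a0 W iota Y C (pred1 (rcons z d0)) (pred1 z') Phi p.+1 N0 N1
      f0 g (c N1) (sub (chi p z) h1) (fe (chi p z) \o y0)) //.
    + by apply: rc => // x _; rewrite !sub_comp /sub /=; case: (fv g x) => // u; case: (fv f0 u).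
    + by move=> u su /=; rewrite -ez' (inj_eq (@fe_inj D d0 A f0)).
    + by move=> i; apply: chi_y2_size.
    + move=> x sx /=; case: eqP => [->|/eqP n].
        by apply: chi_high_z => //; have := l0 z sz; rewrite inE eqxx.
      exact: chi_high.
  rewrite red // red //.
  have : c' N0 (sub f0 (sub (chi p z) h)) (fe f0 \o y1 y) =
      c' N0 (sub f0 (sub (chi p z) h')) (fe f0 \o y1 y').
    apply: fe0.
    + by move=> i; apply: chi_y1_size.
    + by move=> i; apply: chi_y1_size.
    + split=> [x xp|i]; last by rewrite /y1 !chi_take // ag.2.
      by rewrite !(sub_idw _ _ (proj1 (@chi_idp p z))) // ag.1.
    + by apply: on_level_but_on_level; apply: chi_low_slots => // x sx _ _; exact: (l x sx).
    + by apply: on_level_but_on_level; apply: chi_low_slots => // x sx _ _; exact: (l' x sx).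
  by rewrite /c' eqxx => -[_ -> _].
pose y1 (y : Y -> node) i := take p.+1 (fe (chi p z) (y i)).
have s1 y0 : (forall i, size (y0 i) = p.+1) -> forall i, size (y1 y0 i) = p.+1.
  by move=> s0 i; apply: chi_y1_size.
have ag1 h y h' y' : (forall i, size (y i) = p.+1) -> (forall i, size (y' i) = p.+1) ->
  agree p h y h' y' -> agree p (sub (chi p z) h) (y1 y) (sub (chi p z) h') (y1 y').
  move=> sy sy' ag; split=> [x xp|i]; last by rewrite /y1 !chi_take // ag.2.
  by rewrite !(sub_idw _ _ (proj1 (@chi_idp p z))) // ag.1.
(* For [z] itself the colour is read inside [g], after [f0] has disposed of the slots of [zs]; this
   is the component [mk]. For a slot of [zs] the first occurrence lies below level [N0], where [g]
   changes nothing, and [chi] shows [z] there in its default state. *)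
move=> z0; rewrite inE; case: (altP (z0 =P z)) => [->
  _|z0z /= z0in] h y h' y' sy sy' ag ez ey l l' q.
  have eq1 : q = q1.
    by have [f3a _ _] := f3; rewrite /q !comp_ft chi_ft_z // f3a ?size_rcons ?sz // ez'.
  pose th := [ffun i => nth d0 (y i) p].
  have red h1 y0 : (forall i, size (y0 i) = p.+1) ->
      on_level_but d0 a0 iota z (fun x => x \in z :: zs) Phi p h1 y0 ->
      (forall i, take p (y0 i) = z -> th i = nth d0 (y0 i) p) ->
      c q (sub f h1) (fun i => take q (fe f (y0 i))) =
      mk (sub f0 (sub (chi p z) h1)) (fe f0 \o y1 y0) (h1 z, th).
    move=> s0 l0 hth; rewrite eq1 ffunE; apply: rc => [x xq|i].
      rewrite !sub_comp; apply: (@sub_lt D d0 A W iota g N0.+1); last first.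
        by rewrite -(addn1 N0) g4; apply: leq_trans xq q1N.
      move=> u; rewrite sub_comp ltnS leq_eqVlt => /orP[/eqP su|su]; last by rewrite /mark_h su.
      rewrite /mark_h su ltnn; case: (stack_case d0 f3 f4 su) => [[v [sv ev ev']]|[ev ev']].
        rewrite {1}/sub ev' ev -ez' (inj_eq (@fe_inj D d0 A f0)).
        case/lastP: v sv {ev ev'} => // v d; rewrite size_rcons => -[sv].
        by rewrite chi_sub1.
      rewrite {1}/sub ev ifN //; apply/eqP => eu; apply: (ev' (rcons z d0)).
        by rewrite size_rcons sz.
      by rewrite ez'.
    congr take; rewrite !comp_fe; congr fe.
    rewrite chi_y2 // /mark_y /= /y1 chi_y1 //; case: eqP => et.
      by rewrite (triv_top f3) ?size_rcons ?sz // ez' eqxx hth.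
    rewrite (triv_top f3) // ifN //; apply/eqP; rewrite -ez' => /(@fe_inj D d0 A f0) e.
    by apply: et; rewrite e -sz take_rcons_size.
  rewrite red //; last by move=> i; rewrite /th ffunE.
  rewrite red //; last first.
    by move=> i e; rewrite /th ffunE (ey i) // ag.2.
  rewrite ez.
  have : c' N0 (sub f0 (sub (chi p z) h)) (fe f0 \o y1 y) =
      c' N0 (sub f0 (sub (chi p z) h')) (fe f0 \o y1 y').
    apply: fe0; [exact: s1|exact: s1|exact: ag1| |].
    + by apply: on_level_but_on_level; apply: chi_low_slots => // x sx _ xz; exact: (l x sx xz).
    + by apply: on_level_but_on_level; apply: chi_low_slots => // x sx _ xz; exact: (l' x sx xz).
  by rewrite /c' eqxx => -[_ _ ->].
have e0 : ft f z0 = ft f0 z0.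
  have sz0 : size z0 = p by apply/eqP; apply: (allP szs).
  rewrite !comp_ft chi_ft // g1.1 //.
  by have := ft_size_lt d0 f0 z0; rewrite sz0 f4.
have qN : q <= N0.
  have sz0 : size z0 = p by apply/eqP; apply: (allP szs).
  by have := ft_size_lt d0 f0 z0; rewrite sz0 f4 -e0.
have red h1 y0 : (forall i, size (y0 i) = p.+1) ->
    c q (sub f h1) (fun i => take q (fe f (y0 i))) =
    (c' q (sub f0 (sub (chi p z) h1)) (fun i => take q (fe f0 (y1 y0 i)))).1.
  move=> s0; apply: rc => [x xq|i].
    by rewrite sub_comp (sub_idw _ _ g1.1) ?sub_comp //; apply: leq_trans xq qN.
  rewrite !comp_fe (fixes_take g1.1) //; last by rewrite fe_size chi_y2_size // f4' leqW.
  rewrite /y1 -(take_fe f0) ?chi_y2_size // f4 take_takel //.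
rewrite red // red //; apply: (congr1 (fun t : C' => t.1)); rewrite /q e0.
apply: fmk => //; try exact: s1.
- exact: ag1.
- by rewrite !chi_sub0 ?(negbTE z0z) //; apply/eqP; apply: (allP szs).
- move=> i; rewrite /y1 chi_take // => e; rewrite !chi_y1 // -?ag.2 e (negbTE z0z).
  exact: ey.
- by apply: chi_low_slots => // x sx xn _; exact: (l x sx xn).
- by apply: chi_low_slots => // x sx xn _; exact: (l' x sx xn).
Qed.

End Slots.

Section Letters.
Variables (D : finType) (d0 : D) (A : finType) (a0 : A) (W : finType)
  (iota : A -> W) (Y : finType).
Notation node := (seq D).
Notation sub := (sub iota).
Notation on_level := (on_level d0 a0 iota).
Implicit Types (h : node -> W) (y : Y -> node) (x u z o w : node)
  (Phi : seq (A * option D)) (O : pred node).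

Lemma on_level_take O Phi q n h y : q < n -> on_level O Phi q h y ->
  on_level O Phi q h (fun i => take n (y i)).
Proof.
move=> qn l x sx; have := l x sx; case: ifP => _.
  move=> [a [t [e1 e2 e3]]]; exists a, t; split=> // i.
  by rewrite take_takel ?sx ?(ltnW qn) // nth_take // -sx; apply: e3.
move=> [e r]; split=> // i.
by rewrite take_takel ?sx ?(ltnW qn) // nth_take // -sx; apply: r.
Qed.

(** The slots of level [p] are finitely many, so those above [o] can be listed and treated
    together. *)
Lemma many_slots_above Phi : many_slots d0 a0 iota Y Phi -> forall p o (C : finType),
  exists N, p < N /\ forall c : (node -> W) -> (Y -> node) -> C, resp N c -> exists f,
  [/\ good a0 p 1 N f, straight d0 (prefix o) p 1 N f & end_stable d0 a0 iota (prefix o) Phi p f c].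
Proof.
move=> V p o C.
pose zs := [seq tval t | t : p.-tuple D <- enum {: p.-tuple D} & prefix o (tval t)].
have uz : uniq zs by rewrite map_inj_uniq; [apply/filter_uniq/enum_uniq|move=> s t /val_inj].
have zsE x : size x = p -> (x \in zs) = prefix o x.
  move=> sx; apply/mapP/idP => [[t]|ox]; first by rewrite mem_filter => /andP[h _] ->.
  by exists (Tuple (introT eqP sx)) => //; rewrite mem_filter ox mem_enum.
have sz : all (fun z => size z == p) zs.
  by apply/allP => z /mapP[t _ ->]; rewrite size_tuple.
have [N [pN VN]] := V p zs C uz sz; exists N; split=> // c rc.
(* Only the colour on the final level is of interest; the other levels receive a constant colour. *)
pose c' n := if n == N then c else fun _ _ => c (fun _ => iota a0) (fun _ => [::]).
have rc' n : resp n (c' n).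
  by move=> h h' y y' e1 e2; rewrite /c'; case: eqP e1 => [->|//] e1; apply: rc.
have [f [gf stf ef _]] := VN c' rc'.
exists f; split=> //.
- by move=> x sx; rewrite -zsE //; apply: stf.
- move=> h y h' y' sy sy' ag l l'; rewrite /c' eqxx in ef; apply: ef => //.
    by move=> x sx; rewrite zsE //; apply: l.
  by move=> x sx; rewrite zsE //; apply: l'.
Qed.

Lemma prefix_idp o p (f : strong_word D A) u : size o <= p -> strongly_fixes p f -> p <= size u ->
  prefix o (fe f u) = prefix o u.
Proof.
by move=> op [fw _] pu; rewrite !prefixE (fixes_take fw op) // (leq_trans op).
Qed.

(** One word has to serve every starting level [p + i], because the pigeonhole principle determines
    [i] only after the word is known. *)
Lemma many_slots_levels Phi : has_default d0 a0 Phi -> many_slots d0 a0 iota Y Phi ->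
  forall o r p (C : finType),
  size o <= p -> exists N, p + r <= N /\
  forall c : (node -> W) -> (Y -> node) -> C, resp N c -> exists f,
  [/\ good a0 p r N f, straight d0 (prefix o) p r N f &
    forall i h y h' y', i <= r -> (forall v, size (y v) = p + r) ->
      (forall v, size (y' v) = p + r) -> agree (p + i) h y h' y' ->
      (forall q, p + i <= q < p + r -> on_level (prefix o) Phi q h y) ->
      (forall q, p + i <= q < p + r -> on_level (prefix o) Phi q h' y') ->
      c (sub f h) (fe f \o y) = c (sub f h') (fe f \o y')].
Proof.
move=> bP V o; elim=> [|r IH] p C op.
  exists p; split; first by rewrite addn0.
  move=> c rc; exists id_word; split.
  - by split; [exact: strongly_fixes_id|exact: low_id|exact: triv_id|rewrite /= addn0].
  - by move=> x _ _; rewrite subnn.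
  move=> i h y h' y'; rewrite leqn0 => /eqP -> {i}; rewrite addn0 => sy sy' [a1 a2] _ _.
  apply: rc => [x xp|i] /=; first by rewrite /sub /=; apply: a1.
  by have := a2 i; rewrite !take_oversize ?sy ?sy'.
have [N0 [pN0 H0]] := IH p C op.
have [N1 [N01 H1]] := many_slots_above V N0 o C.
exists N1; split; first by lia.
move=> c rc; have [g [[g1 g2 g3 g4] gst ge]] := H1 c rc.
have rc' : resp N0 (reduced d0 a0 iota g N0 c) by apply: reduced_resp rc.
have [f0 [[f1 f2 f3 f4] fst fe0]] := H0 _ rc'.
have pN : p <= N0 by lia.
have f3' : triv a0 (p + r.+1) f0 by apply: (triv_le d0 _ f3); lia.
have f4' : fl f0 (p + r.+1) = N0.+1 by rewrite (triv_fl d0 f3) ?f4; lia.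
exists (comp_word d0 g f0); split.
- split.
  + by apply: strongly_fixes_comp => //; apply: strongly_fixes_le g1.
  + by apply: low_comp => //; apply: low_le g2.
  + by apply: (@triv_comp D d0 A a0 (p + r.+1) g f0 N0.+1) => //; rewrite ?f4' // -addn1.
  + by rewrite comp_fl f4' -addn1.
- move=> x sx nox; rewrite comp_fe.
  have -> : x ++ nseq r.+1 d0 = rcons (x ++ nseq r d0) d0.
    by rewrite -addn1 nseqD catA cats1.
  have sxr : size (x ++ nseq r d0) = p + r by rewrite size_cat size_nseq sx.
  rewrite (triv_top f3) // fst // -cats1 gst.
  + by rewrite -catA -nseqD; congr (_ ++ nseq _ _); lia.
  + by rewrite size_cat size_nseq sx; lia.
  + by rewrite prefixE takel_cat ?sx // -prefixE.
move=> i h y h' y' ir sy sy' ag l l'.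
move: ir; rewrite leq_eqVlt => /orP[/eqP ei|]; last rewrite ltnS => ir.
  move: ag; rewrite ei => -[a1 a2]; apply: rc => [x xN|v].
    apply: (sub_lt d0 iota a1); by rewrite comp_fl f4' -(addn1 N0) g4.
  by have := a2 v; rewrite /= !take_oversize ?sy ?sy' // => ->.
rewrite addnS in sy sy'.
have OO u : size u = p + r -> prefix o (fe f0 u) = prefix o u.
  by move=> su; apply: (prefix_idp op f1); rewrite su leq_addr.
rewrite !(@stack_reduced D d0 A a0 W iota Y C (prefix o) (prefix o) Phi (p + r) N0 N1 f0 g c) //;
  try by [apply: l; lia|apply: l'; lia].
apply: (fe0 i) => //.
- by move=> v; rewrite size_takel // sy.
- by move=> v; rewrite size_takel // sy'.
- split=> [x xp|v]; first exact: ag.1.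
  by rewrite !take_takel ?leq_add2l // ag.2.
- by move=> q /andP[q1 q2]; apply: on_level_take => //; apply: l; lia.
- by move=> q /andP[q1 q2]; apply: on_level_take => //; apply: l'; lia.
Qed.

End Letters.

(** * Adjoining one pair of a letter and a direction *)

Section NewLetter.
Variables (D : finType) (d0 : D) (A : finType) (a0 : A) (W : finType)
  (iota : A -> W) (Y : finType).
Notation node := (seq D).
Notation sub := (sub iota).
Notation on_level := (on_level d0 a0 iota).
Notation reference := (reference d0 a0 iota).
Notation admissible := (admissible d0 iota).
Implicit Types (h : node -> W) (y : Y -> node) (x u z o w : node)
  (Phi : seq (A * option D)) (O : pred node).

(* The new letter is as_, crossed in direction ds. Above the slot o, the word [step] carries
   as_ for i levels, then the variable of o up to level j, then a0. Replacing the variable by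
   as_ turns the threshold i into the threshold j, so by the pigeonhole principle some i < j
   make the colour insensitive to this replacement. Z tells which nodes above o are decorated. *)
Variables (p r : nat) (o : node) (as_ : A) (ds : D) (Z : pred node).
Hypothesis so : size o = p.
Hypothesis Z_nseq : forall q, Z (nseq q ds).

Section Kappa.
Variables i j : nat.
Hypotheses (ij : i < j) (jr : j <= r).

Definition step_tau x : node := if x == o then nseq i ds else [::].
Definition step_eps x d : node :=
  if x == o then nseq i ds ++ nseq (j - i) d ++ nseq (r - j) d0 else d :: nseq r.-1 d0.
Definition step_phi x w :=
  if x == o then
    if size w < i then Some (if Z w then as_ else a0)
    else if size w < j then
      if Z w then (if prefix (nseq i ds) w then None else Some as_) else Some a0
    else Some a0
  else if w == [::] then None else Some a0.

Definition step : strong_word D A.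
Proof.
refine (@block D d0 A a0 p r step_tau step_eps step_phi _ _ _ _).
- move=> x d; rewrite /step_eps; case: ifP => _; rewrite ?size_cat /= !size_nseq; lia.
- move=> x d; rewrite /step_eps /step_tau; case: ifP => _;
  last by rewrite prefix_cons eqxx prefix0s.
  rewrite -cats1 prefix_catr // eqxx; have -> : j - i = (j - i).-1.+1 by lia.
  by rewrite /= eqxx prefix0s.
- move=> x; rewrite /step_phi /step_tau; case: (x == o) => //.
  by rewrite size_nseq ltnn ij Z_nseq prefix_refl.
- move=> x w _; rewrite /step_phi /step_tau; case: (x == o); last by move=> _; apply: prefix0s.
  by case: ifP => // _; case: ifP => // _; case: ifP => // _; case: ifP.
Defined.

Lemma step_idp : strongly_fixes p step. Proof. exact: block_idp. Qed.
Lemma step_low : low p step. Proof. exact: block_low. Qed.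
Lemma step_triv : triv a0 p.+1 step. Proof. exact: block_triv. Qed.
Lemma step_fl : fl step p.+1 = p + r. Proof. exact: block_fl_top. Qed.

Lemma step_fe x d : size x = p -> fe step (rcons x d) = x ++ step_eps x d.
Proof. by move=> e; apply: block_feE. Qed.

(** Closed form of the substituted word when all slots of level [p] other than [o] hold the default
    letter. *)
Definition step_h h x : W :=
  if size x < p then h x
  else if prefix o x then
    let w := drop p x in
    if size w < i then iota (if Z w then as_ else a0)
    else if size w < j then
      if Z w then (if prefix (nseq i ds) w then h o else iota as_) else iota a0
    else iota a0
  else iota a0.

Lemma step_sub h x : (forall u, size u = p -> u != o -> h u = iota a0) ->
  size x < p + r -> sub step h x = step_h h x.
Proof.
move=> hr xr; rewrite /step_h; case: ltnP => xp; first exact: (sub_idw _ _ step_idp.1).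
have sx : size (take p x) = p by rewrite size_takel.
rewrite -{1}(cat_take_drop p x) /sub block_fvE //; last by rewrite size_drop; lia.
rewrite /step_phi [prefix o x]prefixE so; case: eqP => [->|/eqP n].
  by case: ifP => // _; case: ifP => // _; case: ifP => // _; case: ifP.
by case: ifP => // _; apply: hr.
Qed.

End Kappa.

(** The threshold word: it does not involve the content of [o], so its colour is a function of the
    levels below [p], and the pigeonhole principle applies to the thresholds [k]. *)
Definition step_ref_h k h x : W :=
  if size x < p then h x
  else if prefix o x then
    (let w := drop p x in iota (if (size w < k) && Z w then as_ else a0))
  else iota a0.

Definition step_ref_y k y v : node := take p (y v) ++
  (if take p (y v) == o then nseq k ds ++ nseq (r - k) d0 else nseq r d0).

Variable Phi : seq (A * option D).
Hypothesis bP : has_default d0 a0 Phi.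
Hypothesis on_off : forall a d, (a, Some d) \in Phi -> (a, None) \in Phi.
(** The two demands on the decoration. A vacant node carrying [as_] away from the path along [ds]
    needs the pair [(as_, None)]; a node on the route of an old pair has to be decorated, since it
    must show the variable of [o]. *)
Hypothesis Z_off : forall w, Z w -> (as_, None) \in Phi \/ w = nseq (size w) ds.
Hypothesis Z_on : forall a d m n, (a, Some d) \in Phi -> Z (nseq m ds ++ nseq n d).

Section Object.
Variables (h : node -> W) (y : Y -> node).
Hypothesis sy : forall v, size (y v) = p.+1.
Hypothesis ref_o : forall x, size x = p -> x != o -> reference h y x.

Let hr u : size u = p -> u != o -> h u = iota a0.
Proof. by move=> su n; case: (ref_o su n). Qed.

Let st v : size (take p (y v)) = p. Proof. by rewrite size_takel ?sy. Qed.

Lemma step_ref_size k v : k <= r -> size (step_ref_y k y v) = p + r.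
Proof.
move=> kr; rewrite size_cat st; case: ifP => _; rewrite ?size_cat !size_nseq //; lia.
Qed.

Lemma step_ref_nth k v q : k <= r -> p + k <= q -> nth d0 (step_ref_y k y v) q = d0.
Proof.
move=> kr kq; rewrite nth_cat st ifN; last by lia.
case: ifP => _; last by rewrite nth_nseq if_same.
rewrite nth_cat size_nseq ifN; last by lia.
by rewrite nth_nseq if_same.
Qed.

Lemma step_ref_on_level k q : k <= r -> p + k <= q ->
  on_level (prefix o) Phi q (step_ref_h k h) (step_ref_y k y).
Proof.
move=> kr kq; apply: reference_on_level => // x sx; split.
  rewrite /step_ref_h sx ifN; last by lia.
  case: ifP => // _; rewrite size_drop sx ifN //; lia.
by move=> v _; rewrite sx step_ref_nth.
Qed.

Variables i j : nat.
Hypotheses (ij : i < j) (jr : j <= r).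
Let step := step ij jr.

Lemma step_y v : fe step (y v) = take p (y v) ++ step_eps i j (take p (y v)) (nth d0 (y v) p).
Proof. by rewrite -step_fe // -stack_rcons. Qed.

Let tr v : take p (y v) != o -> nth d0 (y v) p = d0.
Proof. by move=> n; case: (ref_o (st v) n) => _ /(_ v); rewrite st; apply. Qed.

Let nseq_r : nseq r d0 = d0 :: nseq r.-1 d0.
Proof. by rewrite -[RHS]/(nseq r.-1.+1 d0) prednK //; lia. Qed.

Lemma step_agree : agree (p + i) (sub step h) (fe step \o y) (step_ref_h i h) (step_ref_y i y).
Proof.
split=> [x xi|v].
  rewrite step_sub //; last by lia.
  rewrite /step_h /step_ref_h; case: ltnP => // px; case: ifP => // _.
  have -> : size (drop p x) < i by rewrite size_drop; lia.
  by [].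
rewrite [(_ \o _) _]step_y /step_ref_y !take_cat st ifN ?addKn; last by lia.
rewrite ifN ?addKn; last by lia.
congr (_ ++ _); rewrite /step_eps; case: ifP => [_|/negbT n].
  by rewrite !take_size_cat ?size_nseq.
by rewrite tr // nseq_r.
Qed.

Lemma step_new : h o = iota as_ -> (forall v, take p (y v) = o -> nth d0 (y v) p = ds) ->
  (forall x, size x < p + r -> sub step h x = step_ref_h j h x) /\ fe step \o y =1 step_ref_y j y.
Proof.
move=> ho ty; split=> [x xr|v].
  rewrite step_sub // /step_h /step_ref_h; case: ltnP => // px; case: ifP => // _.
  case: (ltnP (size (drop p x)) i) => wi /=.
    by rewrite (ltn_trans wi ij) /=; case: (Z _).
  case: (ltnP (size (drop p x)) j) => wj //=.
  by case: (Z _) => //; case: ifP.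
rewrite [(_ \o _) _]step_y /step_ref_y /step_eps; case: eqP => [e|/eqP n].
  by rewrite ty //; congr (_ ++ _); rewrite catA -nseqD subnKC // ltnW.
by rewrite tr // nseq_r.
Qed.

Variables (a : A) (t : option D).
Hypotheses (ho : h o = iota a) (at_Phi : (a, t) \in Phi)
  (ty : forall v, take p (y v) = o -> t = Some (nth d0 (y v) p)).

(** An old pair at [o] creates only old pairs on the levels from [p + i] on: [(a, t)] itself where a
    branch passes, and vacant nodes with [a], [as_] or [a0]. The vacant nodes with [a] are the
    reason for [on_off]. *)
Lemma step_on_level q : p + i <= q < p + r -> on_level (prefix o) Phi q (sub step h) (fe step \o y).
Proof.
move=> /andP[iq qr] x sx.
have tq v : take (size x) (fe step (y v)) = x ->
    take p x = take p (y v) /\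
    drop p x = take (q - p) (step_eps i j (take p (y v)) (nth d0 (y v) p)).
  rewrite step_y sx => e.
  have e' : x = take p (y v) ++ take (q - p) (step_eps i j (take p (y v)) (nth d0 (y v) p)).
    by rewrite -{1}e take_cat st ifN //; lia.
  by rewrite e' take_size_cat ?drop_size_cat.
have hx : sub step h x = step_h i j h x by rewrite step_sub // sx.
case: ifP => ox; last first.
  split; first by rewrite hx /step_h sx ox ifN //; lia.
  move=> v /tq [e _]; rewrite [(_ \o _) _]step_y sx nth_cat st ifN; last by lia.
  have n : take p (y v) != o by apply: contraFneq ox => eo; rewrite prefixE so e eo.
  rewrite /step_eps (negbTE n) tr //; case: (q - p) => //= k; by rewrite nth_nseq if_same.
have eo v : take (size x) (fe step (y v)) = x -> take p (y v) = o.
  by move=> /tq[<- _]; apply/eqP; rewrite -so -prefixE.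
have sw : size (drop p x) = q - p by rewrite size_drop sx.
have wi : (size (drop p x) < i) = false by rewrite sw; lia.
have px : (size x < p) = false by rewrite sx; lia.
have n1 v : take (size x) (fe step (y v)) = x ->
    nth d0 (fe step (y v)) (size x) = if q - p < j then nth d0 (y v) p else d0.
  move=> /eo e; rewrite step_y sx nth_cat st ifN; last by lia.
  rewrite /step_eps e eqxx nth_cat size_nseq ifN; last by lia.
  rewrite nth_cat size_nseq; case: ltnP => h1.
    by rewrite nth_nseq h1 ifT //; lia.
  by rewrite nth_nseq if_same ifN //; lia.
case: (ltnP (size (drop p x)) j) => wj; last first.
  apply: reference_admissible bP _; split; first by rewrite hx /step_h px ox wi ltnNge wj.
  by move=> v /n1 ->; rewrite ltnNge -sw wj.
have hxE : sub step h x = if Z (drop p x) then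
    (if prefix (nseq i ds) (drop p x) then h o else iota as_) else iota a0.
  by rewrite hx /step_h px ox wi wj.
case: (pickP [pred v | take (size x) (fe step (y v)) == x]) => [v0 /= /eqP onx|no].
  have [_ dx] := tq _ onx; have tv0 := ty (eo _ onx).
  have wE : drop p x = nseq i ds ++ nseq (q - p - i) (nth d0 (y v0) p).
    rewrite dx /step_eps eo // eqxx take_cat size_nseq ifN; last by lia.
    congr (_ ++ _); rewrite take_cat size_nseq; case: ltnP => h1.
      by rewrite take_nseq // ltnW.
    have -> : q - p - i = j - i by lia.
    by rewrite subnn take0 cats0.
  exists a, t; split=> //.
    rewrite hxE wE (Z_on (a := a)) -?tv0 //.
    by rewrite prefix_prefix.
  move=> v onv; rewrite [nth _ ((_ \o _) _) _]n1 // -sw wj; exact: ty (eo _ onv).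
have vac t' : forall v, take (size x) ((fe step \o y) v) = x ->
    t' = Some (nth d0 ((fe step \o y) v) (size x)).
  by move=> v /eqP; have := no v => /= ->.
have aoff : (a, None) \in Phi by case: t at_Phi => // d /on_off.
rewrite /admissible; have [b1 _] := bP; case Zw: (Z (drop p x)) hxE => hxE; last first.
  by exists a0, None; split; [rewrite hxE| |apply: vac].
case pw: (prefix _ _) hxE => hxE; first by exists a, None; split; [rewrite hxE ho| |apply: vac].
case: (Z_off Zw) => [off|e]; first by exists as_, None; split; [rewrite hxE| |apply: vac].
by move: pw; rewrite e sw prefixE size_nseq take_nseq ?eqxx //; lia.
Qed.

End Object.

End NewLetter.

(** * Reaching all pairs of a letter and a direction *)

Section AllLetters.
Variables (D : finType) (d0 : D) (A : finType) (a0 : A) (W : finType)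
  (iota : A -> W) (Y : finType).
Notation node := (seq D).
Notation sub := (sub iota).
Implicit Types (h : node -> W) (y : Y -> node) (x u z o w : node)
  (Phi : seq (A * option D)) (O : pred node).

Lemma pigeonhole (X : finType) (F : 'I_#|X|.+1 -> X) : exists i j : 'I_#|X|.+1, i < j /\ F i = F j.
Proof.
have /injectivePn [i [j ij e]] : ~~ injectiveb F.
  apply/negP => /injectiveP /leq_card; by rewrite card_ord ltnn.
case: (ltngtP i j) => h; first by exists i, j.
  by exists j, i.
by case/eqP: ij; apply: val_inj.
Qed.

Lemma one_slot_step Phi as_ del ds (Z : pred node) : has_default d0 a0 Phi ->
  many_slots d0 a0 iota Y Phi ->
  (forall q, Z (nseq q ds)) ->
  (forall a d, (a, Some d) \in Phi -> (a, None) \in Phi) ->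
  (forall w, Z w -> (as_, None) \in Phi \/ w = nseq (size w) ds) ->
  (forall a d m n, (a, Some d) \in Phi -> Z (nseq m ds ++ nseq n d)) ->
  (del = None \/ del = Some ds) -> one_slot d0 a0 iota Y ((as_, del) :: Phi).
Proof.
move=> bP V Zn onoff Zoff Zon hdel p o C so.
pose X : finType := {ffun ctx D W Y p -> C}.
(* One more threshold than there are colourings of the levels below [p], so two thresholds [i < j]
   below [r] yield the same colouring. *)
pose r := #|X|.+1.
have [N [pN HN]] := @many_slots_levels D d0 A a0 W iota Y Phi bP V o r p C (eq_leq so).
exists N; split; first by rewrite /r in pN; lia.
move=> c rc; have [f [[f1 f2 f3 f4] fst fe0]] := HN c rc.
pose col k h y := c (sub f (step_ref_h a0 iota p o as_ Z k h)) (fe f \o step_ref_y d0 p r o ds k y).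
have rcol k : resp p (col k).
  move=> h h' y y' e1 e2; apply: rc => [x _|v]; last by rewrite /= /step_ref_y e2.
  rewrite /sub; case: (fv f x) => // u; rewrite /step_ref_h.
  by case: ifP => // /e1.
have [i [j [ij e]]] := pigeonhole (fun k : 'I_r => @enc D W (iota a0) Y C p (col k)).
have jr : j <= r by apply/ltnW/ltn_ord.
have ir : i <= r by apply/ltnW/ltn_ord.
have e' h y : (forall v, size (y v) = p) -> col i h y = col j h y.
  by move=> sy; apply: (encP d0 (rcol i) (rcol j) e).
pose kp := @step D d0 A a0 p r o as_ ds Z so Zn i j ij jr.
have kF : fl kp p.+1 = p + r by apply: step_fl.
have kT : triv a0 p.+1 kp by apply: step_triv.
have kI : strongly_fixes p kp by apply: step_idp.
have kL : low p kp by apply: step_low.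
have kE x d : size x = p -> fe kp (rcons x d) = x ++ step_eps d0 r o ds i j x d.
  by move=> sx; apply: step_fe.
exists (comp_word d0 f kp); split.
- split.
  + exact: strongly_fixes_comp.
  + exact: low_comp.
  + by apply: (@triv_comp D d0 A a0 (p + 1) f kp (p + r)) => //; rewrite addn1 // kF.
  + by rewrite comp_fl addn1 kF.
- move=> x sx xo; rewrite comp_fe cats1 kE // /step_eps ifN // -[d0 :: _]/(nseq r d0) fst //.
  by apply: contra xo => ox; rewrite /= eq_sym; rewrite prefixE so -sx take_size eq_sym in ox.
(* An old pair at [o] gives the colour [col i], because everything from level [p + i] on may be
   reset. The new pair gives [col j], which equals [col i] by the choice of [i] and [j]. *)
have claim h y : (forall v, size (y v) = p.+1) ->
  on_level d0 a0 iota (pred1 o) ((as_, del) :: Phi) p h y ->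
    c (sub (comp_word d0 f kp) h) (fe (comp_word d0 f kp) \o y) = col i h y.
  move=> sy l.
  have -> : c (sub (comp_word d0 f kp) h) (fe (comp_word d0 f kp) \o y) =
      c (sub f (sub kp h)) (fe f \o (fe kp \o y)).
    by apply: rc => // x _; rewrite sub_comp.
  have lr x : size x = p -> x != o -> reference d0 a0 iota h y x.
    by move=> sx xo; have := l x sx; rewrite /= (negbTE xo).
  have := l o so; rewrite /= eqxx => -[a [t [ho]]]; rewrite so inE => inP ty.
  have [new|old] := boolP ((a, t) \in Phi); last first.
    move: inP; rewrite (negbTE old) orbF => /eqP[ea et]; rewrite ea in ho.
    have ty' v : take p (y v) = o -> nth d0 (y v) p = ds.
      by move=> /ty; rewrite et; case: hdel => -> // [].
    have [E1 E2] := step_new so Zn sy lr ij jr ho ty'.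
    have -> : col i h y = col j h y.
      have tk v : size (take p (y v)) = p by rewrite size_takel ?sy.
      rewrite -[col i h y](_ : col i h (fun v => take p (y v)) = _).
        rewrite e' //; apply: rc => // v; by rewrite /= /step_ref_y take_takel.
      by apply: rc => // v; rewrite /= /step_ref_y take_takel.
    apply: rc => [x xN|v]; last by have /= := E2 v => ->.
    by apply: (sub_lt d0 iota E1); rewrite f4.
  have ag : agree (p + i) (sub kp h) (fe kp \o y) (step_ref_h a0 iota p o as_ Z i h) (step_ref_y
    d0 p r o ds i y).
    exact: step_agree.
  apply: (fe0 i) => //; try exact: ag.
  - by move=> v; have := fe_size kp (y v); rewrite sy kF.
  - by move=> v; apply: step_ref_size.
  - by move=> q qq;
    apply: (@step_on_level D d0 A a0 W iota Y p r o as_ ds Z so Zn Phi bP onoff Zoff Zon h y sy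
      lr i j ij jr a t).
  - by move=> q /andP[qq _]; apply: step_ref_on_level.
move=> h y h' y' sy sy' [a1 a2] l l'; rewrite !claim //.
apply: rc => [x _|v]; last by rewrite /= /step_ref_y a2.
rewrite /sub; case: (fv f x) => // u; rewrite /step_ref_h.
by case: ifP => // /a1.
Qed.

Lemma one_slot_base : one_slot d0 a0 iota Y [:: (a0, None); (a0, Some d0)].
Proof.
move=> p o C so; exists p.+1; split=> // c rc; exists id_word; split.
- by split; [exact: strongly_fixes_id|exact: low_id|exact: triv_id|rewrite /= addn1].
- by move=> x _ _; rewrite subSnn.
have lr h y : on_level d0 a0 iota (pred1 o) [:: (a0, None); (a0, Some d0)] p h y ->
    forall x, size x = p -> reference d0 a0 iota h y x.
  move=> l x sx; have := l x sx; case: ifP => // _ [a [t [ho]]].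
  rewrite !inE => /orP[]/eqP[ea et] ty; split; rewrite ?ho ?ea // => v /ty; rewrite et // => -[].
  by [].
move=> h y h' y' sy sy' ag /lr l /lr l'; have [E1 E2] := on_level_nil sy sy' ag l l'.
by apply: rc => // x xp; rewrite /sub /=; apply: E1.
Qed.

End AllLetters.

Section Full.
Variables (D : finType) (d0 : D) (A : finType) (a0 : A) (W : finType)
  (iota : A -> W) (Y : finType).

Let offs (s : seq A) := [seq (a, @None D) | a <- s] ++ [:: (a0, None); (a0, Some d0)].

(** While [(a, None)] is being adjoined it is not yet allowed on vacant nodes, so only the path
    along [d0] is decorated. This suffices, since the only crossed pair so far is [(a0, Some d0)],
    which runs along that path. *)
Lemma many_slots_off s : many_slots d0 a0 iota Y (offs s).
Proof.
have bo s' : has_default d0 a0 (offs s').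
  by split; rewrite mem_cat !inE eqxx ?orbT.
have on a d s' : (a, Some d) \in offs s' -> a = a0 /\ d = d0.
  rewrite mem_cat !inE => /orP[/mapP[? _ []//]|/orP[/eqP[]//|/eqP[-> ->]//]].
elim: s => [|a s IH]; apply: many_slots_of_one => //; first exact: one_slot_base.
apply: (@one_slot_step D d0 A a0 W iota Y (offs s) a None d0 (fun w => w == nseq (size w) d0)) =>
  //.
- by move=> q; rewrite size_nseq.
- by move=> b d /on[-> _]; case: (bo s).
- by move=> w /eqP; right.
- by move=> b d m n /on[_ ->]; rewrite -nseqD size_nseq.
- by left.
Qed.

Definition all_letters : seq (A * option D) :=
  [seq (q.1, Some q.2) | q <- enum {: A * D}] ++ offs (enum A).

Lemma mem_all_letters q : q \in all_letters.
Proof.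
case: q => a [d|]; rewrite mem_cat; apply/orP; [left|right].
  by apply/mapP; exists (a, d); rewrite ?mem_enum.
by rewrite mem_cat map_f ?mem_enum.
Qed.

(** All vacant pairs are available now, so every node above the slot may be decorated, and the
    variable is visible in whatever direction a branch leaves. *)
Lemma many_slots_all : many_slots d0 a0 iota Y all_letters.
Proof.
rewrite /all_letters; elim: (enum _) => [|[a d] s IH]; first exact: many_slots_off.
have off b : (b, @None D) \in [seq (q.1, Some q.2) | q <- s] ++ offs (enum A).
  by rewrite mem_cat; apply/orP; right; rewrite mem_cat map_f ?mem_enum.
have bo : has_default d0 a0 ([seq (q.1, Some q.2) | q <- s] ++ offs (enum A)).
  by split; rewrite !mem_cat !inE eqxx ?orbT.
apply: many_slots_of_one.
  by case: bo => b1 b2; split; rewrite inE ?b1 ?b2 orbT.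
apply: (@one_slot_step D d0 A a0 W iota Y _ a (Some d) d predT) => //.
- by move=> w _; left.
- by right.
Qed.

End Full.

(** * Earlier variables as additional letters *)

Section OneLevel.
Variables (D : finType) (d0 : D) (L : finType) (l0 : L) (V : finType)
  (iota : L -> V) (Y : finType).
Notation node := (seq D).
Implicit Types (h : node -> V) (y : Y -> node) (x u z : node).

(** No new variable starts at [x]. An earlier variable first occurs at an initial segment of each of
    its occurrences, so the length [i] of that segment is enough to name it. *)
Definition determined p h x := (exists l, h x = iota l) \/ exists2 i, i < p & h x = h (take i x).

Variable p : nat.
(* The letter [inr i] at x stands for the value at the initial segment of x of length i. *)
Let A : finType := (L + 'I_p)%type.
Let W : finType := (A + V)%type.
Let a0 : A := inl l0.

Definition decode_at h x (w : W) : V :=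
  match w with inl (inl l) => iota l | inl (inr i) => h (take i x) | inr v => v end.

Definition comb h (eta : node -> W) x : V := if size x < p then h x else decode_at h x (eta x).

Definition code h x : W :=
  if [pick l | h x == iota l] is Some l then inl (inl l)
  else if [pick i : 'I_p | h x == h (take i x)] is Some i then inl (inr i)
  else inr (h x).

Lemma decode_code h x : decode_at h x (code h x) = h x.
Proof.
rewrite /code; case: pickP => [l /eqP -> //|_].
by case: pickP => [i /eqP -> //|_].
Qed.

Lemma comb_code h x : comb h (code h) x = h x.
Proof. by rewrite /comb decode_code if_same. Qed.

Lemma code_determined h x : determined p h x -> exists a, code h x = inl a.
Proof.
rewrite /code => hc; case: pickP => [l _|nl]; first by exists (inl l).
case: pickP => [i _|ni]; first by exists (inr i).
case: hc => [[l e]|[i ip e]]; first by have := nl l; rewrite e eqxx.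
by have := ni (Ordinal ip); rewrite /= e eqxx.
Qed.

Lemma code_agree h h' x : (forall u, size u < p -> h u = h' u) ->
  h x = h' x -> code h x = code h' x.
Proof.
move=> e ex; rewrite /code ex; case: pickP => // _.
rewrite (_ : [pick i : 'I_p | h' x == h (take i x)] = [pick i : 'I_p | h' x == h' (take i x)]) //.
by apply: eq_pick => i /=; rewrite e //; have := ltn_ord i; rewrite size_take_min; lia.
Qed.

Section Translate.
Variable f : strong_word D A.
Hypotheses (fid : strongly_fixes p f) (flow : low p f).

Definition translate_fv x : L + node :=
  match fv f x with inl (inl l) => inl l | inl (inr i) => inr (take i x) | inr u => inr u end.

Lemma fv_inl_size x a : fv f x = inl a -> p <= size x.
Proof. by move=> e; rewrite leqNgt; apply/negP => /(fixes_fv fid.1); rewrite e. Qed.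

Definition translate : strong_word D L.
Proof.
refine (@StrongWord D L translate_fv (fe f) (ft f) (fl f) (fe_size f) (fe_ft f) (ft_fe f) _ _).
- by move=> x; rewrite /translate_fv fv_ft.
- move=> z x; rewrite /translate_fv; case E: (fv f z) => [[//|i]|u] [<-]; last exact: fv_inr.
  have ip := ltn_ord i; rewrite fid.1 ?prefix_take // size_takel //.
  exact: leq_trans (ltnW ip) (fv_inl_size E).
Defined.

(** The letter [inr i] in slot [u] is decoded at [take i u], but at [take i x] once it is seen at an
    occurrence [x] of the variable of [u]. The two nodes coincide because [f] fixes the levels below
    [p]. *)
Lemma tr_sub h eta x : sub iota translate (comb h eta) x = comb h (sub inl f eta) x.
Proof.
rewrite /sub /= /translate_fv; case: (ltnP (size x) p) => xp.
  by rewrite (fixes_fv fid.1) // /comb xp.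
rewrite {2}/comb ltnNge xp /=; case E: (fv f x) => [[//|i]|u] /=.
  by rewrite /comb ifT // size_takel ?ltn_ord // (leq_trans (ltnW (ltn_ord i))).
have pu : p <= size u.
  by rewrite leqNgt; apply/negP => up; move: xp; rewrite leqNgt (flow E up) up.
rewrite /comb ltnNge pu /=.
case: (eta u) => [[//|i]|//] /=; congr h.
have ip : i <= p by apply/ltnW/ltn_ord.
have h1 : take (size (fe f u)) x = fe f u.
  exact: prefix_take_eq (prefix_trans (fe_ft f u) (fv_inr E)).
rewrite -(fixes_take fid.1 ip) ?(leq_trans ip pu) // -h1 take_takel //.
by rewrite fe_size; apply: leq_trans (leq_trans ip pu) (fl_ge d0 f _).
Qed.

Lemma translate_triv q : triv a0 q f -> triv l0 q translate.
Proof.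
move=> [t1 t2 t3]; split=> // z /t3 [e|[u [qu e1 e2]]].
  by left; rewrite /= /translate_fv e.
by right; exists u; split=> //; rewrite /= /translate_fv e2.
Qed.

End Translate.

Lemma one_level (C : finType) : exists N, p < N /\
  forall c : nat -> (node -> V) -> (Y -> node) -> C, (forall n, resp n (c n)) ->
  exists f : strong_word D L, [/\ strongly_fixes p f, triv l0 p.+1 f, fl f p.+1 = N &
    (forall h y h' y', (forall i, size (y i) = p.+1) -> (forall i, size (y' i) = p.+1) ->
      agree p h y h' y' ->
      (forall x, size x = p -> determined p h x) -> (forall x, size x = p -> determined p h' x) ->
      (forall i j, take p (y i) = take p (y j) -> y i = y j) ->
      (forall i j, take p (y' i) = take p (y' j) -> y' i = y' j) ->
      c N (sub iota f h) (fe f \o y) = c N (sub iota f h') (fe f \o y')) /\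
    (forall z h y h' y', size z = p ->
      (forall i, size (y i) = p.+1) -> (forall i, size (y' i) = p.+1) ->
      agree p h y h' y' -> h z = h' z -> (forall i, take p (y i) = z -> y i = y' i) ->
      (forall x, size x = p -> x != z -> determined p h x) ->
      (forall x, size x = p -> x != z -> determined p h' x) ->
      (forall i j, take p (y i) = take p (y j) -> take p (y i) <> z -> y i = y j) ->
      (forall i j, take p (y' i) = take p (y' j) -> take p (y' i) <> z -> y' i = y' j) ->
      let q := (size (ft f z)).+1 in
      c q (sub iota f h) (fun i => take q (fe f (y i))) =
      c q (sub iota f h') (fun i => take q (fe f (y' i))))].
Proof.
pose K : finType := {ffun p.-bseq D -> V}.
pose dec (k : K) x := if insub x is Some t then k t else iota l0.
pose enck h : K := [ffun t : p.-bseq D => h t].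
pose zs := [seq tval t | t : p.-tuple D <- enum {: p.-tuple D}].
have uz : uniq zs by rewrite map_inj_uniq; [apply/enum_uniq|move=> s t /val_inj].
have inzs x : size x = p -> x \in zs.
  by move=> sx; apply/mapP; exists (Tuple (introT eqP sx)); rewrite ?mem_enum.
have sz : all (fun z => size z == p) zs.
  by apply/allP => z /mapP[t _ ->]; rewrite size_tuple.
have [N [pN HN]] := many_slots_all d0 a0 (@inl A V) Y {ffun K -> C} uz sz.
exists N; split=> // c rc.
(* Decoding requires the contents below level [p], which the code does not retain; the colour is
   therefore a function of these contents. *)
pose ct n (eta : node -> W) (y : Y -> node) := [ffun k => c n (comb (dec k) eta) y].
have rct n : resp n (ct n).
  move=> h h' y y' e1 e2; apply/ffunP => k; rewrite !ffunE; apply: rc => // x xn.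
  by rewrite /comb e1.
have [f [[f1 f2 f3 f4] _ fe0 fm]] := HN ct rct.
rewrite addn1 in f3 f4.
have combE k h eta x : (forall u, size u < p -> h u = dec k u) -> comb h eta x = comb (dec k) eta x.
  move=> e; rewrite /comb; case: ltnP => [/e //|px].
  case: (eta x) => [[//|i]|//] /=; apply: e.
  by rewrite size_takel ?ltn_ord // (leq_trans (ltnW (ltn_ord i))).
have decE h u : size u < p -> h u = dec (enck h) u.
  by move=> up; rewrite /dec insubT; [exact: ltnW|move=> le; rewrite ffunE].
have trans n h k y : (forall u, size u < p -> h u = dec k u) ->
    c n (sub iota (translate f1) h) y = ct n (sub inl f (code h)) y k.
  move=> e; rewrite ffunE; apply: rc => // x _.
  rewrite -(combE _ _ _ _ e) -tr_sub //.
  by rewrite /sub; case: (fv _ _) => // u; rewrite comb_code.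
have ok h y x : determined p h x -> size x = p ->
    (forall i j, take p (y i) = x -> take p (y j) = x -> y i = y j) ->
    admissible d0 inl (all_letters d0 a0) (code h) y x.
  move=> hc sx co; have [a ea] := code_determined hc.
  case: (pickP [pred i | take p (y i) == x]) => [i /= /eqP ei|no].
    exists a, (Some (nth d0 (y i) p)); split; rewrite ?mem_all_letters //.
    by move=> j; rewrite sx => ej; rewrite (co i j).
  exists a, None; split; rewrite ?mem_all_letters // => j; rewrite sx => /eqP.
  by have := no j => /= ->.
exists (translate f1); split=> //; first exact: translate_triv.
split.
  move=> h y h' y' sy sy' ag cl cl' co co'.
  have e' u : size u < p -> h' u = dec (enck h) u by move=> up; rewrite -decE // ag.1.
  rewrite (trans N h (enck h)) ?(trans N h' (enck h)) //; last exact: decE.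
  congr (fun_of_fin _ _); apply: fe0 => //.
  - split=> [x xp|i]; last exact: ag.2.
    by apply: code_agree ag.1 _; apply: ag.1.
  - by move=> x sx; rewrite inzs //; apply: ok => // [|i j ei ej]; [apply: cl|apply: co;
    rewrite ei].
  - by move=> x sx; rewrite inzs //; apply: ok => // [|i j ei ej]; [apply: cl'|apply: co';
    rewrite ei].
move=> z h y h' y' sz' sy sy' ag ez ey cl cl' co co' q.
have e' u : size u < p -> h' u = dec (enck h) u by move=> up; rewrite -decE // ag.1.
rewrite (trans q h (enck h)) ?(trans q h' (enck h)) //; last exact: decE.
congr (fun_of_fin _ _); apply: fm => //.
- exact: inzs.
- by split=> [x xp|i]; [apply: code_agree ag.1 _; apply: ag.1|exact: ag.2].
- exact: code_agree ag.1 ez.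
- move=> x sx xz; rewrite inzs //; apply: ok => // [|i j ei ej]; first exact: cl.
  by apply: co; rewrite ei // => e; rewrite e eqxx in xz.
- move=> x sx xz; rewrite inzs //; apply: ok => // [|i j ei ej]; first exact: cl'.
  by apply: co'; rewrite ei // => e; rewrite e eqxx in xz.
Qed.

End OneLevel.

(** * Level homogeneity and fusion *)

Section Marked.
Variables (D : finType) (d0 : D) (L : finType) (l0 : L) (V : finType)
  (iota : L -> V) (Y : finType).
Notation node := (seq D).
Notation sub := (sub iota).
Notation determined := (determined iota).
Implicit Types (h : node -> V) (y : Y -> node) (x u z s : node) (f g : strong_word D L).
Implicit Types (kd : Y * V * {ffun Y -> D}).

(* The kind (i, v, th): the next variable v of the coded word first occurs at level N on the
   branch i, and a branch j through that node leaves it in direction [th j]. Between the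
   levels p and N nothing else happens. *)
Definition marked kd p N h y :=
  let s := take N (y kd.1.1) in
  [/\ (forall i, size (y i) = N.+1) /\ p <= N, h s = kd.1.2,
      forall i, take N (y i) = s -> nth d0 (y i) N = kd.2 i,
      forall x, p <= size x <= N -> x != s -> determined p h x &
      forall i j, take p (y i) = take p (y j) ->
        take N (y i) = take N (y j) /\ (take N (y i) <> s -> y i = y j)].

Definition mark_eval C f kd N (c : nat -> (node -> V) -> (Y -> node) -> C) h y :=
  let q := (size (ft f (take N (y kd.1.1)))).+1 in
  c q (sub f h) (fun i => take q (fe f (y i))).

(** The condition on the slot [u] which makes its occurrences in the image under [f] determined from
    below level [ps]. *)
Definition lower f h ps u := (exists l, h u = iota l) \/
  exists2 i, h u = h (take i u) & size (ft f (take i u)) < ps.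

Lemma determined_sub f h ps x u : fv f x = inr u -> lower f h ps u -> determined ps (sub f h) x.
Proof.
move=> e [[l el]|[i ei lt]]; first by left; exists l; rewrite /sub e.
right; exists (size (ft f (take i u))) => //; rewrite {1}/sub e ei.
have -> : take (size (ft f (take i u))) x = ft f (take i u).
  apply: prefix_take_eq; apply: prefix_trans (fv_inr e).
  by apply: (ft_mono d0); apply: prefix_take.
by rewrite sub_ft.
Qed.

Lemma lower_determined f h p ps u : (forall w, size w < p -> lower f h ps w) ->
  determined p h u -> lower f h ps u.
Proof.
move=> H [e|[i ip e]]; first by left.
have sw : size (take i u) < p by rewrite size_take_min; lia.
case: (H _ sw) => [[l el]|[j ej lt]]; first by left; exists l; rewrite e.
right; exists (minn j i); last by rewrite -take_min in lt.
by rewrite e ej take_min.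
Qed.

Lemma lower_idw p f h w : fixes p f -> size w < p -> lower f h p w.
Proof. by move=> fi wp; right; exists (size w); rewrite take_size // fi. Qed.

(** A word carries the mark to the first occurrence of the marked slot. The new base level [ps] need
    not be [fl f p]: it is enough that slots below [p] refer to first occurrences below [ps], and
    that branches which differ below [p] have separated below [ps]. *)
Lemma marked_sub f kd p N h y ps : marked kd p N h y ->
  (forall u, size u < p -> lower f h ps u) ->
  (forall i j, take ps (fe f (y i)) = take ps (fe f (y j)) -> take p (y i) = take p (y j)) ->
  let n := size (ft f (take N (y kd.1.1))) in ps <= n ->
  marked kd ps n (sub f h) (fun i => take n.+1 (fe f (y i))).
Proof.
move=> [[sy pN] hs ts hc co] H1 H2; set s := take N _ in hs ts hc co *; move=> n psn.
have ss : size s = N by rewrite size_takel ?sy.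
have nN : n < fl f N.+1 by rewrite -ss; apply: (ft_size_lt d0).
have sf i : size (fe f (y i)) = fl f N.+1 by rewrite fe_size sy.
have take_s i : take N (y i) = s -> take n (fe f (y i)) = ft f s.
  move=> e; apply: (take_ft d0); last by rewrite sy ss.
  by rewrite -e prefix_take.
have s_take i : take n (fe f (y i)) = ft f s -> take N (y i) = s.
  move=> e; have : prefix (fe f s) (fe f (y i)).
    by apply: prefix_trans (fe_ft f s) _; rewrite -e prefix_take.
  by move=> /(fe_reflect d0) /prefix_take_eq; rewrite ss.
have tt i : take n (take n.+1 (fe f (y i))) = take n (fe f (y i)) by rewrite take_takel.
have es : take n (take n.+1 (fe f (y kd.1.1))) = ft f s by rewrite tt take_s.
rewrite /marked es; split.
- by split=> // i; rewrite size_takel // sf.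
- by rewrite sub_ft.
- move=> i; rewrite tt => /s_take e; rewrite nth_take // -ts // -ss.
  by apply: nth_ft; rewrite ?sy ?ss // -e prefix_take.
- move=> x /andP[x1 x2] xs; case E: (fv f x) => [l|u].
    by left; exists l; rewrite /sub E.
  have uN : size u <= N by rewrite -ltnS (fv_inr_size d0 E) // (leq_ltn_trans x2 nN).
  apply: (determined_sub E); case: (ltnP (size u) p) => up; first exact: H1.
  apply: lower_determined H1 _; apply: hc; first by rewrite up.
  apply: contraNneq xs => us; have := fv_inr E; rewrite us => /prefix_take_eq <-.
  by rewrite take_oversize.
- move=> i j; rewrite !tt !take_takel ?(leq_trans psn) // => /H2 /co [e1 e2].
  split.
    have [e|/eqP ne] := eqVneq (take N (y i)) s; last by rewrite e2.
    by rewrite !take_s // -e1.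
  by move=> ne; rewrite e2 // => /take_s.
Qed.

Lemma mark_eval_comp C f g kd N (c : nat -> (node -> V) -> (Y -> node) -> C) h y :
  (forall n, resp n (c n)) -> (forall i, size (y i) = N.+1) ->
  let n := size (ft g (take N (y kd.1.1))) in
  mark_eval (comp_word d0 f g) kd N c h y = mark_eval f kd n c (sub g h) (fun i =>
    take n.+1 (fe g (y i))).
Proof.
move=> rc sy n; rewrite /mark_eval.
set s := take N _.
have ss : size s = N by rewrite size_takel ?sy.
have nN : n < fl g N.+1 by rewrite -ss; apply: (ft_size_lt d0).
have -> : take n (take n.+1 (fe g (y kd.1.1))) = ft g s.
  by rewrite take_takel // (take_ft d0) ?prefix_take ?ss ?sy.
apply: rc => [x _|i]; first by rewrite sub_comp.
rewrite comp_fe -(take_fe f); last by rewrite fe_size sy.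
by rewrite take_takel //; apply: (ft_size_lt d0).
Qed.

Lemma mark_eval_resp C f kd n (c : nat -> (node -> V) -> (Y -> node) -> C) :
  (forall m, resp m (c m)) -> resp n.+1 (mark_eval f kd n c).
Proof.
move=> rc h h' y y' e1 e2; rewrite /mark_eval -(e2 kd.1.1); apply: rc => [x xq|i];
  last by rewrite (e2 i).
apply: (sub_lt d0 iota e1); apply: leq_trans xq _.
apply: leq_trans (ft_size_lt d0 _ _) _; rewrite (fl_le d0) // ltnS size_take_min geq_minl //.
Qed.

End Marked.

Section Levels.
Variables (D : finType) (d0 : D) (L : finType) (l0 : L) (V : finType)
  (iota : L -> V) (Y : finType).
Notation node := (seq D).
Notation sub := (sub iota).
Notation determined := (determined iota).
Notation marked := (marked d0 iota).
Notation mark_eval := (mark_eval iota).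
Implicit Types (h : node -> V) (y : Y -> node) (x u z s : node) (f g : strong_word D L).
Implicit Types (kd : Y * V * {ffun Y -> D}).

(** Here each level [N] of the mark is treated by itself; different levels are compared only
    afterwards, by the pigeonhole principle. *)
Lemma many_levels kd p k (C : finType) : exists n, p + k <= n /\
  forall c : nat -> (node -> V) -> (Y -> node) -> C, (forall n, resp n (c n)) ->
  exists f, [/\ strongly_fixes p f, triv l0 (p + k) f, fl f (p + k) = n,
    (forall h y h' y', (forall i, size (y i) = p + k) -> (forall i, size (y' i) = p + k) ->
      agree p h y h' y' ->
      (forall x, p <= size x < p + k -> determined p h x) ->
      (forall x, p <= size x < p + k -> determined p h' x) ->
      (forall i j, take p (y i) = take p (y j) -> y i = y j) ->
      (forall i j, take p (y' i) = take p (y' j) -> y' i = y' j) ->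
      c n (sub f h) (fe f \o y) = c n (sub f h') (fe f \o y')) &
    (forall N h y h' y', N < p + k -> marked kd p N h y -> marked kd p N h' y' ->
      agree p h y h' y' -> mark_eval f kd N c h y = mark_eval f kd N c h' y')].
Proof.
elim: k C => [|k IH] C.
  exists p; split; first by rewrite addn0.
  move=> c rc; exists id_word; split.
  - exact: strongly_fixes_id.
  - exact: triv_id.
  - by rewrite /= addn0.
  - rewrite addn0 => h y h' y' sy sy' [a1 a2] _ _ _ _; apply: rc => [x xp|i] /=.
      by rewrite /sub /= a1.
    by have := a2 i; rewrite !take_oversize ?sy ?sy'.
  - by rewrite addn0 => N h y h' y' Np [[_ pN] _ _ _ _]; lia.
have [n0 [pn0 H0]] := IH (C * option (C * C))%type.
have [n1 [n01 H1]] := @one_level D d0 L l0 V iota Y n0 C.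
exists n1; split; first by lia.
move=> c rc; have [g [g1 g3 g4 [ge gm]]] := H1 c rc.
set w0 := kd.1.2; set th := kd.2; set nu := kd.1.1.
(* The colour for a mark on the top level. Its value and directions are prescribed by [kd], so a
   single colour suffices. *)
pose mk h y := let s := y nu in let q := (size (ft g s)).+1 in
  c q (sub g (mark_h l0 iota n0 s w0 h)) (fun i => take q (fe g (mark_y d0 s th y i))).
pose c' n h y := (c n h y,
  if n == n0 then Some (reduced d0 l0 iota g n (c n1) h y, mk h y) else None).
have rc' n : resp n (c' n).
  move=> h h' y y' e1 e2; rewrite /c'; congr pair; first exact: rc.
  case: eqP => // en; congr (Some (_, _)); first exact: reduced_resp (rc n1) _ _ _ _ e1 e2.
  rewrite /mk -(e2 nu); apply: rc => [x _|i].
    rewrite /sub; case: (fv g x) => // u; rewrite /mark_h.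
    by case: ifP => //; rewrite -en => /e1.
  by rewrite /mark_y (e2 i).
have [f0 [f1 f3 f4 fe0 fm]] := H0 c' rc'.
have pk : p <= p + k by apply: leq_addr.
have f3' : triv l0 (p + k.+1) f0 by apply: (triv_le d0 _ f3); lia.
have f4' : fl f0 (p + k.+1) = n0.+1 by rewrite (triv_fl d0 f3) ?f4; lia.
exists (comp_word d0 g f0).
have topc h u : size u = p + k -> determined p h u -> determined n0 (sub f0 h) (fe f0 u).
  move=> su hc; have e : fv f0 (fe f0 u) = inr u by apply: (triv_fv_fe f3); rewrite su.
  apply: (determined_sub d0 e); apply: (lower_determined (p := p)) hc => w wp.
  by right; exists (size w); rewrite take_size // f1.1 //; lia.
split.
- by apply: strongly_fixes_comp => //; apply: strongly_fixes_le g1; lia.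
- by apply: (@triv_comp D d0 L l0 (p + k.+1) g f0 n0.+1) => //; rewrite f4'.
- by rewrite comp_fl f4'.
- move=> h y h' y'; rewrite addnS => sy sy' ag hc hc' co co'.
  have red h2 y2 : (forall i, size (y2 i) = (p + k).+1) ->
      (forall x, p <= size x < (p + k).+1 -> determined p h2 x) ->
      (forall i j, take p (y2 i) = take p (y2 j) -> y2 i = y2 j) ->
      c n1 (sub (comp_word d0 g f0) h2) (fe (comp_word d0 g f0) \o y2) =
      reduced d0 l0 iota g n0 (c n1) (sub f0 h2) (fe f0 \o (fun i => take (p + k) (y2 i))).
    move=> s2 hc2 co2.
    rewrite (rc _ _ (sub g (sub f0 h2)) _ (fe g \o (fe f0 \o y2))) //; last first.
      by move=> x _; rewrite sub_comp.
    have ss i : size (fe f0 (take (p + k) (y2 i))) = n0 by rewrite fe_size size_takel ?s2 ?f4.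
    apply: ge.
    + by move=> i; apply: (stack_size d0 f3 f4 s2).
    + by move=> i; rewrite size_rcons /= ss.
    + split=> [x xn|i]; first by rewrite /ref_h xn.
      by rewrite /ref_y /= (stack_take f4 s2) -[X in _ = take X _](ss i) take_rcons_size.
    + move=> x sx; case: (stack_case d0 f3 f4 sx) => [[u [su -> _]]|[e _]].
        by apply: topc => //; apply: hc2; rewrite su; lia.
      by left; exists l0; rewrite /sub e.
    + by move=> x sx; left; exists l0; rewrite /ref_h sx ltnn.
    + move=> i j; rewrite /= !(stack_take f4 s2) => /(@fe_inj D d0 L f0) e.
      by congr fe; apply: co2; apply: take_eq_le e.
    + move=> i j; rewrite /ref_y /=.
      have h3 i' : take n0 (rcons (fe f0 (take (p + k) (y2 i'))) d0) = fe f0 (take (p + k) (y2 i')).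
        by rewrite -(ss i') take_rcons_size.
      by rewrite !h3 => ->.
  rewrite red // red //.
  have : c' n0 (sub f0 h) (fe f0 \o (fun i => take (p + k) (y i))) =
      c' n0 (sub f0 h') (fe f0 \o (fun i => take (p + k) (y' i))).
    apply: fe0.
    + by move=> i; rewrite size_takel ?sy.
    + by move=> i; rewrite size_takel ?sy'.
    + by split=> [x xp|i]; [exact: ag.1|rewrite !take_takel // ag.2].
    + by move=> x /andP[x1 x2]; apply: hc; rewrite x1 ltnW.
    + by move=> x /andP[x1 x2]; apply: hc'; rewrite x1 ltnW.
    + by move=> i j; rewrite !take_takel // => /co ->.
    + by move=> i j; rewrite !take_takel // => /co' ->.
  by rewrite /c' eqxx => -[_ -> _].
(* For a mark on the top level, [g] resets the other slots of that level and [f0] deals with the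
   levels below. A mark on a lower level first occurs below [n0], where [g] changes nothing. *)
move=> N h y h' y'; rewrite addnS ltnS leq_eqVlt => /orP[/eqP eN|Npk] mh mh' ag.
  have red h2 y2 : marked kd p N h2 y2 ->
      mark_eval (comp_word d0 g f0) kd N c h2 y2 =
      mk (sub f0 h2) (fe f0 \o (fun i => take (p + k) (y2 i))).
    rewrite eN => -[[s2 _] hs ts hc co]; set s := take _ _ in hs ts hc co.
    have ss : size s = p + k by rewrite size_takel // s2.
    have ess : ft f0 s = fe f0 s by case: f3 => -> //; rewrite ss.
    have sfs : size (fe f0 s) = n0 by rewrite fe_size ss f4.
    rewrite /mark_eval comp_ft -/s ess /mk /= -/s.
    set q := _.+1.
    rewrite (rc _ _ (sub g (sub f0 h2)) _ (fun i => take q (fe g (fe f0 (y2 i))))) //; last first.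
      by move=> x _; rewrite sub_comp.
    have sk i : size (fe f0 (take (p + k) (y2 i))) = n0 by rewrite fe_size size_takel ?s2 ?f4.
    have mkyE i : size (mark_y d0 (fe f0 s) th (fe f0 \o (fun i => take (p + k) (y2 i))) i) = n0.+1.
      by rewrite size_rcons /= sk.
    have mkyT i : take n0 (mark_y d0 (fe f0 s) th (fe f0 \o (fun i => take (p + k) (y2 i))) i) =
        fe f0 (take (p + k) (y2 i)).
      by rewrite /mark_y -(sk i) take_rcons_size.
    apply: gm => //.
    + by move=> i; apply: (stack_size d0 f3 f4 s2).
    + split=> [x xn|i]; first by rewrite /mark_h xn.
      by rewrite mkyT (stack_take f4 s2).
    + by rewrite /mark_h sfs ltnn eqxx /sub (triv_fv_fe f3) ?ss // hs.
    + move=> i; rewrite (stack_take f4 s2) => /(@fe_inj D d0 L f0) e.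
      by rewrite /mark_y /= e eqxx (stack_fe d0 f3 s2) e ts.
    + move=> x sx xs; case: (stack_case d0 f3 f4 sx) => [[u [su ex _]]|[e _]].
        rewrite ex; apply: topc => //; apply: hc; rewrite ?su ?leq_addr ?leqnn //.
        by apply: contraNneq xs => <-; rewrite ex.
      by left; exists l0; rewrite /sub e.
    + by move=> x sx xs; left; exists l0; rewrite /mark_h sx ltnn (negbTE xs).
    + move=> i j; rewrite !(stack_take f4 s2) => /(@fe_inj D d0 L f0) e ne.
      congr fe; case: (co i j); first exact: take_eq_le e.
      by move=> _; apply=> e'; apply: ne; rewrite e'.
    + move=> i j; rewrite !mkyT => e ne; rewrite /mark_y /= -e.
      by move/eqP/negbTE: ne => ->.
  rewrite !red //.
  have : c' n0 (sub f0 h) (fe f0 \o (fun i => take (p + k) (y i))) =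
      c' n0 (sub f0 h') (fe f0 \o (fun i => take (p + k) (y' i))).
    move: mh mh'; rewrite eN => -[[sy _] _ _ hc co] [[sy' _] _ _ hc' co'].
    apply: fe0.
    + by move=> i; rewrite size_takel ?sy.
    + by move=> i; rewrite size_takel ?sy'.
    + by split=> [x xp|i]; [exact: ag.1|rewrite !take_takel // ag.2].
    + move=> x /andP[x1 x2]; apply: hc; rewrite ?x1 1?ltnW //.
      by apply: contraTneq x2 => ->; rewrite size_takel ?sy // ltnn.
    + move=> x /andP[x1 x2]; apply: hc'; rewrite ?x1 1?ltnW //.
      by apply: contraTneq x2 => ->; rewrite size_takel ?sy' // ltnn.
    + by move=> i j; rewrite !take_takel // => /co[].
    + by move=> i j; rewrite !take_takel // => /co'[].
  by rewrite /c' eqxx => -[_ _ ->].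
have red h2 y2 : marked kd p N h2 y2 ->
    mark_eval (comp_word d0 g f0) kd N c h2 y2 = (mark_eval f0 kd N c' h2 y2).1.
  move=> [[s2 _] _ _ _ _]; rewrite /mark_eval comp_ft; set s := take N _.
  have ss : size s = N by rewrite size_takel // s2.
  have h1 : size (ft f0 s) < n0.
    apply: leq_trans (ft_size_lt d0 _ _) _; rewrite ss -f4 (fl_le d0) //.
  rewrite g1.1 //=; apply: rc => [x xq|i].
    by rewrite sub_comp (sub_idw _ _ g1.1) //; apply: leq_trans xq _.
  rewrite (fixes_take g1.1) // fe_size s2; apply: leq_trans (ft_size_lt d0 _ _) _.
  by rewrite ss.
by rewrite !red // (fm _ _ _ _ _ Npk mh mh' ag).
Qed.

End Levels.

(** If each colour occurred fewer than [t] times, summing over the colours would give at most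
    [t * #|X|] levels. *)
Lemma monochromatic_levels (X : finType) (t : nat) (F : nat -> X) :
  exists s : seq nat, [/\ size s = t, sorted ltn s, all (fun j => j < (t * #|X|).+1) s &
    forall i j, i \in s -> j \in s -> F i = F j].
Proof.
have [x hx] : exists x, t <= count (fun j => F j == x) (iota 0 (t * #|X|).+1).
  apply/existsP; apply: contraT => /existsPn nx.
  have e : \sum_(x : X) count (fun j => F j == x) (iota 0 (t * #|X|).+1) = (t * #|X|).+1.
    rewrite -[RHS](size_iota 0) -sum1_size.
    rewrite (eq_bigr (fun x => \sum_(j <- iota 0 (t * #|X|).+1 | F j == x) 1)); last first.
      by move=> x _; rewrite sum1_count.
    rewrite (exchange_big_dep xpredT) //=; apply: eq_bigr => j _.
    by rewrite (eq_bigl (pred1 (F j))) ?big_pred1_eq // => x; rewrite /= eq_sym.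
  have : \sum_(x : X) count (fun j => F j == x) (iota 0 (t * #|X|).+1) <= \sum_(x : X) t.
    by apply: leq_sum => x _; have := nx x; rewrite -ltnNge => /ltnW.
  by rewrite e sum_nat_const mulnC ltnn.
pose s := take t (filter (fun j => F j == x) (iota 0 (t * #|X|).+1)).
exists s.
have sub : {subset s <= filter (fun j => F j == x) (iota 0 (t * #|X|).+1)}.
  by move=> i; apply: mem_take.
split.
- by rewrite size_takel // size_filter.
- apply: take_sorted; apply: sorted_filter; [exact: ltn_trans|exact: iota_ltn_sorted].
- by apply/allP => i /sub; rewrite mem_filter mem_iota add0n => /andP[_].
- by move=> i j /sub + /sub; rewrite !mem_filter => /andP[/eqP -> _] /andP[/eqP -> _].
Qed.

Section Fusion.
Variables (D : finType) (d0 : D) (L : finType) (l0 : L) (V : finType)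
  (iota : L -> V) (Y : finType).
Notation node := (seq D).
Notation sub := (sub iota).
Notation determined := (determined iota).
Notation marked := (marked d0 iota).
Notation mark_eval := (mark_eval iota).
Implicit Types (h : node -> V) (y : Y -> node) (x u z s : node) (f g : strong_word D L).
Implicit Types (kd : Y * V * {ffun Y -> D}).

Definition marked_h N kd h y := mark_h l0 iota N (y kd.1.1) kd.1.2 h.
Definition marked_y kd y i := mark_y d0 (y kd.1.1) kd.2 y i.

Lemma marked_size kd y N i : (forall i, size (y i) = N) -> size (marked_y kd y i) = N.+1.
Proof. by move=> sy; rewrite size_rcons sy. Qed.

Lemma marked_take kd y N i : (forall i, size (y i) = N) -> take N (marked_y kd y i) = y i.
Proof. by move=> sy; rewrite /marked_y /mark_y -(sy i) take_rcons_size. Qed.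

Lemma marked_ref p N kd h y : p <= N -> (forall i, size (y i) = N) ->
  (forall x, p <= size x < N -> determined p h x) ->
  (forall i j, take p (y i) = take p (y j) -> y i = y j) ->
  marked kd p N (marked_h N kd h y) (marked_y kd y).
Proof.
move=> pN sy hc co; rewrite /marked.
have tk i : take N (marked_y kd y i) = y i by apply: marked_take.
rewrite tk; split.
- by split=> // i; rewrite (@marked_size _ _ N).
- by rewrite /marked_h /mark_h sy ltnn eqxx.
- move=> i; rewrite tk => e.
  by rewrite /marked_y /mark_y e eqxx -(sy kd.1.1) nth_rcons_size.
- move=> x /andP[px xN] xs; rewrite /marked_h /mark_h; case: (ltnP (size x) N) => xN'.
    case: (hc x); first by rewrite px.
      by move=> [l e]; left; exists l; rewrite /mark_h xN'.
    move=> [i ip e]; right; exists i => //; rewrite /mark_h xN' ifT //.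
    by apply: leq_ltn_trans xN'; rewrite size_take_min geq_minr.
  by left; exists l0; rewrite /mark_h ltnNge xN' (negbTE xs).
- have tkp i : take p (marked_y kd y i) = take p (y i) by rewrite -(take_takel _ pN) tk.
  move=> i j; rewrite !tkp !tk => /co e; split=> // ne.
  rewrite /marked_y /mark_y e; congr rcons.
  by move: ne; rewrite e => /eqP/negbTE ->.
Qed.

Lemma level_homogeneous kd p m (C : finType) : p <= m -> exists n, m <= n /\
  forall c : nat -> (node -> V) -> (Y -> node) -> C, (forall n, resp n (c n)) ->
  exists f, [/\ fixes p f, fl f m <= n &
    forall N N' h y h' y', N < m -> N' < m -> marked kd p N h y -> marked kd p N' h' y' ->
      agree p h y h' y' -> mark_eval f kd N c h y = mark_eval f kd N' c h' y'].
Proof.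
move=> pm; pose X : finType := {ffun ctx D V Y p -> C}.
pose k := ((m - p) * #|X|).+1.
have [n [pn H]] := @many_levels D d0 L l0 V iota Y kd p k C.
exists (n + m); split; first exact: leq_addl.
move=> c rc; have [f [f1 f3 f4 _ fm]] := H c rc.
pose up h x := if size x < p then h x else iota l0.
pose ext j y (i : Y) := y i ++ nseq j d0.
(* The reference object with its mark on level [p + j]: between [p] and the mark all contents are
   the default and the branches follow [d0], so its colour depends on the levels below [p] only. *)
pose col j h y :=
  mark_eval f kd (p + j) c (marked_h (p + j) kd (up h) (ext j y)) (marked_y kd (ext j y)).
have rcol j : resp p (col j).
  move=> h h' y y' e1 e2; apply: (@mark_eval_resp D d0 L V iota Y C f kd (p + j) c rc).
    move=> x _; rewrite /marked_h /mark_h /up /ext e2; case: ifP => // _.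
    by case: ifP => // /e1.
  by move=> i; rewrite /marked_y /mark_y /ext !e2.
have [js [sjs sorted_js js_lt js_eq]] := @monochromatic_levels X (m - p)
  (fun j => @enc D V (iota l0) Y C p (col j)).
(* The levels from [p] to [m - 1] are sent to levels [p + j] of equal colour; from [m] on they
   continue at [p + k], the level from which [f] is plain. *)
pose lam n := if n < p then n else if n < m then p + nth 0 js (n - p) else p + k + (n - m).
have js_ltk q : q < m - p -> nth 0 js q < k.
  by move=> h; move/all_nthP: js_lt; apply; rewrite sjs.
have lamS q : lam q < lam q.+1.
  rewrite /lam; case: (ltnP q p) => h1; case: (ltnP q.+1 p) => h2; case: (ltnP q m) => h3;
    case: (ltnP q.+1 m) => h4; try lia.
    rewrite ltn_add2l; have -> : q.+1 - p = (q - p).+1 by lia.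
    by apply: (sorted_ltn_nth ltn_trans) sorted_js _ _ _ _ _; rewrite ?inE ?sjs; lia.
  by have := js_ltk (q - p); lia.
pose sl := select d0 l0 lamS.
have idsl : fixes p sl by apply: select_idw => q qp; rewrite /lam qp.
exists (comp_word d0 f sl); split.
- by apply: fixes_comp => //; case: f1.
- rewrite comp_fl /= /lam ltnNge pm ltnn /= subnn addn0 f4; exact: leq_addr.
have key N h y : N < m -> marked kd p N h y -> exists2 j, j \in js &
    mark_eval (comp_word d0 f sl) kd N c h y = col j h (fun i => take p (y i)).
  move=> Nm mk; have [[sy pN] hs ts hc co] := mk.
  exists (nth 0 js (N - p)); first by apply: mem_nth; rewrite sjs; lia.
  set j := nth _ _ _; rewrite (mark_eval_comp d0) //.
  have ss : size (take N (y kd.1.1)) = N by rewrite size_takel ?sy.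
  have nE : size (ft sl (take N (y kd.1.1))) = p + j.
    by rewrite /= (select_size d0) ss /lam ltnNge pN Nm /=.
  have jk : j < k by apply: js_ltk; lia.
  have mk' : marked kd p (p + j) (sub sl h) (fun i => take (p + j).+1 (fe sl (y i))).
    rewrite -nE; apply: marked_sub mk _ _ _ => //.
    - by move=> u; apply: lower_idw.
    - by move=> i i'; rewrite !(fixes_take idsl) // sy leqW.
    - by rewrite nE leq_addr.
  rewrite nE /col; apply: fm => //; first by rewrite ltn_add2l.
    apply: marked_ref; rewrite ?leq_addr //.
    - by move=> i; rewrite size_cat size_nseq size_takel // sy leqW.
    - by move=> x /andP[x1 _]; left; exists l0; rewrite /up ltnNge x1.
    - move=> i i'; rewrite /ext !take_size_cat ?size_takel ?sy ?leqW // => -> //.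
  split=> [x xp|i].
    rewrite (sub_idw _ _ idsl) // /marked_h /mark_h /up xp ifT //; lia.
  have sp i' : size (ext j (fun i => take p (y i)) i') = p + j.
    by rewrite size_cat size_nseq size_takel // sy leqW.
  rewrite take_takel ?(fixes_take idsl) ?sy ?leqW ?leq_addr //.
  rewrite -[RHS](take_takel _ (leq_addr j p)) marked_take //.
  by rewrite /ext take_size_cat // size_takel // sy leqW.
move=> N N' h y h' y' Nm Nm' mk mk' ag.
have [j jin ->] := key _ _ _ Nm mk; have [j' jin' ->] := key _ _ _ Nm' mk'.
have s1 : forall i, size (take p (y i)) = p.
  by case: mk => -[sy pN] _ _ _ _ i; rewrite size_takel // sy leqW.
rewrite (encP d0 (rcol j) (rcol j') (js_eq _ _ jin jin')) //.
by apply: rcol => [x xp|i]; [exact: ag.1|exact: ag.2].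
Qed.

End Fusion.

(** * Fusion over all base levels and induction on the variables *)

Section Ramsey.
Variables (D : finType) (d0 : D) (L : finType) (l0 : L) (V : finType)
  (iota : L -> V) (Y : finType).
Notation node := (seq D).
Notation sub := (sub iota).
Notation determined := (determined iota).
Notation marked := (marked d0 iota).
Notation mark_eval := (mark_eval iota).
Notation kind := (Y * V * {ffun Y -> D})%type.
Implicit Types (h : node -> V) (y : Y -> node) (x u z s : node) (f g : strong_word D L).
Implicit Types (kd : kind) (ks : seq kind).

Definition homogeneous C kd p m f (c : nat -> (node -> V) -> (Y -> node) -> C) :=
  forall N N' h y h' y', N < m -> N' < m -> marked kd p N h y -> marked kd p N' h' y' ->
    agree p h y h' y' -> mark_eval f kd N c h y = mark_eval f kd N' c h' y'.

(** Induction on [m - q]: [f0] settles the base level [q], and [f1] settles the later ones for the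
    colouring pulled back along [f0]. The word [f1] does no harm at [q], since it fixes the levels
    below [q] and carries marks to marks. *)
Lemma fusion kd q m (C : finType) : q <= m -> exists n, m <= n /\
  forall c : nat -> (node -> V) -> (Y -> node) -> C, (forall n, resp n (c n)) ->
  exists f, [/\ fixes q f, fl f m <= n & forall p, q <= p -> homogeneous kd p m f c].
Proof.
move=> qm; have [k ek] : exists k, m = q + k by exists (m - q); lia.
elim: k q qm ek => [|k IH] q qm ek.
  exists m; split=> // c rc; exists id_word; split=> // p qp N N' h y h' y' Nm _ [[_ pN] _ _ _ _].
  by lia.
have [n1 [mn1 H1]] := IH q.+1 (ltac:(lia)) (ltac:(lia)).
have [n [n1n H]] := @level_homogeneous D d0 L l0 V iota Y kd q n1 C (ltac:(lia)).
exists n; split; first exact: leq_trans n1n.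
move=> c rc; have [f0 [f0i f0l f0h]] := H c rc.
(* Evaluating a mark on level [N] involves the levels up to and including [N], whence the shift by
   one. *)
pose c' j := if j is N.+1 then mark_eval f0 kd N c else c 0.
have rc' j : resp j (c' j).
  by case: j => [|j]; [exact: rc|exact: (@mark_eval_resp D d0 L V iota Y C f0 kd j c rc)].
have [f1 [f1i f1l f1h]] := H1 c' rc'.
exists (comp_word d0 f0 f1); split.
- by apply: fixes_comp => //; apply: fixes_le f1i.
- by rewrite comp_fl; apply: leq_trans f0l; rewrite (fl_le d0).
move=> p qp N N' h y h' y' Nm Nm' mk mk' ag.
have [[sy pN] _ _ _ _] := mk; have [[sy' pN'] _ _ _ _] := mk'.
rewrite !(mark_eval_comp d0) //.
move: qp; rewrite leq_eqVlt => /orP[/eqP eqp|qp]; last first.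
  have e N2 h2 y2 : (forall i, size (y2 i) = N2.+1) ->
      mark_eval f0 kd (size (ft f1 (take N2 (y2 kd.1.1)))) c (sub f1 h2)
        (fun i => take (size (ft f1 (take N2 (y2 kd.1.1)))).+1 (fe f1 (y2 i))) = mark_eval f1 kd
          N2 c' h2 y2.
    by [].
  rewrite !e //; exact: (f1h p qp N N' h y h' y').
subst p; have f1q : fixes q f1 by apply: fixes_le f1i.
have lvl N2 y2 : (forall i, size (y2 i) = N2.+1) -> q <= N2 -> N2 < m ->
    q <= size (ft f1 (take N2 (y2 kd.1.1))) < n1.
  move=> s2 q2 N2m; have s3 : size (take N2 (y2 kd.1.1)) = N2 by rewrite size_takel ?s2.
  rewrite (leq_trans _ (ft_size_ge f1 _)) ?s3 ?(leq_trans q2) ?(fl_ge d0) //=.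
  apply: leq_trans f1l; apply: leq_trans (ft_size_lt d0 _ _) _.
  by rewrite s3 (fl_le d0).
have tr N2 h2 y2 : N2 < m -> marked kd q N2 h2 y2 ->
    marked kd q (size (ft f1 (take N2 (y2 kd.1.1)))) (sub f1 h2)
      (fun i => take (size (ft f1 (take N2 (y2 kd.1.1)))).+1 (fe f1 (y2 i))).
  move=> N2m mk2; have [[s2 q2] _ _ _ _] := mk2; apply: marked_sub mk2 _ _ _ => //.
  - by move=> u; apply: lower_idw.
  - by move=> i j; rewrite !(fixes_take f1q) // s2 leqW.
  - by case/andP: (lvl _ _ s2 q2 N2m).
apply: (f0h _ _ _ _ _ _ _ _ (tr _ _ _ Nm mk) (tr _ _ _ Nm' mk')).
- by case/andP: (lvl _ _ sy pN Nm).
- by case/andP: (lvl _ _ sy' pN' Nm').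
split=> [x xp|i]; first by rewrite !(sub_idw _ _ f1q) // ag.1.
have h1 := lvl _ _ sy pN Nm; have h2 := lvl _ _ sy' pN' Nm'.
rewrite !take_takel; try by lia.
by rewrite !(fixes_take f1q) ?sy ?sy' ?leqW // ag.2.
Qed.

(* The list ks gives the kinds of the marked nodes in decreasing order of level. *)
Fixpoint object ks p h y : Prop :=
  if ks is kd :: ks' then
    exists p0, [/\ p0 < p, object ks' p0 h (fun i => take p0 (y i)) & marked kd p0 p.-1 h y]
  else p = 0.

Definition last_level f ks p y :=
  if ks is kd :: _ then (size (ft f (take p.-1 (y kd.1.1)))).+1 else 0.

Definition object_eval C f ks p (c : nat -> (node -> V) -> (Y -> node) -> C) h y :=
  let q := last_level f ks p y in c q (sub f h) (fun i => take q (fe f (y i))).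

Lemma object_low f ks p h y : object ks p h y -> (forall i, size (y i) = p) ->
  let ps := last_level f ks p y in
  [/\ ps <= fl f p, forall u, size u < p -> lower iota f h ps u &
    forall i j, take ps (fe f (y i)) = take ps (fe f (y j)) -> y i = y j].
Proof.
case: ks => [|kd ks] /=.
  move=> -> sy; split=> // i j _.
  by rewrite (size0nil (sy i)) (size0nil (sy j)).
move=> [p0 [p0p _ [[sy' p0N] hs ts hc co]]] sy.
have [N eN] : exists N, p = N.+1 by exists p.-1; lia.
rewrite {p p0p}eN /= in sy' p0N hs ts hc co sy *.
set s := take N _ in hs ts hc co *; set ps := _.+1.
have ss : size s = N by rewrite size_takel ?sy.
have lo w : size w < N -> size (ft f w) < ps.
  move=> wN; rewrite ltnS; apply: leq_trans (ft_size_ge f _).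
  by apply: leq_trans (ltnW (ft_size_lt d0 _ _)) _; rewrite (fl_le d0) ss.
have psN : ps <= fl f N.+1 by rewrite /ps -ss; apply: (ft_size_lt d0).
split=> //.
- move=> u; rewrite ltnS leq_eqVlt => /orP[/eqP su|su]; last first.
    by right; exists (size u); rewrite take_size //; apply: lo.
  have [->|us] := eqVneq u s; first by right; exists (size s); rewrite take_size.
  case: (hc u _ us); [by rewrite su leqnn andbT|by left|].
  move=> [i ip e]; right; exists i => //; apply: lo.
  by rewrite size_take_min; lia.
- move=> i j e.
  have flN : fl f N <= ps by rewrite ltnW // ltnS -ss ft_size_ge.
  have eN : take N (y i) = take N (y j).
    by apply: (@fe_inj D d0 L f); rewrite -!take_fe ?sy //; apply: take_eq_le e.
  have [es|/eqP ns] := eqVneq (take N (y i)) s; last first.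
    by case: (co i j) => [|_]; [apply: take_eq_le eN|apply].
  have px v : take N v = s -> prefix s v by move=> <-; apply: prefix_take.
  have nn v : size v = N.+1 -> take N v = s -> nth d0 (fe f v) (size (ft f s)) = nth d0 v N.
    by move=> sv vs; rewrite -ss; apply: nth_ft; rewrite ?sv ?ss //; apply: px.
  rewrite (stack_rcons d0 sy i) (stack_rcons d0 sy j) eN; congr rcons.
  rewrite -(nn (y i)) // -(nn (y j)) -?eN //.
  by rewrite -(@nth_take ps) // e nth_take.
Qed.

Lemma object_size ks p h y : object ks p h y -> ks != [::] -> forall i, size (y i) = p.
Proof.
case: ks => // kd ks [p0 [p0p _ [[sy _] _ _ _ _]]] _ i; rewrite sy; lia.
Qed.

(** By [f1] the last variable may be moved down to the first level above the previous one. The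
    colour then depends on an object with one variable less, to which the induction hypothesis
    applies. *)
Lemma objects_homogeneous ks m (C : finType) : exists n, m <= n /\
  forall c : nat -> (node -> V) -> (Y -> node) -> C, (forall n, resp n (c n)) ->
  exists f, fl f m <= n /\ forall p p' h y h' y', p <= m -> p' <= m ->
    object ks p h y -> object ks p' h' y' ->
    (forall i, size (y i) = p) -> (forall i, size (y' i) = p') ->
    object_eval f ks p c h y = object_eval f ks p' c h' y'.
Proof.
elim: ks C => [|kd ks IH] C.
  exists m; split=> // c rc; exists id_word; split=> // p p' h y h' y' _ _ _ _ _ _.
  by rewrite /object_eval /=; apply: rc => // i; rewrite !take0.
have [n1 [mn1 H1]] := IH C.
have [n [n1n H]] := @fusion kd 0 n1 C (leq0n _).
exists n; split; first exact: leq_trans n1n.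
move=> c rc; have [f1 [_ f1l f1h]] := H c rc.
pose c' q h y := mark_eval f1 kd q c (marked_h l0 iota q kd h y) (marked_y d0 kd y).
have rc' q : resp q (c' q).
  move=> h h' y y' e1 e2; apply: (@mark_eval_resp D d0 L V iota Y C f1 kd q c rc).
    by move=> x _; rewrite /marked_h /mark_h e2; case: ifP => // /e1.
  by move=> i; rewrite /marked_y /mark_y !e2.
have [f2 [f2l f2h]] := H1 c' rc'.
exists (comp_word d0 f1 f2); split.
  by rewrite comp_fl; apply: leq_trans f1l; rewrite (fl_le d0).
have red p h y : p <= m -> object (kd :: ks) p h y -> (forall i, size (y i) = p) ->
    exists p0, [/\ p0 <= m, object ks p0 h (fun i => take p0 (y i)),
      forall i, size (take p0 (y i)) = p0 &
      object_eval (comp_word d0 f1 f2) (kd :: ks) p c h y = object_eval f2 ks p0 c' h (fun i =>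
        take p0 (y i))].
  move=> pm [p0 [p0p ob mk]] sy; have p0m : p0 <= m by lia.
  have s0 i : size (take p0 (y i)) = p0 by rewrite size_takel // sy ltnW.
  exists p0; split=> //.
  have [N eN] : exists N, p = N.+1 by exists p.-1; lia.
  rewrite {p}eN /= in pm p0p mk sy *.
  have [ps_le lo inj] := object_low f2 ob s0.
  rewrite /object_eval; set ps := last_level f2 ks p0 _ in ps_le lo inj *.
  transitivity (mark_eval (comp_word d0 f1 f2) kd N c h y); first by [].
  have fy i : take ps (fe f2 (take p0 (y i))) = take ps (fe f2 (y i)).
    by rewrite -take_fe ?sy 1?ltnW // take_takel.
  have ss : size (take N (y kd.1.1)) = N by rewrite size_takel ?sy.
  rewrite (mark_eval_comp d0) //; set n' := size (ft f2 _).
  have n'l : n' < n1.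
    apply: leq_trans (ft_size_lt d0 _ _) _; rewrite ss.
    by apply: leq_trans f2l; rewrite (fl_le d0).
  have psn : ps <= n'.
    apply: leq_trans ps_le (leq_trans _ (ft_size_ge _ _)).
    by rewrite (fl_le d0) ss.
  have mk' : marked kd ps n' (sub f2 h) (fun i => take n'.+1 (fe f2 (y i))).
    by apply: marked_sub mk _ _ _ => // i j e; apply: inj; rewrite !fy.
  pose Z i := take ps (fe f2 (take p0 (y i))).
  have sZ i : size (Z i) = ps by rewrite size_takel // fe_size s0.
  have mkr : marked kd ps ps (marked_h l0 iota ps kd (sub f2 h) Z) (marked_y d0 kd Z).
    apply: marked_ref => // [x /andP[x1 x2]|i j]; first by lia.
    by rewrite !take_oversize ?sZ.
  (* The mark on its actual level [n'] is compared with a mark of the same kind placed on the base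
     level [ps] itself. *)
  rewrite (f1h ps (leq0n _) _ _ _ _ _ _ n'l (leq_ltn_trans psn n'l) mk' mkr) //.
  split=> [x xps|i]; first by rewrite /marked_h /mark_h xps.
  by rewrite (marked_take d0 kd _ sZ) take_takel ?(leq_trans psn) // /Z fy.
move=> p p' h y h' y' pm pm' ob ob' sy sy'.
have [p0 [p0m ob0 s0 ->]] := red p h y pm ob sy.
have [p0' [p0m' ob0' s0' ->]] := red p' h' y' pm' ob' sy'.
exact: f2h.
Qed.

(** The counterpart of fusion for the levels after the last variable, where no variable begins: the
    contents there are made irrelevant for all base levels at once. *)
Lemma end_fusion kd q m (C : finType) : q <= m -> exists n, m <= n /\
  forall c : (node -> V) -> C, (forall h h', (forall x, size x < n -> h x = h' x) -> c h = c h') ->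
  exists f, [/\ fixes q f, fl f m = n & forall p h h', q <= p <= m ->
    (forall x, size x < p -> h x = h' x) ->
    (forall x, p <= size x < m -> determined p h x) -> (forall x, p <= size x < m ->
      determined p h' x) ->
    c (sub f h) = c (sub f h')].
Proof.
move=> qm; have [k ek] : exists k, m = q + k by exists (m - q); lia.
elim: k q qm ek => [|k IH] q qm ek.
  exists m; split=> // c rc; exists id_word; split=> // p h h' /andP[qp pm] e _ _.
  by apply: rc => x xm; rewrite /sub /=; apply: e; lia.
have [n1 [mn1 H1]] := IH q.+1 (ltac:(lia)) (ltac:(lia)).
have [n [n1n H]] := @many_levels D d0 L l0 V iota Y kd q (n1 - q) C.
have eqn : q + (n1 - q) = n1 by lia.
rewrite eqn in n1n H.
exists n; split; first exact: leq_trans n1n.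
move=> c rc.
have [f0 [[f0i _] _ f0l f0e _]] :=
  H (fun j h (y : Y -> node) => c (fun x => if size x < j then h x else iota l0)) (ltac:(
    by move=> j h h' y y' e _; apply: rc => x _; case: ifP => // /e)).
pose c' h := c (sub f0 h).
have rc' h h' : (forall x, size x < n1 -> h x = h' x) -> c' h = c' h'.
  move=> e; apply: rc => x xn; apply: (sub_lt d0 iota e); by rewrite f0l.
have [f1 [f1i f1l f1h]] := H1 c' rc'.
have cE h : c (sub (comp_word d0 f0 f1) h) = c' (sub f1 h).
  by apply: rc => x _; rewrite sub_comp.
exists (comp_word d0 f0 f1); split.
- by apply: fixes_comp => //; apply: fixes_le f1i.
- by rewrite comp_fl f1l.
move=> p h h' /andP[qp pm] e hc hc'; rewrite !cE.
move: qp; rewrite leq_eqVlt => /orP[/eqP eqp|qp]; last first.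
  by apply: (f1h p) => //; rewrite qp.
subst p; have f1q : fixes q f1 by apply: fixes_le f1i.
have tr h2 : (forall x, q <= size x < m -> determined q h2 x) ->
    forall x, q <= size x < n1 -> determined q (sub f1 h2) x.
  move=> hc2 x /andP[qx xn]; case E: (fv f1 x) => [l|u].
    by left; exists l; rewrite /sub E.
  apply: (determined_sub d0 E); case: (ltnP (size u) q) => uq; first exact: lower_idw.
  apply: (lower_determined (p := q)); first by move=> w; apply: lower_idw.
  by apply: hc2; rewrite uq (fv_inr_size d0 E) // f1l.
(* A constant family of branches never splits, so it meets the conditions of [many_levels]. *)
pose yc (i : Y) := nseq n1 d0.
have cut h2 : c' h2 = c (fun x => if size x < n then sub f0 h2 x else iota l0).
  by apply: rc => x ->.
rewrite !cut; apply: (f0e _ yc _ yc).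
- by move=> i; rewrite size_nseq.
- by move=> i; rewrite size_nseq.
- by split=> // x xq; rewrite !(sub_idw _ _ f1q) // e.
- exact: tr.
- exact: tr.
- by [].
- by [].
Qed.

(** Because [f1] ignores whatever follows the last variable, the colour may be computed with the
    default letter from there on. This makes it a colouring of objects, for which [f2] is chosen. *)
Lemma ramsey_objects kd ks m (C : finType) : exists n, m <= n /\
  forall c : (node -> V) -> C, (forall h h', (forall x, size x < n -> h x = h' x) -> c h = c h') ->
  exists f, fl f m <= n /\ forall p p' h y h' y', p <= m -> p' <= m ->
    object (kd :: ks) p h y -> object (kd :: ks) p' h' y' ->
    (forall x, p <= size x < m -> determined p h x) -> (forall x, p' <= size x < m ->
      determined p' h' x) ->
    (forall x, m <= size x -> h x = iota l0) -> (forall x, m <= size x -> h' x = iota l0) ->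
    c (sub f h) = c (sub f h').
Proof.
have [n1 [mn1 H1]] := objects_homogeneous (kd :: ks) m C.
have [n [n1n H]] := @end_fusion kd 0 n1 C (leq0n _).
exists n; split; first exact: leq_trans n1n.
move=> c rc; have [f1 [_ f1l f1h]] := H c rc.
pose c' q h (y : Y -> node) := c (sub f1 (ref_h l0 iota q h)).
have rc' q : resp q (c' q).
  move=> h h' y y' e _; apply: rc => x _; rewrite /sub; case: (fv f1 x) => // u.
  by rewrite /ref_h; case: ifP => // /e.
have [f2 [f2l f2h]] := H1 c' rc'.
exists (comp_word d0 f1 f2); split.
  by rewrite comp_fl -f1l (fl_le d0).
have red p h y : p <= m -> object (kd :: ks) p h y ->
    (forall x, p <= size x < m -> determined p h x) -> (forall x, m <= size x -> h x = iota l0) ->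
    c (sub (comp_word d0 f1 f2) h) = object_eval f2 (kd :: ks) p c' h y.
  move=> pm ob hc hm; have sy := object_size ob isT.
  have [ps_le lo _] := object_low f2 ob sy.
  rewrite (rc _ (sub f1 (sub f2 h))); last by move=> x _; rewrite sub_comp.
  rewrite /object_eval /c'; set ps := last_level _ _ _ _ in ps_le lo *.
  apply: (f1h ps).
  - by apply: leq_trans ps_le (leq_trans _ f2l); rewrite (fl_le d0).
  - by move=> x xps; rewrite /ref_h xps.
  - move=> x _; case E: (fv f2 x) => [l|u]; first by left; exists l; rewrite /sub E.
    apply: (determined_sub d0 E); case: (ltnP (size u) p) => up; first exact: lo.
    case: (ltnP (size u) m) => um; last by left; exists l0; apply: hm.
    by apply: lower_determined lo _; apply: hc; rewrite up.
  - by move=> x /andP[x1 _]; left; exists l0; rewrite /ref_h ltnNge x1.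
move=> p p' h y h' y' pm pm' ob ob' hc hc' hm hm'.
rewrite (red p h y) // (red p' h' y') //; apply: f2h => //.
- exact: object_size ob isT.
- exact: object_size ob' isT.
Qed.

End Ramsey.

(** * Skew subtrees *)

Section Branching.
Variable T : eqType.
Implicit Types u v w : seq T.

Lemma branch u v : [\/ prefix u v, prefix v u |
  exists w d d', [/\ d != d', prefix (rcons w d) u & prefix (rcons w d') v]].
Proof.
elim: u v => [|a u IH] [|c v]; try by [constructor 1|constructor 2].
rewrite !prefix_cons [c == a]eq_sym; have [->|ac] /= := eqVneq a c.
  case: (IH v) => [h|h|[w [d [d' [dd h1 h2]]]]]; [by constructor 1|by constructor 2|].
  by constructor 3; exists (c :: w), d, d'; rewrite /= eqxx h1 h2.
by constructor 3; exists [::], a, c; rewrite /= !eqxx !prefix0s.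
Qed.

Lemma branch_lcp u v w d d' : d != d' -> prefix (rcons w d) u -> prefix (rcons w d') v ->
  lcp u v = size w.
Proof.
elim: w u v => [|a w IH] [|c u] [|e v] //= dd; rewrite ?prefix_cons.
  by move=> /andP[/eqP <- _] /andP[/eqP <- _]; rewrite (negbTE dd).
move=> /andP[/eqP <- h1] /andP[/eqP <- h2]; rewrite eqxx; congr _.+1.
exact: IH dd h1 h2.
Qed.

Lemma branch_incomp u v w d d' : d != d' -> prefix (rcons w d) u -> prefix (rcons w d') v ->
  ~~ prefix u v.
Proof.
move=> dd h1 h2; apply/negP => uv.
have e : rcons w d = rcons w d'.
  by apply: (prefix_eq_size (prefix_trans h1 uv) h2); rewrite !size_rcons.
by move/eqP: e; rewrite eqseq_rcons eqxx (negbTE dd).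
Qed.

Lemma sprefix_size u v : sprefix u v = prefix u v && (size u < size v).
Proof.
rewrite /sprefix; case uv: (prefix u v) => //=.
apply/idP/idP => [n|]; last by apply: contraTneq => ->; rewrite ltnn.
rewrite ltnNge; apply: contra n => le; rewrite -(prefix_take_eq uv).
by rewrite take_oversize.
Qed.

End Branching.

Lemma branch_lex b (u v w : seq 'I_b) d d' : d != d' -> prefix (rcons w d) u ->
  prefix (rcons w d') v -> lex_le u v = (d < d').
Proof.
move=> dd h1 h2; rewrite /lex_le (negbTE (branch_incomp dd h1 h2)) /=.
have dd' : d' != d by rewrite eq_sym.
rewrite (branch_incomp dd' h2 h1) /= (branch_lcp dd h1 h2).
have s1 := size_prefix h1; have s2 := size_prefix h2.
rewrite !size_rcons in s1 s2.
rewrite (nth_map d) // (nth_map d) //.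
by rewrite (nth_prefix d h1) ?size_rcons // (nth_prefix d h2) ?size_rcons // !nth_rcons_size.
Qed.

Section TreeMap.
Variables (b n k : nat) (d0 : 'I_b) (s : seq 'I_b -> node b n) (S : {set node b n}).
Hypothesis s_succ : forall x d, (size x).+1 < k -> prefix (rcons (s x) d) (s (rcons x d)).
Hypothesis s_mem : forall x, size x < k -> s x \in S.
Hypothesis s_onto : forall t, t \in S -> exists2 x, size x < k & t = s x.
Implicit Types x y z : seq 'I_b.

Lemma tree_prefix x y : size y < k -> prefix x y -> prefix (s x) (s y).
Proof.
elim/last_ind: y => [|y d IH]; first by rewrite prefixs0 => _ /eqP ->; apply: prefix_refl.
rewrite size_rcons => yk /prefix_rcons_inv[->|/IH h]; first exact: prefix_refl.
apply: prefix_trans (h (ltnW yk)) _.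
exact: prefix_trans (prefix_rcons _ _) (s_succ _ yk).
Qed.

Lemma tree_rcons x y d : size y < k -> prefix (rcons x d) y -> prefix (rcons (s x) d) (s y).
Proof.
move=> yk xy; apply: prefix_trans (tree_prefix yk xy); apply: s_succ.
by have := size_prefix xy; rewrite size_rcons => h; apply: leq_ltn_trans h yk.
Qed.

Lemma tree_lt x y : size y < k -> prefix x y -> size x < size y -> size (s x) < size (s y).
Proof.
move=> yk xy lt; have := tree_rcons yk (prefix_rcons_nth d0 xy lt).
by move=> /size_prefix; rewrite size_rcons.
Qed.

(** If [x] and [y] branch off from some [w], so do [s x] and [s y] from [s w]; if [y] is a proper
    initial segment of [x], lengths contradict. *)
Lemma tree_reflect x y : size x < k -> size y < k -> prefix (s x) (s y) -> prefix x y.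
Proof.
move=> xk yk h; case: (branch x y) => [//|yx|[w [d [d' [dd h1 h2]]]]].
  case: (ltnP (size y) (size x)) => lt;
    last by rewrite -(prefix_take_eq yx) take_oversize ?prefix_refl.
  by have := leq_trans (tree_lt xk yx lt) (size_prefix h); rewrite ltnn.
by move: (branch_incomp dd (tree_rcons xk h1) (tree_rcons yk h2)); rewrite h.
Qed.

Lemma tree_inj x y : size x < k -> size y < k -> s x = s y -> x = y.
Proof.
move=> xk yk e; apply: prefix_anti; apply: tree_reflect => //; rewrite e; exact: prefix_refl.
Qed.

Lemma tree_below x : size x < k ->
  [set t in S | prefix t (s x)] = [set s (take i x) | i : 'I_(size x).+1].
Proof.
move=> xk; apply/setP => t; rewrite inE; apply/andP/imsetP => [[tS tx]|[i _ ->]]; last first.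
  split; first by apply: s_mem; rewrite size_take_min; apply: leq_ltn_trans (geq_minr _ _) xk.
  by apply: tree_prefix => //; apply: prefix_take.
have [y yk e] := s_onto tS; rewrite e in tx.
have yx := tree_reflect yk xk tx.
have lt : size y < (size x).+1 by rewrite ltnS size_prefix.
by exists (Ordinal lt) => //=; rewrite (prefix_take_eq yx).
Qed.

Lemma card_tree_below x : size x < k -> #|[set t in S | prefix t (s x)]| = (size x).+1.
Proof.
move=> xk; rewrite tree_below // card_imset ?card_ord // => i j /tree_inj e.
have si (i' : 'I_(size x).+1) : size (take i' x) = i'.
  by rewrite size_takel // -ltnS ltn_ord.
by apply: val_inj; rewrite /= -(si i) -(si j) e // si; have := ltn_ord i; have := ltn_ord j; lia.
Qed.

Lemma tree_height x : size x < k -> height S (s x) = size x.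
Proof.
move=> xk; apply: succn_inj; rewrite -card_tree_below //.
rewrite (cardsD1 (s x)) inE s_mem // prefix_refl /= add1n /height; congr _.+1.
apply: eq_card => t; rewrite !inE /sprefix -val_eqE /=.
by case: (t \in S); case: (prefix t (s x)); rewrite /= ?andbF ?andbT.
Qed.

End TreeMap.

Lemma chain_below b n (S : {set node b n}) (v : node b n) :
  chain [set t in S | prefix t v].
Proof.
apply/'forall_in_forall_inP => t; rewrite inE => /andP[_ h1] u; rewrite inE => /andP[_ h2].
case: (leqP (size t) (size u)) => le; first by rewrite (prefix_total h1 h2).
by rewrite (prefix_total h2 h1) ?orbT // ltnW.
Qed.

(* The isomorphism from b^{<k} onto a k-complete skew subtree S. *)
Definition tree_map b n k (s : seq 'I_b -> node b n) (S : {set node b n}) :=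
  [/\ forall x d, (size x).+1 < k -> prefix (rcons (s x) d) (s (rcons x d)),
      forall x, size x < k -> s x \in S,
      forall t, t \in S -> exists2 x, size x < k & t = s x,
      forall x y, size x < k -> size y < k -> size x < size y -> size (s x) < size (s y) &
      forall x y w (d d' : 'I_b), size x < k -> size x = size y -> prefix (rcons w d) x ->
        prefix (rcons w d') y -> d < d' -> size (s x) <= size (s y)].

Section Skew.
Variables (b n k : nat) (d0 : 'I_b) (S : {set node b n}).
Hypothesis k_gt0 : 0 < k.
Implicit Types (x y z : seq 'I_b) (t u : node b n).

Lemma skew_image s : tree_map k s S -> complete_skew k S.
Proof.
move=> [h1 h2 h3 h4 h5]; apply/and5P; split.
- apply/exists_inP; exists (s [::]); first exact: h2.
  apply/forall_inP => t /h3[x xk ->]; apply: (tree_prefix h1) => //; exact: prefix0s.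
- apply/forallP => C; apply/implyP => /maxsetP[/andP[CS Cc] Cmax].
  have [t tC tmax] : exists2 t, t \in C & forall u, u \in C -> size u <= size t.
    have [t0 t0C] : exists t0, t0 \in C.
      apply/set0Pn/eqP => C0; have := Cmax [set s [::]] _ _.
      rewrite C0 sub0set => X; have/setP/(_ (s [::])) : [set s [::]] = set0.
        apply: X => //; rewrite sub1set h2 //=; apply/'forall_in_forall_inP => v.
        by rewrite inE => /eqP -> v'; rewrite inE => /eqP ->; rewrite prefix_refl.
      by rewrite !inE eqxx.
    by case: (arg_maxnP (fun t : node b n => size t) t0C) => t tC tm; exists t.
  have [x xk e] := h3 t (subsetP CS t tC).
  (* The index of the longest element of [C] is prolonged to length [k - 1]. The elements of [S]
     below [s z] form a chain containing [C], which is all of [C] by maximality and has [k]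
     elements. *)
  pose z := x ++ nseq (k.-1 - size x) d0.
  have zk : size z = k.-1 by rewrite size_cat size_nseq; lia.
  have zk' : size z < k by rewrite zk; lia.
  have <- : [set u in S | prefix u (s z)] = C.
    apply: Cmax; last first.
      apply/subsetP => u uC; rewrite inE (subsetP CS) //=.
      apply: prefix_trans (tree_prefix h1 zk' (prefix_prefix _ _)).
      move/'forall_in_forall_inP: Cc => /(_ u uC t tC); rewrite e => /orP[//|tu].
      have le := tmax u uC; rewrite e in le.
      by rewrite -(prefix_take_eq tu) take_oversize ?prefix_refl.
    by rewrite chain_below andbT; apply/subsetP => u; rewrite inE => /andP[].
  by rewrite (card_tree_below d0 h1 h2 h3) // zk prednK.
- apply/forall_inP => t /h3[x xk ->]; apply/forall_inP => u /h3[y yk ->].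
  rewrite !(tree_height d0 h1 h2 h3) //; apply/implyP => /eqP e; apply/implyP.
  case: (branch x y) => [xy|yx|[w [d [d' [dd w1 w2]]]]].
  + by rewrite -(prefix_take_eq xy) e take_size.
  + by rewrite -(prefix_take_eq yx) -e take_size.
  rewrite (branch_lex dd (tree_rcons h1 xk w1) (tree_rcons h1 yk w2)) => lt.
  exact: h5 xk e w1 w2 lt.
- apply/forall_inP => t /h3[x xk ->]; apply/forall_inP => u /h3[y yk ->].
  rewrite !(tree_height d0 h1 h2 h3) //; apply/implyP; exact: h4.
- apply/forall_inP => t /h3[x xk ->]; apply/implyP => /exists_inP[u /h3[y yk ->]].
  rewrite sprefix_size => /andP[/(tree_reflect d0 h1 xk yk) xy lt].
  have xy' : size x < size y.
    rewrite ltnNge; apply: contraL lt => le; rewrite -leqNgt.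
    by rewrite -(prefix_take_eq xy) take_oversize.
  have xk' : (size x).+1 < k by apply: leq_ltn_trans xy' yk.
  apply/forallP => i; apply/cards1P; exists (s (rcons x i)); apply/setP => v; rewrite !inE.
  apply/andP/eqP => [[/and3P[vS sv nv] pv]|->].
    have [z zk e] := h3 v vS; rewrite {v}e in sv nv pv vS *.
    have xz : prefix x z.
      by apply: (tree_reflect d0 h1) => //; apply: prefix_trans (prefix_rcons _ i) pv.
    have ltz : size x < size z.
      rewrite ltnNge; apply: contraL pv => le; apply/negP => /size_prefix.
      by rewrite size_rcons -(prefix_take_eq xz) take_oversize // ltnn.
    have c1 := prefix_rcons_nth d0 xz ltz.
    have iE : nth d0 z (size x) = i.
      have := prefix_eq_size (tree_rcons h1 zk c1) pv; rewrite !size_rcons => /(_ erefl) /eqP.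
      by rewrite eqseq_rcons => /andP[_ /eqP].
    rewrite iE in c1; have := size_prefix c1; rewrite size_rcons leq_eqVlt => /orP[/eqP es|lts].
      by congr s; rewrite -(prefix_take_eq c1) size_rcons es take_size.
    case/negP: nv; apply/exists_inP; exists (s (rcons x i)); first by apply: h2; rewrite size_rcons.
    rewrite !sprefix_size (tree_prefix h1) ?size_rcons ?prefix_rcons //=.
    rewrite (tree_prefix h1 zk c1) /=.
    rewrite (tree_lt d0 h1) ?size_rcons ?prefix_rcons //=.
    by rewrite (tree_lt d0 h1) ?size_rcons.
  split; last exact: h1.
  apply/and3P; split; first by apply: h2; rewrite size_rcons.
    by rewrite sprefix_size (tree_prefix h1) ?(tree_lt d0 h1) ?size_rcons ?prefix_rcons.
  apply/negP => /exists_inP[v' /h3[z zk ->]]; rewrite !sprefix_size =>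
    /andP[/andP[p1 l1] /andP[p2 l2]].
  have q1 := tree_reflect d0 h1 xk zk p1.
  have ri : size (rcons x i) < k by rewrite size_rcons.
  have q2 := tree_reflect d0 h1 zk ri p2.
  have e1 : size x < size z.
    rewrite ltnNge; apply: contraL l1 => le; rewrite -leqNgt.
    by rewrite -(prefix_take_eq q1) take_oversize.
  have e2 : size z < size (rcons x i).
    rewrite ltnNge; apply: contraL l2 => le; rewrite -leqNgt.
    by rewrite -(prefix_take_eq q2) take_oversize.
  by rewrite size_rcons ltnS leqNgt e1 in e2.
Qed.

End Skew.

(** * Naming the nodes of a skew subtree *)

Section SkewNames.
Variables (b n k : nat) (d0 : 'I_b) (S : {set node b n}).
Hypothesis k_gt0 : 0 < k.
Hypothesis skS : complete_skew k S.
Implicit Types (x y z : seq 'I_b) (t u v : node b n).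

Let below t := [set u in S | prefix u t].

Definition child t (d : 'I_b) : node b n :=
  if [pick u | u \in [set u in ImSucc S t | prefix (rcons t d) u]] is Some u then u else t.

Lemma childP t d : t \in S -> nonmaximal S t ->
  [/\ child t d \in ImSucc S t, prefix (rcons t d) (child t d) &
      forall u, u \in ImSucc S t -> prefix (rcons t d) u -> u = child t d].
Proof.
move=> tS nt;
  have/and5P[_ _ _ _ /forall_inP/(_ t tS)/implyP/(_ nt)/forallP/(_ d)/cards1P[v ev]] := skS.
have ch : child t d = v.
  rewrite /child ev; case: pickP => [u|/(_ v)]; rewrite inE; last by rewrite eqxx.
  by move/eqP.
rewrite ch; have : v \in [set v] by rewrite inE.
rewrite -ev inE => /andP[v1 v2]; split=> // u u1 u2.
by apply/set1P; rewrite -ev inE u1 u2.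
Qed.

Lemma card_below_le t : #|below t| <= k.
Proof.
have/and5P[_ /forallP mc _ _ _] := skS.
have hP : (below t \subset S) && chain (below t).
  by rewrite chain_below andbT; apply/subsetP => u; rewrite inE => /andP[].
have [C mC sC] := maxset_exists (P := fun D : {set node b n} => (D \subset S) && chain D) hP.
by have := mc C; rewrite /max_chain mC /= => /eqP <-; apply: subset_leq_card.
Qed.

Lemma card_below_max t : t \in S -> ~~ nonmaximal S t -> #|below t| = k.
Proof.
move=> tS nt; have/and5P[_ /forallP/(_ (below t))/implyP mc _ _ _] := skS.
apply/eqP/mc/maxsetP; split.
  by rewrite chain_below andbT; apply/subsetP => u; rewrite inE => /andP[].
move=> C /andP[CS Cc] sub; apply/eqP; rewrite eqEsubset sub andbT.
apply/subsetP => u uC; rewrite inE (subsetP CS) //=.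
have tC : t \in C by apply: (subsetP sub); rewrite inE tS prefix_refl.
move/'forall_in_forall_inP: Cc => /(_ u uC t tC) /orP[//|tu].
have [->|ne] := eqVneq u t; first exact: prefix_refl.
case/negP: nt; apply/exists_inP; exists u; first exact: (subsetP CS).
by rewrite /sprefix tu eq_sym.
Qed.

Lemma below_child t d : t \in S -> nonmaximal S t ->
  child t d \in S /\ #|below (child t d)| = #|below t|.+1.
Proof.
move=> tS nt; have [c1 c2 _] := childP d tS nt.
move: c1; rewrite inE => /and3P[cS sc nb]; split=> //.
have tc : prefix t (child t d) by case/andP: sc.
rewrite (cardsD1 (child t d)) inE cS prefix_refl add1n; congr _.+1.
apply: eq_card => u; rewrite !inE; apply/andP/andP => [[ne /andP[uS uc]]|[uS ut]]; last first.
  split; last by rewrite uS (prefix_trans ut tc).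
  apply: contraTneq ut => ->; apply/negP => ct.
  by move: sc; rewrite sprefix_size => /andP[_]; rewrite ltnNge size_prefix.
split=> //; case: (leqP (size u) (size t)) => le; first exact: prefix_total uc tc le.
case/negP: nb; apply/exists_inP; exists u => //.
by rewrite sprefix_size (prefix_total tc uc (ltnW le)) le /sprefix uc.
Qed.

(** The map is obtained by iterating [child] from the root. Having fewer than [k] elements of [S]
    below it, an inner node is not maximal, so the iteration does not stop before length [k]. *)
Lemma skew_names : exists s, tree_map k s S.
Proof.
have/and5P[/exists_inP[t0 t0S /forall_inP t0min] _ hlex hlen _] := skS.
pose s x := foldl child t0 x.
have sr x d : s (rcons x d) = child (s x) d by rewrite /s foldl_rcons.
have card_s x : size x < k -> s x \in S /\ #|below (s x)| = (size x).+1.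
  elim/last_ind: x => [_|x d IH].
    split=> //; apply/eqP/cards1P; exists t0; apply/setP => u; rewrite !inE.
    apply/andP/eqP => [[uS ut]|->]; last by rewrite prefix_refl.
    by apply: val_inj; apply: prefix_anti => //; apply: t0min.
  rewrite size_rcons => xk; have [sS e] := IH (ltnW xk).
  have nt : nonmaximal S (s x).
    by apply: contraLR xk => /(card_below_max sS); rewrite e => ->; rewrite ltnn.
  by rewrite sr; have [a ->] := below_child d sS nt; rewrite e.
have s_nm x : (size x).+1 < k -> nonmaximal S (s x).
  move=> xk; have [sS e] := card_s x (ltnW xk).
  by apply: contraLR xk => /(card_below_max sS); rewrite e => ->; rewrite ltnn.
have h1 x d : (size x).+1 < k -> prefix (rcons (s x) d) (s (rcons x d)).
  move=> xk; have [sS _] := card_s x (ltnW xk).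
  by rewrite sr; have [] := childP d sS (s_nm x xk).
have h2 x : size x < k -> s x \in S by move=> /card_s[].
have h3 t : t \in S -> exists2 x, size x < k & t = s x.
  move=> tS.
  (* The walk from [s x] towards [t]: [j] bounds the remaining distance, which each step reduces. *)
  have main j x : size x < k -> prefix (s x) t -> size t <= size (s x) + j ->
      exists2 x', size x' < k & t = s x'.
    elim: j x => [|j IH] x xk px le.
      exists x => //; apply: val_inj; rewrite /= -(prefix_take_eq px) take_oversize //.
      by rewrite addn0 in le.
    have [e|ne] := eqVneq (s x) t; first by exists x.
    have spx : sprefix (s x) t by rewrite /sprefix px.
    have [sS ce] := card_s x xk.
    have nt : nonmaximal S (s x) by apply/exists_inP; exists t.
    have xk1 : (size x).+1 < k.
      have [_ e1] := below_child d0 sS nt.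
      by have := card_below_le (child (s x) d0); rewrite e1 ce.
    have lt : size (s x) < size t by move: spx; rewrite sprefix_size => /andP[].
    set d := nth d0 t (size (s x)).
    have pd : prefix (rcons (s x) d) t by apply: prefix_rcons_nth.
    (* The shortest element of [S] strictly above [s x] and below [t] is an immediate successor of
       [s x], hence the child in the direction of [t]. *)
    pose Q u := [&& u \in S, sprefix (s x) u & prefix u t].
    have Qt : Q t by rewrite /Q tS spx prefix_refl.
    case: (arg_minnP (fun u : node b n => size u) Qt) => u /and3P[uS su ut] umin.
    have uI : u \in ImSucc S (s x).
      rewrite inE uS su /=; apply/negP => /exists_inP[v vS /andP[v1 v2]].
      have Qv : Q v.
        by rewrite /Q vS v1 /=; apply: prefix_trans ut; case/andP: v2.
      by have := umin v Qv; move: v2; rewrite sprefix_size => /andP[_]; rewrite ltnNge =>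
        /negbTE ->.
    have pu : prefix (rcons (s x) d) u.
      apply: prefix_total pd ut _; rewrite size_rcons.
      by move: su; rewrite sprefix_size => /andP[].
    have [_ _ uniq_c] := childP d sS nt.
    have eu := uniq_c u uI pu; rewrite -sr in eu; rewrite eu in ut.
    apply: (IH (rcons x d)) => //; first by rewrite size_rcons.
    have := size_prefix (h1 x d xk1); rewrite size_rcons => h.
    by apply: leq_trans le _; rewrite addnS -addSn leq_add2r.
  apply: (main (size t) [::]) => //; first exact: t0min.
  exact: leq_addl.
have ht x : size x < k -> height S (s x) = size x by exact: tree_height h1 h2 h3 x.
exists s; split=> //.
- move=> x y xk yk lt; move/'forall_in_forall_inP: hlen => /(_ _ (h2 x xk) _ (h2 y yk)).
  by rewrite !ht // lt.
- move=> x y w d d' xk e w1 w2 lt; have yk : size y < k by rewrite -e.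
  move/'forall_in_forall_inP: hlex => /(_ _ (h2 x xk) _ (h2 y yk)).
  have dd : d != d' by apply: contraTneq lt => ->; rewrite ltnn.
  by rewrite !ht // e eqxx /= (branch_lex dd (tree_rcons h1 xk w1) (tree_rcons h1 yk w2)) lt.
Qed.

End SkewNames.

Lemma ft_reflect_rcons (D : finType) (d0 : D) (A : Type) (f : strong_word D A) w w' d :
  prefix (rcons (ft f w) d) (ft f w') -> prefix (rcons w d) w'.
Proof.
move=> h; have p : prefix w w'.
  by apply: (ft_reflect d0) (prefix_trans (prefix_rcons _ _) h).
have lt : size w < size w'.
  rewrite ltnNge; apply: contraL h => le; apply/negP => /size_prefix.
  by rewrite -[in ft f w](prefix_take_eq p) take_oversize // size_rcons ltnn.
have q := prefix_trans (ft_fe_lt d0 f p lt) (fe_ft f w').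
have := prefix_eq_size h q; rewrite !size_rcons => /(_ erefl) /eqP.
rewrite eqseq_rcons => /andP[_ /eqP ->]; exact: prefix_rcons_nth.
Qed.

Lemma ft_size_mono (D : finType) (d0 : D) (A : Type) (f : strong_word D A) w w' :
  size w < size w' -> size (ft f w) < size (ft f w').
Proof.
move=> lt; apply: leq_trans (ft_size_ge f w'); apply: leq_trans (ft_size_lt d0 f w) _.
by rewrite (fl_le d0).
Qed.

(** * From variable words to objects *)

(* The nodes of b^{<m} are placed on pairwise distinct levels, ordered by length and then
   lexicographically. *)
Section Positions.
Variables (b : nat) (d0 : 'I_b).
Implicit Types u v w : seq 'I_b.

Definition pos u : seq 'I_b :=
  foldl (fun w (d : 'I_b) => w ++ d :: nseq (b.-1 * size w + d) d0) [::] u.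

Lemma pos_rcons u d : pos (rcons u d) = pos u ++ d :: nseq (b.-1 * size (pos u) + d) d0.
Proof. by rewrite /pos foldl_rcons. Qed.

Lemma pos_succ u d : prefix (rcons (pos u) d) (pos (rcons u d)).
Proof. by rewrite pos_rcons -cat_rcons prefix_prefix. Qed.

(** This is the recursion of the breadth first numbering of the [b]-ary tree, where the node of
    number [i] has the children [b * i + 1], ..., [b * i + b]. The padding in [pos] is chosen to
    obtain it. *)
Lemma size_pos_rcons u d : size (pos (rcons u d)) = b * size (pos u) + d.+1.
Proof.
have b_gt0 : 0 < b by apply: leq_ltn_trans (ltn_ord d0).
rewrite pos_rcons size_cat /= size_nseq -subn1 mulnBl mul1n addnS addnA subnKC ?addnS //.
exact: leq_pmull.
Qed.

Lemma size_pos_step u v d d' : size (pos u) < size (pos v) ->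
  size (pos (rcons u d)) < size (pos (rcons v d')).
Proof.
rewrite !size_pos_rcons => lt; have := ltn_ord d.
have : b * (size (pos u)).+1 <= b * size (pos v) by rewrite leq_mul2l lt orbT.
by rewrite mulnS; lia.
Qed.

Lemma size_pos_lt u v : size u < size v -> size (pos u) < size (pos v).
Proof.
elim/last_ind: v u => [//|v d' IH] u; case/lastP: u => [|u d].
  by rewrite size_pos_rcons addnS.
by rewrite !size_rcons ltnS => /IH; apply: size_pos_step.
Qed.

Lemma size_pos_lex u v w (d d' : 'I_b) : size u = size v -> prefix (rcons w d) u ->
  prefix (rcons w d') v -> d < d' -> size (pos u) < size (pos v).
Proof.
elim/last_ind: u v => [|u c IH] v; first by move=> _ /size_prefix; rewrite size_rcons.
case/lastP: v => [|v c']; first by rewrite size_rcons.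
rewrite !size_rcons => -[e] /prefix_rcons_inv[/rcons_inj[ew ed]|h1].
  move=> /prefix_rcons_inv[/rcons_inj[ew' ed']|/size_prefix]; last first.
    by rewrite size_rcons ew e ltnn.
  move=> lt; rewrite !size_pos_rcons -ew -ew' -ed -ed'; lia.
move=> /prefix_rcons_inv[/rcons_inj[ew' ed']|h2] lt.
  by have := size_prefix h1; rewrite size_rcons ew' e ltnn.
by apply: size_pos_step; apply: IH h1 h2 lt.
Qed.

Lemma size_pos_inj u v : size (pos u) = size (pos v) -> u = v.
Proof.
move=> e; have es : size u = size v.
  by case: (ltngtP (size u) (size v)) => // /size_pos_lt; rewrite e ltnn.
case: (branch u v) => [h|h|[w [d [d' [dd h1 h2]]]]].
- by rewrite -(prefix_take_eq h) es take_size.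
- by rewrite -(prefix_take_eq h) -es take_size.
case: (ltngtP d d') => lt.
- by have := size_pos_lex es h1 h2 lt; rewrite e ltnn.
- by have := size_pos_lex (esym es) h2 h1 lt; rewrite e ltnn.
- by case/eqP: dd; apply: val_inj.
Qed.

End Positions.

Section Spans.
Variables (b n : nat) (L : finType).
Implicit Types f g : word b n L.

(** With two letters a variable can be given two values, and two variables different ones; so the
    evaluations of [g] tell letters from variables and variables from each other. *)
Lemma span_subset f g : 1 < #|L| -> span g \subset span f ->
  (forall x a, f x = inl a -> g x = inl a) /\ (forall x x', f x = f x' -> g x = g x').
Proof.
move=> /card_gt1P[a1 [a2 [_ _ a12]]] /subsetP sub.
have ev alpha : exists beta, subst g alpha = subst f beta.
  have /sub /imsetP[beta _ ->] : subst g alpha \in span g by apply/imsetP; exists alpha.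
  by exists beta.
have same x x' : f x = f x' -> forall alpha, subst g alpha x = subst g alpha x'.
  by move=> e alpha; have [beta ->] := ev alpha; rewrite !ffunE e.
have lets x a : f x = inl a -> forall alpha, subst g alpha x = a.
  by move=> e alpha; have [beta ->] := ev alpha; rewrite !ffunE e.
have nc (s : node b n) a : ~ (forall alpha : {ffun node b n -> L}, alpha s = a).
  move=> h; move: (h [ffun=> a1]) (h [ffun=> a2]); rewrite !ffunE => e1 e2.
  by rewrite e1 e2 eqxx in a12.
split=> [x a /lets h|x x' /same h].
  case E: (g x) h => [a'|s] h; first by have := h [ffun=> a1]; rewrite ffunE E => ->.
  by case: (@nc s a) => alpha; have := h alpha; rewrite ffunE E.
case E: (g x) h => [a|s]; case E': (g x') => [a'|s'] h.
- by have := h [ffun=> a1]; rewrite !ffunE E E' => ->.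
- by case: (@nc s' a) => alpha; have := h alpha; rewrite !ffunE E E'.
- by case: (@nc s a') => alpha; have := h alpha; rewrite !ffunE E E'.
congr inr; apply/eqP; apply: contraNT a12 => ns.
have := h [ffun t => if t == s then a1 else a2]; rewrite !ffunE E E' !ffunE eqxx.
by rewrite eq_sym (negbTE ns) => ->.
Qed.

End Spans.

Definition tonode b n (s : seq 'I_b) : node b n := insubd [bseq] s.

Lemma tonodeK b n (s : seq 'I_b) : 0 < n -> size s < n -> tonode n s = s :> seq 'I_b.
Proof. by move=> n0 h; rewrite /tonode val_insubd -ltnS prednK // h. Qed.

Lemma node_lt b n (s : node b n) : 0 < n -> size s < n.
Proof. by move=> n0; have := size_bseq s; rewrite -ltnS prednK. Qed.

Section Kinds.
Variables (b k : nat) (A : finType) (d0 : 'I_b).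

Definition ranked : seq (node b k) :=
  sort (fun s t : node b k => size (pos d0 s) <= size (pos d0 t)) (enum {: node b k}).

Lemma mem_ranked s : s \in ranked.
Proof. by rewrite mem_sort mem_enum. Qed.

Lemma ranked_lt i j : i < j -> j < size ranked ->
  size (pos d0 (nth [bseq] ranked i)) < size (pos d0 (nth [bseq] ranked j)).
Proof.
move=> ij jK; rewrite ltn_neqAle; apply/andP; split.
  apply/eqP => /size_pos_inj/val_inj/eqP; rewrite nth_uniq ?sort_uniq ?enum_uniq //.
    by rewrite (ltn_eqF ij).
  exact: ltn_trans ij jK.
apply: (@sorted_leq_nth _ (fun s t : node b k => size (pos d0 s) <= size (pos d0 t))) => //.
- by move=> u v w; apply: leq_trans.
- by apply: sort_sorted => u v; apply: leq_total.
- by rewrite inE; apply: ltn_trans ij jK.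
- exact: ltnW.
Qed.

(** Branches are indexed by tuples of length [k], one entry for each of the [k] nodes on the branch:
    the last entry is the direction in which the last node is left. *)
Definition pad (s : seq 'I_b) : k.-tuple 'I_b := [tuple nth d0 s i | i < k].

Lemma prefix_pad (s : seq 'I_b) : size s < k -> prefix s (pad s).
Proof.
move=> sk; have e : size (take (size s) (pad s)) = size s.
  by rewrite size_takel // size_tuple ltnW.
rewrite prefixE; apply/eqP/(@eq_from_nth _ d0) => // i; rewrite e => lt; rewrite nth_take //.
by rewrite -(tnth_nth d0 (pad s) (Ordinal (ltn_trans lt sk))) tnth_mktuple.
Qed.

Definition kind (s : node b k) :
    k.-tuple 'I_b * (A + node b k) * {ffun k.-tuple 'I_b -> 'I_b} :=
  (pad s, inr s, [ffun y : k.-tuple 'I_b => nth d0 y (size s)]).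

End Kinds.

(** * The object given by a placement of the small tree *)

Section Placement.
Variables (b k M : nat) (A : finType) (d0 : 'I_b) (P : seq 'I_b -> seq 'I_b).
Variable h : seq 'I_b -> A + node b k.
Hypothesis k_gt0 : 0 < k.
Hypothesis P_chain : forall s t d, size t < k -> prefix (rcons s d) t ->
  prefix (rcons (P s) d) (P t).
Hypothesis P_lt : forall s t, size s < k -> size t < k ->
  size (pos d0 s) < size (pos d0 t) -> size (P s) < size (P t).
Hypothesis P_max : forall s, size s < k -> size (P s) < M.
Hypothesis hP : forall s : node b k, h (P s) = inr s.
Hypothesis h_prefix : forall x s, h x = inr s -> prefix (P s) x.
Implicit Types (s t : node b k) (y : k.-tuple 'I_b).

Let K := size (ranked k d0).
Let node_k s : size s < k := node_lt s k_gt0.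
Let rk i := nth [bseq] (ranked k d0) i.

(** The final block of length [M] only makes the track longer than every level at which it will be
    cut. *)
Definition track y : seq 'I_b := P (take k.-1 y) ++ nth d0 y k.-1 :: nseq M d0.

Lemma size_track y : M < size (track y).
Proof. by rewrite size_cat /= size_nseq addnS ltnS leq_addl. Qed.

Lemma track_next (s : seq 'I_b) y : size s < k -> prefix s y ->
  prefix (rcons (P s) (nth d0 y (size s))) (track y).
Proof.
move=> sk sy; have sz : size (take k.-1 y) = k.-1.
  by rewrite size_takel // size_tuple leq_pred.
have st : prefix s (take k.-1 y).
  by apply: prefix_take_le sy _; rewrite -ltnS prednK.
case: (ltnP (size s) k.-1) => le.
  have lt : size s < size (take k.-1 y) by rewrite sz.
  apply: prefix_trans (prefix_prefix _ _); apply: P_chain; first by rewrite sz prednK.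
  by have := prefix_rcons_nth d0 st lt; rewrite nth_take.
have es : s = take k.-1 y by rewrite -(prefix_take_eq st) take_oversize // sz.
have -> : size s = k.-1 by rewrite es.
by rewrite es /track -cat_rcons prefix_prefix.
Qed.

Lemma track_reflect (s : seq 'I_b) y : size s < k -> prefix (P s) (track y) -> prefix s y.
Proof.
move=> sk h1; case: (branch s y) => [//|h2|[w [d [d' [dd h2 h3]]]]].
  by have := size_prefix h2; rewrite size_tuple leqNgt sk.
have wk : size w < k by apply: leq_ltn_trans sk; apply: ltnW; have := size_prefix h2;
  rewrite size_rcons.
have q1 := prefix_trans (P_chain sk h2) h1.
have := track_next wk (prefix_trans (prefix_rcons _ _) h3).
rewrite (nth_prefix d0 h3) ?size_rcons // nth_rcons_size => q2.
have := prefix_eq_size q1 q2; rewrite !size_rcons => /(_ erefl)/rcons_inj[e].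
by rewrite e eqxx in dd.
Qed.

(** The node [w] is the longest common initial segment of [y] and [y']; the tracks run together up
    to [P w] and leave it in different directions. *)
Lemma track_branch y y' : y <> y' -> exists w, [/\ size w < k, prefix (P w) (track y) &
  forall i, (take i (track y) == take i (track y')) = (i <= size (P w))].
Proof.
move=> ne; case: (branch y y') => [h1|h1|[w [d [d' [dd h1 h2]]]]].
- by case: ne; apply: val_inj; apply: prefix_eq_size h1 (prefix_refl _) _; rewrite !size_tuple.
- by case: ne; apply: val_inj; apply/esym; apply: prefix_eq_size h1 (prefix_refl _) _;
  rewrite !size_tuple.
have wk : size w < k by have := size_prefix h1; rewrite size_rcons size_tuple.
have := track_next wk (prefix_trans (prefix_rcons _ _) h1).
have := track_next wk (prefix_trans (prefix_rcons _ _) h2).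
rewrite (nth_prefix d0 h1) ?size_rcons // (nth_prefix d0 h2) ?size_rcons // !nth_rcons_size.
move=> q2 q1; exists w; split=> [//||i]; first exact: prefix_trans (prefix_rcons _ _) q1.
case: leqP => le.
  rewrite -(take_takel (track y) le) -(take_takel (track y') le).
  rewrite (prefix_take_eq (prefix_trans (prefix_rcons _ _) q1)).
  by rewrite (prefix_take_eq (prefix_trans (prefix_rcons _ _) q2)) eqxx.
apply/eqP => e; have szd : size (rcons (P w) d) <= i by rewrite size_rcons.
have szd' : size (rcons (P w) d') <= i by rewrite size_rcons.
have r1 := prefix_take_le q1 szd; have r2 := prefix_take_le q2 szd'.
rewrite e in r1; have := prefix_eq_size r1 r2; rewrite !size_rcons => /(_ erefl)/rcons_inj[e'].
by rewrite e' eqxx in dd.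
Qed.

(** Below this level lie the places of exactly the first [i] nodes in the ranking. *)
Definition level i : nat := if i is j.+1 then (size (P (rk j))).+1 else 0.

Lemma rk_size i j : i < j -> j < K -> size (P (rk i)) < size (P (rk j)).
Proof. by move=> ij jK; apply: P_lt; rewrite ?node_k // ranked_lt. Qed.

Lemma level_lt i : i < K -> level i <= size (P (rk i)).
Proof. by case: i => // i iK; apply: rk_size. Qed.

Lemma level_max : level K <= M.
Proof. by case: K => //= i; apply: P_max. Qed.

Lemma level_cases i t : i < K ->
  [\/ size (P t) < level i, t = rk i | size (P (rk i)) < size (P t)].
Proof.
move=> iK; have tr := mem_ranked d0 t; have et : rk (index t (ranked k d0)) = t by apply: nth_index.
have jK : index t (ranked k d0) < K by rewrite index_mem.
move: jK et; set j := index _ _ => jK et.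
case: (ltngtP j i) => ji; last by constructor 2; rewrite -et ji.
- constructor 1; case: i ji iK => // i; rewrite ltnS leq_eqVlt => /orP[/eqP e|ji] iK /=.
    by rewrite -et e.
  by rewrite ltnS -et ltnW // rk_size // ltnW.
- by constructor 3; rewrite -et rk_size.
Qed.

Lemma level_top t : size (P t) < level K.
Proof.
have tr := mem_ranked d0 t; have et : rk (index t (ranked k d0)) = t by apply: nth_index.
have jK : index t (ranked k d0) < K by rewrite index_mem.
case: K jK rk_size => // i; rewrite ltnS leq_eqVlt => /orP[/eqP e|lt] H /=.
  by rewrite -e et.
by rewrite ltnS -et ltnW // H.
Qed.

Lemma determined_below p x : (forall t, h x = inr t -> size (P t) < p) ->
  determined (@inl A _) p h x.
Proof.
case E: (h x) => [a|t] H; first by left; exists a.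
right; exists (size (P t)); first exact: H.
by rewrite (prefix_take_eq (h_prefix E)) hP E.
Qed.

(** Between two consecutive levels exactly one node [rk i] is placed. No other variable begins
    there, and tracks part only at places of nodes, hence only at [P (rk i)]. *)
Lemma object_track i : i <= K -> forall z, (forall y, z y = take (level i) (track y)) ->
  object d0 (@inl A _) (map (kind A d0) (rev (take i (ranked k d0)))) (level i) h z.
Proof.
elim: i => [|i IH] iK z ez; first by rewrite take0.
rewrite (take_nth [bseq]) // rev_rcons map_cons -/(rk i) [level i.+1]/=.
have sk := node_k (rk i); set s := rk i in sk *; set N := size (P s).
have NM : N < M by apply: P_max.
have ls : level i <= N by apply: level_lt.
have tz q y : q <= N.+1 -> take q (z y) = take q (track y).
  by move=> qN; rewrite ez /= take_takel.
exists (level i); split=> //.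
  apply: IH; first exact: ltnW.
  by move=> y; rewrite tz // ltnW.
have es : take N (z (pad k d0 s)) = P s.
  rewrite tz //; apply: prefix_take_eq; apply: prefix_trans (prefix_rcons _ _) _.
    by apply: track_next; rewrite ?prefix_pad.
rewrite /marked /= es; split.
- split=> // y; rewrite ez /= size_takel //.
  by apply: leq_trans (ltnW (size_track y)).
- exact: hP.
- move=> y; rewrite tz // ez /= => e; rewrite nth_take // ffunE.
  have ps : prefix s y by apply: track_reflect => //; rewrite -e prefix_take.
  by have := track_next sk ps => q; rewrite (nth_prefix d0 q) ?size_rcons // nth_rcons_size.
- move=> x /andP[xl xN] xs; apply: determined_below => t /h_prefix tx.
  case: (level_cases t iK) => [//|et|lt].
    have := size_prefix tx; have tx' := prefix_eq_size tx (prefix_refl x).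
    rewrite et -/s -/N => le; have e : N = size x by apply/eqP; rewrite eqn_leq le xN.
    by case/eqP: xs; rewrite -tx' et.
  by have := leq_trans lt (size_prefix tx); rewrite ltnNge xN.
move=> y y' e; have [<-//|/eqP ne] := eqVneq y y'.
have [w [wk wy H]] := track_branch ne; move: e; rewrite !tz ?(leq_trans ls) // => /eqP;
  rewrite H => lw.
have ew := tonodeK k_gt0 wk.
case: (level_cases (tonode k w) iK) => [|et|]; rewrite ?ew.
- by rewrite ltnNge lw.
- have ews : P s = P w by rewrite /s -et ew.
  split; first by apply/eqP; rewrite H -ews.
  by move=> ns; case: ns; rewrite /N ews prefix_take_eq.
move=> lt; split=> [|_]; first by apply/eqP; rewrite H ltnW.
by apply/eqP; rewrite !ez H.
Qed.

End Placement.

(** * Finite words cut out of a strong word *)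

Section Words.
Variables (b k m N n : nat) (A L : finType) (d0 : 'I_b) (l0 : A).
Variables (el : A -> L) (le : L -> A) (f : strong_word 'I_b A).
Hypotheses (elK : cancel el le) (leK : cancel le el).
Hypotheses (k_gt0 : 0 < k) (km : k <= m) (n_gt0 : 0 < n) (Nn : N <= n).
Let M := size (pos d0 (nseq m d0)).
Hypothesis f_le : fl f M <= N.
Implicit Types (u v w : seq 'I_b) (x t : node b n) (g : word b n L).

Definition placed w := [exists u : node b m, pos d0 u == w].

(** Variables off the positions, and all nodes from level [N] on, receive the letter [l0]. So the
    levels below [N], a bound independent of [n], carry all the information. *)
Definition host : word b n L :=
  [ffun x : node b n => if size x < N then
     match fv f x with
     | inl a => inl (el a)
     | inr w => if placed w then inr (tonode n (ft f w)) else inl (el l0)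
     end
   else inl (el l0)].

Let m_gt0 : 0 < m. Proof. exact: leq_trans km. Qed.

Lemma placed_pos u : size u < m -> placed (pos d0 u).
Proof. by move=> um; apply/existsP; exists (tonode m u); rewrite tonodeK. Qed.

Lemma placed_lt w : placed w -> size w < M.
Proof.
move=> /existsP[u /eqP <-]; apply: size_pos_lt; rewrite size_nseq; exact: node_lt.
Qed.

Lemma size_ft_placed w : placed w -> size (ft f w) < N.
Proof.
move=> /placed_lt h; apply: leq_trans (ft_size_lt d0 f w) _; apply: leq_trans f_le.
by rewrite (fl_le d0).
Qed.

Lemma ft_nodeK w : placed w -> tonode n (ft f w) = ft f w :> seq 'I_b.
Proof. by move=> h; apply: tonodeK n_gt0 (leq_trans (size_ft_placed h) Nn). Qed.

Lemma host_ft w : placed w -> host (tonode n (ft f w)) = inr (tonode n (ft f w)).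
Proof. by move=> h; rewrite ffunE ft_nodeK // size_ft_placed // fv_ft h. Qed.

Lemma host_inr x t : host x = inr t ->
  exists2 w, placed w & t = tonode n (ft f w) /\ fv f x = inr w.
Proof.
rewrite ffunE; case: ifP => // _; case: (fv f x) => [//|w]; case: ifP => // pw [<-].
by exists w.
Qed.

Lemma host_Wv : host \in Wv b n L m.
Proof.
pose s u : node b n := tonode n (ft f (pos d0 u)).
have sK u : size u < m -> s u = ft f (pos d0 u) :> seq 'I_b.
  by move=> um; rewrite ft_nodeK // placed_pos.
rewrite inE; apply/existsP; exists [set s (val u) | u : node b m]; apply/andP; split.
  apply: (skew_image d0 m_gt0 (s := s)); split.
  - move=> u d um; rewrite !sK ?size_rcons ?(ltnW um) //.
    exact: prefix_trans (ft_fe_rcons f (pos_succ d0 u d)) (fe_ft f _).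
  - by move=> u um; rewrite -(tonodeK m_gt0 um); apply: imset_f.
  - by move=> t /imsetP[u _ ->]; exists u => //; apply: node_lt.
  - by move=> u v um vm uv; rewrite !sK //; apply: (ft_size_mono d0); apply: size_pos_lt.
  move=> u v w d d' um e h1 h2 dd; rewrite !sK -?e //; apply/ltnW/(ft_size_mono d0).
  exact: size_pos_lex e h1 h2 dd.
apply/andP; split.
  apply/forallP => x; case E: (host x) => [//|t].
  by have [w /existsP[u /eqP <-] [-> _]] := host_inr E; apply: imset_f.
apply/forall_inP => t /imsetP[u _ ->]; have pu := placed_pos (node_lt u m_gt0).
rewrite host_ft // eqxx /=; apply/forallP => x; apply/implyP => /eqP /host_inr[w pw [e E]].
by rewrite e ft_nodeK //; apply: fv_inr E.
Qed.

(* A variable is encoded by its name s in b^{<k}; it is recovered as the minimum of the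
   occurrences of s. *)
Definition decode (H : seq 'I_b -> A + node b k) : word b n L :=
  [ffun x : node b n => if size x < N then
     match H x with
     | inl a => inl (el a)
     | inr s =>
         if [pick t : node b n | [&& size t < N, H t == inr s &
              [forall t' : node b n, (size t' < N) && (H t' == inr s) ==> prefix t t']]]
         is Some t then inr t else inl (el l0)
     end
   else inl (el l0)].

Lemma decode_lt H H' : (forall u, size u < N -> H u = H' u) -> decode H = decode H'.
Proof.
move=> e; apply/ffunP => x; rewrite !ffunE; case: ifP => // xN; rewrite e //.
case: (H' x) => [//|s]; congr (if _ is Some t then _ else _); apply: eq_pick => t /=.
case tN: (size t < N) => //=; rewrite e //; congr andb; apply: eq_forallb => t'.
by case t'N: (size t' < N) => //=; rewrite e.
Qed.

Section Guest.
Variable g : word b n L.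
Hypotheses (L_gt1 : 1 < #|L|) (g_in : g \in Wv_in k host).

Lemma guest_fv x : g x = if size x < N then
     match fv f x with
     | inl a => inl (el a)
     | inr w => if placed w then g (tonode n (ft f w)) else inl (el l0)
     end
   else inl (el l0).
Proof.
have [|g1 g2] := @span_subset _ _ _ host g L_gt1; first by move: g_in; rewrite inE => /andP[].
case: ifP => xN; last by apply: g1; rewrite ffunE xN.
case E: (fv f x) => [a|w]; first by apply: g1; rewrite ffunE xN E.
case: ifP => pw; last by apply: g1; rewrite ffunE xN E pw.
by apply: g2; rewrite host_ft // ffunE xN E pw.
Qed.

Lemma guest_object :
  exists p h y, [/\ p <= M,
    object d0 (@inl A _) (map (kind A d0) (rev (ranked k d0))) p h y,
    forall w, p <= size w -> determined (@inl A _) p h w,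
    forall w, M <= size w -> h w = inl l0 &
    decode (sub inl f h) = g].
Proof.
have [S [skS vS]] : exists S : {set node b n}, complete_skew k S /\ varword S g.
  by move: g_in; rewrite !inE => /andP[/existsP[S /andP[h1 h2]] _]; exists S.
have [s ts] := skew_names d0 k_gt0 skS; have [s1 s2 s3 s4 s5] := ts.
have [/forallP v1 /forall_inP v2] := andP vS.
have gs u : size u < k -> g (s u) = inr (s u).
  by move=> uk; have /andP[/eqP] := v2 _ (s2 _ uk).
have gp x t : g x = inr t -> t \in S /\ prefix t x.
  move=> e; have tS : t \in S by have := v1 x; rewrite e.
  split=> //; have /andP[_ /forallP/(_ x)/implyP] := v2 _ tS; apply; exact/eqP.
(* Since [g] is constant on the occurrences of each host variable and [s u] is the least occurrence
   of its own variable, [s u] is the first occurrence of a host variable, namely of [P u]. *)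
pose P u := if fv f (s u) is inr w then w else [::].
have sP u : size u < k -> placed (P u) /\ s u = ft f (P u) :> seq 'I_b.
  move=> uk; rewrite /P; have := guest_fv (s u); rewrite gs //; case: ifP => // _.
  case E: (fv f (s u)) => [//|w]; case: ifP => // pw e; split=> //.
  have [_] := gp _ _ (esym e); rewrite ft_nodeK // => h; apply: prefix_anti h _.
  exact: fv_inr E.
have sPK u : size u < k -> tonode n (ft f (P u)) = s u.
  by move=> uk; have [pw e] := sP u uk; apply: val_inj; rewrite /= ft_nodeK.
have P_chain u v d : size v < k -> prefix (rcons u d) v -> prefix (rcons (P u) d) (P v).
  move=> vk uv; have uk : size u < k.
    by apply: leq_ltn_trans vk; apply: ltnW; have := size_prefix uv; rewrite size_rcons.
  apply: (ft_reflect_rcons d0 (f := f)); have [_ <-] := sP u uk; have [_ <-] := sP v vk.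
  exact: (tree_rcons s1).
(* Distinct positions lie on distinct levels, so the weak inequality granted by a skew subtree
   becomes strict. *)
have P_le u v : size u < k -> size v < k -> u <> v -> size (s u) <= size (s v) ->
    size (P u) < size (P v).
  move=> uk vk uv; have [/existsP[u' /eqP pu] ->] := sP u uk.
  have [/existsP[v' /eqP pv] ->] := sP v vk.
  move=> h; rewrite ltn_neqAle; apply/andP; split; last first.
    by rewrite leqNgt; apply: contraL h; rewrite -ltnNge; apply: (ft_size_mono d0).
  apply/eqP; rewrite -pu -pv => /size_pos_inj e; case: uv; apply: (tree_inj d0 s1) => //.
  by rewrite -(sPK u) // -(sPK v) // -pu -pv e.
have P_lt u v : size u < k -> size v < k -> size (pos d0 u) < size (pos d0 v) ->
    size (P u) < size (P v).
  move=> uk vk lt; have uv : u <> v by move=> e; rewrite e ltnn in lt.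
  apply: P_le => //; case: (ltngtP (size u) (size v)) => e.
  - by apply: ltnW; apply: s4.
  - by have := ltn_trans lt (size_pos_lt d0 e); rewrite ltnn.
  case: (branch u v) => [h|h|[w [d [d' [dd h1 h2]]]]].
  - by case: uv; apply: prefix_eq_size h (prefix_refl _) e.
  - by case: uv; apply/esym; apply: prefix_eq_size h (prefix_refl _) (esym e).
  case: (ltngtP d d') => ld; first exact: s5 uk e h1 h2 ld.
    by have := ltn_trans lt (size_pos_lex d0 (esym e) h2 h1 ld); rewrite ltnn.
  by case/eqP: dd; apply: val_inj.
(* Renaming the variables of [g] by nodes of the small tree makes the set of contents independent of
   [n]. *)
pose conv (z : L + node b n) : A + node b k :=
  match z with
  | inl a => inl (le a)
  | inr t => if [pick u : node b k | s u == t] is Some u then inr u else inl l0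
  end.
have convK (u : node b k) : conv (inr (s u)) = inr u.
  rewrite /conv; case: pickP => [u' /eqP e|/(_ u)]; last by rewrite eqxx.
  by congr inr; apply: val_inj; apply: (tree_inj d0 s1) e; apply: node_lt.
have conv_inr z (u : node b k) : conv z = inr u -> z = inr (s u).
  by case: z => [a|t] //=; case: pickP => // u' /eqP <- [->].
pose h w : A + node b k := if placed w then conv (g (tonode n (ft f w))) else inl l0.
have hP (u : node b k) : h (P u) = inr u.
  have uk := node_lt u k_gt0; have [pu e] := sP _ uk.
  by rewrite /h pu sPK // gs // convK.
have h_prefix w (u : node b k) : h w = inr u -> prefix (P u) w.
  rewrite /h; case: ifP => // pw /conv_inr/gp[_]; rewrite ft_nodeK //.
  have [pu ->] := sP _ (node_lt u k_gt0); exact: (ft_reflect d0).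
have P_max u : size u < k -> size (P u) < M by move=> /sP[/placed_lt].
exists (level k d0 P (size (ranked k d0))), h,
  (fun y => take (level k d0 P (size (ranked k d0))) (track M d0 P y)); split.
- exact: level_max.
- by have := object_track k_gt0 P_chain P_lt P_max hP h_prefix (leqnn _) (fun y => erefl);
    rewrite take_size.
- by move=> x _; apply: (determined_below hP h_prefix) => t _; apply: level_top.
- by move=> x; rewrite /h; case: ifP => // /placed_lt; rewrite ltnNge => /negbTE ->.
have sg x : size x < N -> sub inl f h x = conv (g x).
  move=> xN; rewrite /sub guest_fv xN; case: (fv f x) => [a|w]; first by rewrite /= elK.
  by rewrite /h; case: ifP => //= _; rewrite elK.
apply/ffunP => x; rewrite ffunE; case: ifP => xN; last by rewrite guest_fv xN.
rewrite sg //; case E: (g x) => [a|t]; first by rewrite /= leK.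
have [tS tx] := gp _ _ E; have [u uk et] := s3 _ tS.
have eu : t = s (tonode k u) by rewrite tonodeK.
have tN : size t < N by apply: leq_ltn_trans xN; apply: size_prefix.
rewrite eu convK; case: pickP => [t1 /and3P[t1N /eqP]|/(_ t)].
  rewrite sg // => /conv_inr/gp[_ p1] /forallP/(_ (s (tonode k u))) /implyP h1.
  congr inr; apply: val_inj; apply: prefix_anti p1; apply: h1; rewrite -eu tN eu.
  by rewrite sg -?eu // eu gs ?node_lt // convK eqxx.
rewrite tN sg // eu gs ?node_lt // convK eqxx /= => /forallP[] t'; apply/implyP => /andP[t'N].
by rewrite sg // => /eqP/conv_inr/gp[].
Qed.

End Guest.
End Words.

Theorem theorem3 (b l k m r : nat) (hb : 0 < b) (hl : 1 < l) (hk : 0 < k)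
    (hm : 0 < m) (hr : 0 < r) (hkm : k <= m) :
  exists2 n0 : nat, 0 < n0 &
    forall n : nat, n0 <= n ->
    forall L : finType, #|L| = l ->
    forall C : finType, #|C| = r ->
    forall c : {g : word b n L | g \in Wv b n L k} -> C,
    exists2 f : word b n L, f \in Wv b n L m &
      monochromatic c (Wv_in k f).
Proof.
pose d0 := Ordinal hb; pose l0 : 'I_l := Ordinal (ltnW hl).
pose M := size (pos d0 (nseq m d0)).
(* The ranking contains the root, so the list of kinds has a first element. *)
case E : (map (kind 'I_l d0) (rev (ranked k d0))) => [|kd ks].
  have := mem_ranked d0 ([bseq] : node b k); rewrite -mem_rev.
  by case: (rev _) E.
(* The bound has to precede the alphabet and the colours; both are therefore replaced by the
   ordinals ['I_l] and ['I_r]. *)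
have [N [MN HN]] := ramsey_objects d0 l0 (@inl 'I_l (node b k)) kd ks M (option 'I_r).
exists N.+1 => // n Nn L Ll C Cr c; have n_gt0 : 0 < n by apply: leq_trans Nn.
pose el (a : 'I_l) : L := enum_val (cast_ord (esym Ll) a).
pose le (a : L) : 'I_l := cast_ord Ll (enum_rank a).
have elK : cancel el le by move=> a; rewrite /le /el enum_valK cast_ordKV.
have leK : cancel le el by move=> a; rewrite /le /el cast_ordK enum_rankK.
(* A map that does not decode to a variable word of the required kind gets the additional colour
   [None]. *)
pose colour H : option 'I_r := omap (fun g => cast_ord Cr (enum_rank (c g)))
  (insub (decode (k := k) N n l0 el H)).
have [|f [fN Hf]] := HN colour.
  by move=> H H' e; rewrite /colour (decode_lt n l0 el e).
exists (host m N n d0 l0 el f).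
  by apply: host_Wv hk hkm n_gt0 (ltnW Nn) fN.
have L_gt1 : 1 < #|L| by rewrite Ll.
move=> g g' hg hg'.
have [p [h [y [pM oh ch hM dg]]]] := guest_object elK leK hk hkm n_gt0 (ltnW Nn) fN L_gt1 hg.
have [p' [h' [y' [pM' oh' ch' hM' dg']]]] :=
  guest_object elK leK hk hkm n_gt0 (ltnW Nn) fN L_gt1 hg'.
rewrite E in oh oh'.
have := Hf p p' h y h' y' pM pM' oh oh' _ _ hM hM'.
rewrite /colour dg dg' !valK /=.
by move=> e; have /Some_inj/cast_ord_inj/enum_rank_inj := e
  (fun x px => ch x (proj1 (andP px))) (fun x px => ch' x (proj1 (andP px))).
Qed.
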